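(* Let $\mathbb{X}$ be a metric measure space with a polar decomposition at $a\in\mathbb{X}$. Let $0<q<\infty$, $1<p_1,p_2<\infty$, and let $u,v_1,v_2$ be weight functions, positive a.e. in $\mathbb{X}$, such that $u\in L^1_{loc}(\mathbb{X}\setminus\{a\})$ and $v_i^{1-p_i'}\in L^1_{loc}(\mathbb{X})$ for $i=1,2$. Set $$U(x)=\int_{\mathbb{X}\setminus B(a,|x|_a)}u(y)\,dy,\qquad V_i(x)=\int_{B(a,|x|_a)}v_i^{1-p_i'}(y)\,dy,\quad i=1,2 .$$ In each of the cases below, the inequality $$\left(\int_{\mathbb{X}}\left(H_2^B(f_1,f_2)(x)\right)^q u(x)\,dx\right)^{1/q}\le C\left(\int_{\mathbb{X}}f_1(x)^{p_1}v_1(x)\,dx\right)^{1/p_1}\left(\int_{\mathbb{X}}f_2(x)^{p_2}v_2(x)\,dx\right)^{1/p_2}$$ holds (with some finite constant $C$) for all measurable $f_1,f_2\ge0$ if and only if the stated conditions hold. (i) For $1<\max(p_1,p_2)\le q<\infty$: $$\mathcal{D}_1:=\sup_{x\ne a}\left\{U^{\frac1q}(x)\,V_1^{\frac1{p_1'}}(x)\,V_2^{\frac1{p_2'}}(x)\right\}<\infty .$$ (ii) For $q\ge p_1$ and $q<p_2$ with $p_1,p_2,q>1$ and $\frac1{r_2}=\frac1q-\frac1{p_2}$: $\mathcal{D}_1<\infty$ and $$\mathcal{D}_2:=\sup_{x\ne a}V_1^{\frac1{p_1'}}(x)\left\{\int_{\mathbb{X}\setminus B(a,|x|_a)}U^{\frac{r_2}{q}}(y)\,V_2^{\frac{r_2}{q'}}(y)\,v_2^{1-p_2'}(y)\,dy\right\}^{\frac1{r_2}}<\infty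 .$$ (iii) For $q<p_1$ and $q<p_2$ with $p_1,p_2,q>1$, $\frac1q\le\frac1{p_1}+\frac1{p_2}$, and $\frac1{r_i}=\frac1q-\frac1{p_i}$, $i=1,2$: $\mathcal{D}_1<\infty$, $\mathcal{D}_2<\infty$ (with $\mathcal{D}_1$, $\mathcal{D}_2$ given by the formulas in (i) and (ii)), and $$\mathcal{D}_3:=\sup_{x\ne a}V_2^{\frac1{p_2'}}(x)\left\{\int_{\mathbb{X}\setminus B(a,|x|_a)}U^{\frac{r_1}{q}}(y)\,V_1^{\frac{r_1}{q'}}(y)\,v_1^{1-p_1'}(y)\,dy\right\}^{\frac1{r_1}}<\infty .$$ (iv) For $q<p_1$ and $q<p_2$ with $p_1,p_2,q>1$, $\frac1q>\frac1{p_1}+\frac1{p_2}$, $\frac1{r_i}=\frac1q-\frac1{p_i}$, $i=1,2$, and $\frac1k=\frac1q-\frac1{p_1}-\frac1{p_2}$: $$\mathcal{D}_4:=\left\{\int_{\mathbb{X}}U^{\frac{k}{p_1}+\frac{k}{p_2}}(y)\,V_1^{\frac{k}{p_1'}}(y)\,V_2^{\frac{k}{p_2'}}(y)\,u(y)\,dy\right\}^{\frac1k}<\infty,$$ $$\mathcal{D}_5:=\left\{\int_{\mathbb{X}}\left\{\int_{\mathbb{X}\setminus B(a,|x|_a)}U^{\frac{r_2}{q}}(y)\,V_2^{\frac{r_2}{q'}}(y)\,v_2^{1-p_2'}(y)\,dy\right\}^{\frac{k}{r_2}}V_1^{\frac{k}{r_2'}}(x)\,v_1^{1-p_1'}(x)\,dx\right\}^{\frac1k}<\infty,$$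 and $$\mathcal{D}_6:=\left\{\int_{\mathbb{X}}\left\{\int_{\mathbb{X}\setminus B(a,|x|_a)}U^{\frac{r_1}{q}}(y)\,V_1^{\frac{r_1}{q'}}(y)\,v_1^{1-p_1'}(y)\,dy\right\}^{\frac{k}{r_1}}V_2^{\frac{k}{r_1'}}(x)\,v_2^{1-p_2'}(x)\,dx\right\}^{\frac1k}<\infty .$$
   Context: A metric measure space with a polar decomposition at a fixed point $a\in\mathbb{X}$ is a metric space $(\mathbb{X},d)$ with a Borel measure $dx$ such that there is a function $\lambda\in L^1_{loc}$ with $$\int_{\mathbb{X}}g(x)\,dx=\int_0^\infty\int_{\Sigma_r}g(r,\omega)\,\lambda(r,\omega)\,d\omega_r\,dr$$ for all $g\in L^1(\mathbb{X})$, where $\Sigma_r=\{x\in\mathbb{X}:d(x,a)=r\}$ is equipped with a measure denoted $d\omega_r$, a point $x\in\Sigma_r$ is written $x=(r,\omega)$, and $(r,\omega)\to a$ as $r\to0$. The function $\lambda$ may depend on the whole variable $x=(r,\omega)$. No doubling condition is assumed on the measure. Notation: $|x|_a:=d(a,x)$; $B(a,r):=\{x\in\mathbb{X}:d(x,a)<r\}$; for an exponent $p>1$, $p'$ is the conjugate exponent, $\frac1p+\frac1{p'}=1$ (likewise $q'$, $r_1'$, $r_2'$); and $$H_2^B(f_1,f_2)(x):=\int_{B(a,|x|_a)}f_1(y)\,dy\;\int_{B(a,|x|_a)}f_2(y)\,dy .$$ *)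

(* Defs.v *)
From HB Require Import structures.
From mathcomp Require Import all_boot all_order all_algebra.
From mathcomp Require Import all_classical all_reals all_analysis.

Set Implicit Arguments.
Unset Strict Implicit.
Unset Printing Implicit Defensive.

Import Order.TTheory GRing.Theory Num.Theory.
Import numFieldNormedType.Exports.

Local Open Scope classical_set_scope.
Local Open Scope ring_scope.

HB.mixin Record Metric_isBorel (d : measure_display) (K : numDomainType) T
    & Metric K T & Measurable d T := {
  borel_measurableE : @measurable d T = <<s (@open T) >> }.

#[short(type="borelMetricType")]
HB.structure Definition BorelMetric d (K : numDomainType) :=
  {T of Metric K T & Measurable d T & Metric_isBorel d K T}.

Definition conjugate_exponent {R : realType} (p : R) : R := p / (p - 1).

Notation "p ^'" := (conjugate_exponent p) : ring_scope.

Section metric_measure_space.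
Context {d : measure_display} {R : realType} {X : borelMetricType d R}.
Variables (mu : {measure set X -> \bar R}) (a : X).
Local Open Scope ereal_scope.

(* Local integrability is tested on the bounded measurable sets at positive
   distance from the complement of D; for D = setT these are the bounded
   measurable sets. When closed balls are compact this is integrability on the
   compact subsets of D. No local compactness is available here: in general,
   integrability on compact sets alone would give no control on the integrals
   over balls. *)
Definition metric_locally_integrable (D : set X) (f : X -> R) : Prop :=
  [/\ open D, measurable_fun D f &
    forall E : set X, measurable E ->
      (exists x (M : R), forall y, E y -> (mdist x y <= M)%R) ->
      (exists2 e : R, (0 < e)%R &
        forall x y, E x -> ~ D y -> (e <= mdist x y)%R) ->
      \int[mu]_(x in E) `|f x|%:E < +oo].

Definition metric_sphere (r : R) : set X := [set x | mdist x a = r].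

(* sigma r is the measure on the sphere of radius r; it is a Borel measure on X
   that is only ever integrated over that sphere. The first two conclusions say
   that the iterated integral makes sense. The requirement that
   (r, omega) --> a as r --> 0 is automatic, since mdist (r, omega) a = r. *)
Definition polar_decomposition : Prop :=
  exists (lambda : X -> R) (sigma : R -> {measure set X -> \bar R}),
    metric_locally_integrable setT lambda /\
    forall g : X -> R, mu.-integrable setT (EFin \o g) ->
      [/\ {ae @lebesgue_measure R, forall r : R, (0 < r)%R ->
            (sigma r).-integrable (metric_sphere r)
              (fun x => (g x * lambda x)%:E)},
          (@lebesgue_measure R).-integrable `]0%R, +oo[
            (fun r : R =>
              \int[sigma r]_(x in metric_sphere r) (g x * lambda x)%:E) &
          \int[mu]_x (g x)%:E =
          \int[@lebesgue_measure R]_(r in `]0%R, +oo[)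
            \int[sigma r]_(x in metric_sphere r) (g x * lambda x)%:E].

Definition centered_ball (x : X) : set X := ball a (mdist a x).

Definition H2B (f1 f2 : X -> R) (x : X) : \bar R :=
  (\int[mu]_(y in centered_ball x) (f1 y)%:E) *
  (\int[mu]_(y in centered_ball x) (f2 y)%:E).

Definition bilinear_hardy (q p1 p2 : R) (u v1 v2 : X -> R) : Prop :=
  exists2 C : R, (0 <= C)%R & forall f1 f2 : X -> R,
    measurable_fun setT f1 -> measurable_fun setT f2 ->
    (forall x, (0 <= f1 x)%R) -> (forall x, (0 <= f2 x)%R) ->
    (\int[mu]_x ((H2B f1 f2 x) `^ q * (u x)%:E)) `^ q^-1 <=
    C%:E * (\int[mu]_x (f1 x `^ p1 * v1 x)%:E) `^ p1^-1
         * (\int[mu]_x (f2 x `^ p2 * v2 x)%:E) `^ p2^-1.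

Definition dual_weight (p : R) (v : X -> R) (x : X) : R :=
  (v x `^ (1 - p^'))%R.

Definition hardyU (u : X -> R) (x : X) : \bar R :=
  \int[mu]_(y in ~` centered_ball x) (u y)%:E.

Definition hardyV (p : R) (v : X -> R) (x : X) : \bar R :=
  \int[mu]_(y in centered_ball x) (dual_weight p v y)%:E.

(* The conditions below take values in [0, +oo], with 0 * +oo = 0. *)

Definition hardyD1 (q p1 p2 : R) (u v1 v2 : X -> R) : \bar R :=
  ereal_sup [set (hardyU u x) `^ q^-1 * (hardyV p1 v1 x) `^ (p1^')^-1
                 * (hardyV p2 v2 x) `^ (p2^')^-1 | x in [set~ a]].

Definition hardy_tail (q r p : R) (u v : X -> R) (x : X) : \bar R :=
  \int[mu]_(y in ~` centered_ball x)
    ((hardyU u y) `^ (r / q) * (hardyV p v y) `^ (r / q^')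
     * (dual_weight p v y)%:E).

Definition hardyD2 (q p1 p2 r2 : R) (u v1 v2 : X -> R) : \bar R :=
  ereal_sup [set (hardyV p1 v1 x) `^ (p1^')^-1
                 * (hardy_tail q r2 p2 u v2 x) `^ r2^-1 | x in [set~ a]].

Definition hardyD3 (q p1 p2 r1 : R) (u v1 v2 : X -> R) : \bar R :=
  ereal_sup [set (hardyV p2 v2 x) `^ (p2^')^-1
                 * (hardy_tail q r1 p1 u v1 x) `^ r1^-1 | x in [set~ a]].

Definition hardyD4 (p1 p2 k : R) (u v1 v2 : X -> R) : \bar R :=
  (\int[mu]_y ((hardyU u y) `^ (k / p1 + k / p2)
               * (hardyV p1 v1 y) `^ (k / p1^')
               * (hardyV p2 v2 y) `^ (k / p2^') * (u y)%:E)) `^ k^-1.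

Definition hardyD5 (q p1 p2 r2 k : R) (u v1 v2 : X -> R) : \bar R :=
  (\int[mu]_x ((hardy_tail q r2 p2 u v2 x) `^ (k / r2)
               * (hardyV p1 v1 x) `^ (k / r2^')
               * (dual_weight p1 v1 x)%:E)) `^ k^-1.

Definition hardyD6 (q p1 p2 r1 k : R) (u v1 v2 : X -> R) : \bar R :=
  (\int[mu]_x ((hardy_tail q r1 p1 u v1 x) `^ (k / r1)
               * (hardyV p2 v2 x) `^ (k / r1^')
               * (dual_weight p2 v2 x)%:E)) `^ k^-1.

End metric_measure_space.

(* Main.v *)
Require Import Defs.
From HB Require Import structures.
From mathcomp Require Import all_boot all_order all_algebra.
From mathcomp Require Import all_classical all_reals all_analysis.
From mathcomp Require Import measurable_realfun ring lra.

(** The only consequence of the polar decomposition that matters is that the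
    spheres centred at a are null ([polar_sphere_null]): what is integrated over
    a single radius does not contribute. The measure is sigma-finite, because
    the dual weights are a.e. positive and have finite mass on balls
    ([weight_sigma_finite]), so Tonelli's theorem applies. Substituting
    f_i = g_i w_i, where w_i = v_i^(1-p_i') is the dual weight, turns the norm of
    f_i into the norm of g_i in L^(p_i)(w_i). Everything then takes place on a
    measure space with a radius function rho, for the operators
    inner f (x), the integral of f over the points of smaller radius, and
    outer f (x), the integral over the other points. In these terms U = outer u
    and V_i = inner w_i.

    Three facts about a nonnegative f, with F = inner f, replace one-variable
    calculus. The operators inner and outer are adjoint to each other
    ([inner_outer_adjoint]). The f-mass of the set where F is at most s is at
    most s ([inner_sublevel]). Consequently F^q is at most a constant times
    inner (F^(q-1) f) ([inner_poweR_le]), and there is a similar product rule for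
    F_1^q F_2^q ([inner_poweR_mul_le]): the part of a ball where F exceeds half
    of its value on the boundary carries at least half of the f-mass, and two
    such parts are nested.

    Sufficiency. By the product rule and adjointness, the left-hand side of the
    bilinear inequality is at most a constant times the sum of the integral of
    U F_2^q F_1^(q-1) f_1 and of the symmetric term. The integral of
    Psi F^(q-1) g w, with F = inner (g w), is estimated by Hoelder's inequality
    and the boundedness on L^p(w) of the mean F / V ([maximal_average]): in terms
    of the supremum of Psi V^(q/p') when p <= q ([power_term_le]), and of the
    integral of Psi^(r/q) V^(r/q') w, where 1/r = 1/q - 1/p, when q < p
    ([power_term_lt]). For Psi = U F_2^q and p_1 <= q, the pointwise bound on F_2
    given by Hoelder's inequality leads to the first condition. When q < p_1,
    the integral that appears is that of F_2^(r_1) against the weight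
    U^(r_1/q) V_1^(r_1/q') w_1, and the linear Hardy inequality, for exponents
    p_2 and r_1, leads to the third condition when p_2 <= r_1 and to the sixth
    one when r_1 < p_2.

    Necessity. Indicators of balls give the first condition. For the linear
    inequality with q < p, the test function U_n^(r/(pq)) V^(r/(pq')), where U_n
    comes from a truncated weight, gives two equivalent integral conditions
    ([hardy_lt_necessary]). Testing one function on the indicator of a ball and
    applying this to the other one gives the second and the third conditions.
    In the last case the linear result is applied twice: with g_2 fixed, its
    conclusions for g_1 are again linear Hardy inequalities for g_2
    ([bilinear_bound_iterated]), whose necessary conditions are the fourth,
    the fifth and the sixth ones. *)

Set Implicit Arguments.
Unset Strict Implicit.
Unset Printing Implicit Defensive.

Import Order.TTheory GRing.Theory Num.Theory.
Import numFieldNormedType.Exports.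

Local Open Scope classical_set_scope.
Local Open Scope ring_scope.
Local Open Scope ereal_scope.

(** * Powers of extended reals and nonnegative measurable functions *)

Section extended_powers.
Context {R : realType}.
Implicit Types (x y : \bar R) (r s : R).

Lemma le_poweR r x y : (0 <= r)%R -> 0 <= x -> x <= y -> x `^ r <= y `^ r.
Proof.
move=> r0 x0 xy; apply: gt0_ler_poweR => //; rewrite in_itv/= ?leey ?andbT//.
exact: le_trans xy.
Qed.

Lemma poweRD_ge0 x r s : (0 <= r)%R -> (0 <= s)%R ->
  x `^ (r + s) = x `^ r * x `^ s.
Proof.
move=> r0 s0; have [rs0|rs0] := eqVneq (r + s)%R 0%R.
  have [-> ->] : r = 0%R /\ s = 0%R by split; lra.
  by rewrite addr0 !poweRe0 mule1.
by rewrite poweRD// add_neq0_poweRD_def.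
Qed.

Lemma poweRK x r : r != 0%R -> 0 <= x -> (x `^ r) `^ r^-1 = x.
Proof. by move=> r0 x0; rewrite -poweRrM mulfV// poweRe1. Qed.

Lemma poweRVK x r : r != 0%R -> 0 <= x -> (x `^ r^-1) `^ r = x.
Proof. by move=> r0 x0; rewrite -poweRrM mulVf// poweRe1. Qed.

(** A self-improving bound: a finite x that is at most a multiple of a smaller
    power of itself is bounded by a constant. *)
Lemma le_poweR_absorb x (B : R) (t : R) : 0 <= x -> x < +oo -> (0 <= B)%R ->
  (0 < t < 1)%R -> x <= B%:E * x `^ t -> x <= (B `^ (1 - t)^-1)%:E.
Proof.
case: x => // x; rewrite lee_fin => x0 _ B0 /andP[t0 t1].
rewrite poweR_EFin -EFinM !lee_fin => xB.
have [->|xn0] := eqVneq x 0%R; first exact: powR_ge0.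
have xp : (0 < x)%R by rewrite lt_neqAle eq_sym xn0.
have t1' : (0 < 1 - t)%R by lra.
have x1t : (x `^ (1 - t) <= B)%R.
  rewrite -(@ler_pM2r _ (x `^ t)) ?powR_gt0// -powRD; last first.
    by rewrite (negbTE xn0) implybT.
  by rewrite subrK powRr1.
rewrite -[leLHS](powRr1 x0) -[1%R in leLHS](mulfV (lt0r_neq0 t1')) powRrM.
by apply: ge0_ler_powR => //; rewrite ?nnegrE ?powR_ge0// ?invr_ge0 ltW.
Qed.

End extended_powers.

(** The nonnegative measurable extended-real functions. *)
Definition nn_measurable d (T : measurableType d) (R : realType)
  (f : T -> \bar R) : Prop := measurable_fun setT f /\ forall x, 0 <= f x.

Section nn_measurable.
Context d (T : measurableType d) (R : realType).
Implicit Types f g : T -> \bar R.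

Lemma nn_measurableD f g : nn_measurable f -> nn_measurable g ->
  nn_measurable (fun x => f x + g x).
Proof.
move=> [mf f0] [mg g0]; split; first exact: emeasurable_funD.
by move=> x; rewrite adde_ge0.
Qed.

Lemma nn_measurableM f g : nn_measurable f -> nn_measurable g ->
  nn_measurable (fun x => f x * g x).
Proof.
move=> [mf f0] [mg g0]; split; first exact: emeasurable_funM.
by move=> x; rewrite mule_ge0.
Qed.

Lemma nn_measurable_poweR f r : nn_measurable f ->
  nn_measurable (fun x => f x `^ r).
Proof.
move=> [mf f0]; split; last by move=> x; rewrite poweR_ge0.
exact: (measurableT_comp (measurable_poweR _) mf).
Qed.

Lemma nn_measurable_cst (k : \bar R) : 0 <= k ->
  nn_measurable (fun _ : T => k).
Proof. by move=> k0; split. Qed.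

Lemma nn_measurable_EFin (f : T -> R) : measurable_fun setT f ->
  (forall x, (0 <= f x)%R) -> nn_measurable (fun x => (f x)%:E).
Proof. by move=> mf f0; split => //; exact/measurable_EFinP. Qed.

Lemma nn_measurable_indic (A : set T) : measurable A ->
  nn_measurable (fun x => (\1_A x)%:E : \bar R).
Proof.
move=> mA; apply: nn_measurable_EFin => [|x]; last by rewrite indicE ler0n.
exact: measurable_indic.
Qed.

Lemma nn_measurable_ge0 f x : nn_measurable f -> 0 <= f x.
Proof. by case. Qed.

Lemma nn_measurableW f A : nn_measurable f -> measurable_fun A f.
Proof. by case=> mf _; apply: measurable_funS mf. Qed.

End nn_measurable.
#[local] Hint Extern 0 (is_true (_ <= _)) => solve [apply: poweR_ge0] : core.

(* Nonnegative measurability of expressions built from hypotheses with sums,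
   products, powers and indicators. *)
Ltac nnm := repeat first [ assumption | apply: nn_measurableM
  | apply: nn_measurableD | apply: nn_measurable_poweR
  | (apply: nn_measurable_indic; assumption) ].

(** * Integration over balls and their complements *)

Section nonneg_integral.
Context d (T : measurableType d) (R : realType).
Variable mu : {measure set T -> \bar R}.
Implicit Types f g : T -> \bar R.

Lemma nn_le_integral f g : nn_measurable f -> nn_measurable g ->
  (forall x, f x <= g x) -> \int[mu]_x f x <= \int[mu]_x g x.
Proof. by move=> [mf f0] [mg g0] fg; apply: ge0_le_integral. Qed.

Lemma nn_integral_ge0 f A : nn_measurable f -> 0 <= \int[mu]_(x in A) f x.
Proof. by move=> [mf f0]; apply: integral_ge0. Qed.

Lemma nn_integralZl f k : nn_measurable f -> 0 <= k ->
  \int[mu]_x (k * f x) = k * \int[mu]_x f x.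
Proof. by move=> [mf f0] k0; rewrite ge0_integralZl. Qed.

Lemma nn_integralD f g : nn_measurable f -> nn_measurable g ->
  \int[mu]_x (f x + g x) = \int[mu]_x f x + \int[mu]_x g x.
Proof. by move=> [mf f0] [mg g0]; rewrite ge0_integralD. Qed.

Lemma nn_subset_integral f A B : nn_measurable f -> measurable A ->
  measurable B -> A `<=` B -> \int[mu]_(x in A) f x <= \int[mu]_(x in B) f x.
Proof.
by move=> nf mA mB AB; apply: ge0_subset_integral => //;
  [exact: nn_measurableW|move=> *; exact: nn_measurable_ge0].
Qed.

Lemma nn_integral_indic f A : measurable A ->
  \int[mu]_(x in A) f x = \int[mu]_x (f x * (\1_A x)%:E).
Proof.
move=> mA; rewrite integral_mkcond; apply: eq_integral => x _.
by rewrite patchE indicE; case: (x \in A); rewrite ?mule1 ?mule0.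
Qed.

Lemma nn_integralU_null f A N : nn_measurable f -> measurable A ->
  measurable N -> mu N = 0 ->
  \int[mu]_(x in A `|` N) f x = \int[mu]_(x in A) f x.
Proof.
move=> nf mA mN N0.
rewrite (@ge0_negligible_integral _ _ _ mu (A `|` N) N)//; last 3 first.
- exact: measurableU.
- exact: nn_measurableW.
- by move=> *; exact: nn_measurable_ge0.
rewrite [RHS](@ge0_negligible_integral _ _ _ mu A N)//; last 2 first.
- exact: nn_measurableW.
- by move=> *; exact: nn_measurable_ge0.
by rewrite setDUl setDv setU0.
Qed.

(** Continuity from below, for sets known up to a null set. *)
Lemma nn_integral_bigcup_le f (F : (set T)^nat) (D N : set T) s :
  nn_measurable f -> nondecreasing_seq F -> (forall n, measurable (F n)) ->
  measurable D -> measurable N -> mu N = 0 ->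
  (forall n, \int[mu]_(x in F n) f x <= s) ->
  D `<=` \bigcup_n F n `|` N -> \int[mu]_(x in D) f x <= s.
Proof.
move=> nf ndF mF mD mN N0 Fs DF.
have mU : measurable (\bigcup_n F n) by exact: bigcupT_measurable.
apply: (le_trans (nn_subset_integral nf mD _ DF)); first exact: measurableU.
rewrite nn_integralU_null//.
have h := @ge0_nondecreasing_set_cvg_integral _ _ _ F f mu ndF mF
  (fun i => nn_measurableW nf) (fun i x _ => nn_measurable_ge0 x nf).
rewrite -(cvg_lim _ h)//; apply: lime_le; first by apply/cvg_ex; eexists; exact: h.
by near=> n; exact: Fs.
Unshelve. all: by end_near. Qed.

End nonneg_integral.

Section radial_operators.
Context d (T : measurableType d) (R : realType).
Variables (mu : {measure set T -> \bar R}) (rho : T -> R).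

(** The points of radius less than that of x, for the radius function rho. *)
Definition below (x : T) : set T := [set y | (rho y < rho x)%R].

(** The Hardy operator: the integral of f over the points of radius less than
    that of x. *)
Definition inner_integral (f : T -> \bar R) x := \int[mu]_(y in below x) f y.

(** The dual Hardy operator: the integral of f over the points of radius at
    least that of x. *)
Definition outer_integral (f : T -> \bar R) x := \int[mu]_(y in ~` below x) f y.

End radial_operators.

Section radial.
Context d (T : measurableType d) (R : realType).
Variables (mu : {sigma_finite_measure set T -> \bar R}) (rho : T -> R).
Hypothesis mrho : measurable_fun setT rho.
Hypothesis sphere0 : forall r, mu [set x | rho x = r] = 0.
Implicit Types f g w : T -> \bar R.

Local Notation below := (below rho).
Local Notation inner := (inner_integral mu rho).
Local Notation outer := (outer_integral mu rho).

Lemma measurable_sphere r : measurable [set x | rho x = r].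
Proof.
by have := mrho measurableT (measurable_set1 r); rewrite setTI.
Qed.

Lemma measurable_lt_radius r : measurable [set x | (rho x < r)%R].
Proof.
have -> : [set x | (rho x < r)%R] = rho @^-1` `]-oo, r[.
  by apply/seteqP; split => x; rewrite /= in_itv.
by rewrite -[X in measurable X]setTI; exact: mrho.
Qed.

Lemma measurable_le_radius r : measurable [set x | (rho x <= r)%R].
Proof.
have -> : [set x | (rho x <= r)%R] = rho @^-1` `]-oo, r].
  by apply/seteqP; split => x; rewrite /= in_itv.
by rewrite -[X in measurable X]setTI; exact: mrho.
Qed.

Lemma measurable_gt_radius r : measurable [set x | (r < rho x)%R].
Proof.
have -> : [set x | (r < rho x)%R] = ~` [set x | (rho x <= r)%R].
  by apply/seteqP; split => x /=; rewrite ltNge => /negP.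
exact/measurableC/measurable_le_radius.
Qed.

Lemma measurable_below x : measurable (below x).
Proof. exact: measurable_lt_radius. Qed.
Hint Resolve measurable_below : core.

Lemma measurable_belowC x : measurable (~` below x).
Proof. exact: measurableC. Qed.
Hint Resolve measurable_belowC : core.

Let K := [set z : T * T | (rho z.2 < rho z.1)%R].
Let mK : measurable K.
Proof.
rewrite -[K]setTI.
have -> : K = (fun z : T * T => rho z.2 - rho z.1)%R @^-1` `]-oo, 0%R[.
  by apply/seteqP; split => z; rewrite /K/= in_itv/= subr_lt0.
apply: measurable_funB => //; exact: measurableT_comp.
Qed.

Lemma nn_measurable_inner f : nn_measurable f -> nn_measurable (inner f).
Proof.
move=> nf; split=> [|x]; last exact: nn_integral_ge0.
have mk : nn_measurable (fun z : T * T => f z.2 * (\1_K z)%:E).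
  apply: nn_measurableM; last exact: nn_measurable_indic.
  by split=> [|z]; [apply: measurableT_comp => //; exact: (nn_measurableW nf)|
     exact: (nn_measurable_ge0 _ nf)].
have := @measurable_fun_fubini_tonelli_F _ _ T T R mu _ mk.1 mk.2.
apply: eq_measurable_fun => x _; rewrite /fubini_F /inner_integral [RHS]nn_integral_indic//.
Qed.

Lemma nn_measurable_outer f : nn_measurable f -> nn_measurable (outer f).
Proof.
move=> nf; split=> [|x]; last exact: nn_integral_ge0.
have mk : nn_measurable (fun z : T * T => f z.2 * (\1_(~` K) z)%:E).
  apply: nn_measurableM; last by apply: nn_measurable_indic; exact: measurableC.
  by split=> [|z]; [apply: measurableT_comp => //; exact: (nn_measurableW nf)|
     exact: (nn_measurable_ge0 _ nf)].
have := @measurable_fun_fubini_tonelli_F _ _ T T R mu _ mk.1 mk.2.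
apply: eq_measurable_fun => x _; rewrite /fubini_F /outer_integral [RHS]nn_integral_indic//.
Qed.

(** The spheres being null, the outer integral may omit the sphere of x. *)
Lemma outerE f x : nn_measurable f ->
  outer f x = \int[mu]_(y in [set y | (rho x < rho y)%R]) f y.
Proof.
move=> nf; rewrite /outer_integral.
have -> : ~` below x = [set y | (rho x < rho y)%R] `|` [set y | rho y = rho x].
  apply/seteqP; split => y; rewrite /below/=.
    by move/negP; rewrite -leNgt le_eqVlt => /orP[/eqP->|]; [right|left].
  by move=> [xy|->]; rewrite ?ltxx//; apply/negP; rewrite -leNgt ltW.
rewrite nn_integralU_null//.
- exact: measurable_gt_radius.
- exact: measurable_sphere.
- exact: sphere0.
Qed.

(** Tonelli's theorem makes the two operators adjoint to each other. *)
Lemma inner_outer_adjoint f g : nn_measurable f -> nn_measurable g ->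
  \int[mu]_x (f x * inner g x) = \int[mu]_x (g x * outer f x).
Proof.
move=> nf ng.
have mk : nn_measurable (fun z : T * T => f z.1 * g z.2 * (\1_K z)%:E).
  apply: nn_measurableM; last exact: nn_measurable_indic.
  by apply: nn_measurableM; split=> [|z];
    by [apply: measurableT_comp => //; exact: (nn_measurableW nf)|
        apply: measurableT_comp => //; exact: (nn_measurableW ng)|
     exact: (nn_measurable_ge0 _ nf)|exact: (nn_measurable_ge0 _ ng)].
transitivity (\int[mu]_x \int[mu]_y (f x * g y * (\1_K (x, y))%:E)).
  apply: eq_integral => x _; rewrite /inner_integral nn_integral_indic//.
  rewrite -nn_integralZl; last exact: (nn_measurable_ge0 _ nf).
    apply: eq_integral => y _; exact: muleA.
  by apply: nn_measurableM => //; exact: nn_measurable_indic.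
rewrite (fubini_tonelli (fun z : T * T => f z.1 * g z.2 * (\1_K z)%:E) mk.1 mk.2)/=.
apply: eq_integral => y _; rewrite outerE// [in RHS]nn_integral_indic; last first.
  exact: measurable_gt_radius.
have mA := measurable_gt_radius (rho y).
rewrite -nn_integralZl; last exact: (nn_measurable_ge0 _ ng).
  apply: eq_integral => x _; rewrite muleA [g y * _]muleC; congr (_ * _%:E).
by apply: nn_measurableM => //; exact: nn_measurable_indic.
Qed.

End radial.

(** * Sublevel sets of inner integrals and powers of inner integrals *)

Section level_sets.
Context d (T : measurableType d) (R : realType).
Implicit Types f : T -> \bar R.

Lemma measurable_le_level f s : nn_measurable f ->
  measurable [set x | f x <= s].
Proof.
move=> [mf _]; have -> : [set x | f x <= s] = f @^-1` [set` `]-oo, s]%O].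
  by apply/seteqP; split => x; rewrite /= in_itv.
by rewrite -[X in measurable X]setTI; apply: mf => //; exact: emeasurable_itv.
Qed.

Lemma measurable_gt_level f s : nn_measurable f ->
  measurable [set x | s < f x].
Proof.
move=> nf; have -> : [set x | s < f x] = ~` [set x | f x <= s].
  by apply/seteqP; split => x /=; rewrite ltNge => /negP.
exact/measurableC/measurable_le_level.
Qed.

End level_sets.

Section radial_levels.
Context d (T : measurableType d) (R : realType).
Variables (mu : {sigma_finite_measure set T -> \bar R}) (rho : T -> R).
Hypothesis mrho : measurable_fun setT rho.
Hypothesis sphere0 : forall r, mu [set x | rho x = r] = 0.
Implicit Types f g w : T -> \bar R.

Local Notation below := (below rho).
Local Notation inner := (inner_integral mu rho).
Local Notation outer := (outer_integral mu rho).

Let mbelow x : measurable (below x). Proof. exact: measurable_below. Qed.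
Hint Resolve mbelow : core.

Lemma inner_mono f x y : nn_measurable f -> (rho x <= rho y)%R ->
  inner f x <= inner f y.
Proof.
by move=> nf xy; apply: nn_subset_integral => // z /= /lt_le_trans; apply.
Qed.

Lemma outer_mono f x y : nn_measurable f -> (rho x <= rho y)%R ->
  outer f y <= outer f x.
Proof.
move=> nf xy; apply: nn_subset_integral => //; try exact: measurableC.
by apply: subsetC => z /= /lt_le_trans; apply.
Qed.

Lemma outer_le f g x : nn_measurable f -> nn_measurable g ->
  (forall y, (rho x <= rho y)%R -> f y <= g y) -> outer f x <= outer g x.
Proof.
move=> nf ng fg; apply: ge0_le_integral => //.
- exact: measurableC.
- by move=> y _; exact: nn_measurable_ge0.
- exact: nn_measurableW.
- exact: nn_measurableW.
- by move=> y /negP; rewrite -leNgt; exact: fg.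
Qed.

Lemma outerZl k f x : nn_measurable f -> 0 <= k ->
  outer (fun y => k * f y) x = k * outer f x.
Proof.
move=> nf k0; apply: ge0_integralZl => //.
- exact: measurableC.
- exact: nn_measurableW.
- by move=> y _; exact: nn_measurable_ge0.
Qed.

(** The mass that w gives to a sublevel set of its own distribution function
    is at most the level. As a function of the radius, [inner w] is continuous
    from the left; the sphere of largest radius in the sublevel set is null. *)
Lemma inner_sublevel w s : nn_measurable w -> 0 <= s ->
  \int[mu]_(y in [set y | inner w y <= s]) w y <= s.
Proof.
move=> nw s0.
pose W t := \int[mu]_(y in [set y | (rho y < t)%R]) w y.
have Wle t t' : (t <= t')%R -> W t <= W t'.
  move=> tt'; apply: nn_subset_integral => //; try exact: measurable_lt_radius.
  by move=> z /= /lt_le_trans; apply.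
have mD : measurable [set y | inner w y <= s].
  by apply: measurable_le_level; exact: nn_measurable_inner.
have [[n0 Wn0]|Wn] := pselect (exists n : nat, ~ (W n%:R <= s)); last first.
  apply: (@nn_integral_bigcup_le _ _ _ mu w (fun n => [set y | (rho y < n%:R)%R])
    _ set0) => //.
  - move=> m n mn; apply/subsetPset => z /= /lt_le_trans; apply.
    by rewrite ler_nat.
  - by move=> n; exact: measurable_lt_radius.
  - by move=> n; apply: contrapT => h; apply: Wn; exists n.
  - move=> y _; left; exists (Num.bound `|rho y|)%R => //=.
    exact: le_lt_trans (ler_norm _) (archi_boundP (normr_ge0 _)).
have [[t0 Wt0]|Wt] := pselect (exists t, W t <= s); last first.
  have -> : [set y | inner w y <= s] = set0.
    by apply/seteqP; split => // y /= h; apply: Wt; exists (rho y).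
  by rewrite integral_set0.
pose S := [set t | W t <= s].
have hS : has_sup S.
  split; first by exists t0.
  exists n0%:R => t /= Wt; rewrite leNgt; apply/negP => n0t.
  by apply: Wn0; exact: le_trans (Wle _ _ (ltW n0t)) Wt.
set t := sup S.
apply: (@nn_integral_bigcup_le _ _ _ mu w
  (fun n => [set y | (rho y < t - n.+1%:R^-1)%R]) _ [set y | rho y = t]) => //.
- move=> m n mn; apply/subsetPset => z /= /lt_le_trans; apply.
  by rewrite lerB// lef_pV2 ?posrE ?ltr0n// ler_nat ltnS.
- by move=> n; exact: measurable_lt_radius.
- exact: measurable_sphere.
- exact: sphere0.
- move=> n; have [|e Se te] := @sup_adherent _ S (n.+1%:R^-1) _ hS.
    by rewrite invr_gt0.
  exact: le_trans (Wle _ _ (ltW te)) Se.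
- move=> y /= Dy; have : (rho y <= t)%R by apply: ub_le_sup => //; case: hS.
  rewrite le_eqVlt => /orP[/eqP ->|yt]; [by right|left].
  by have [n yn] := ltr_add_invr yt; exists n => //=; rewrite ltrBrDr.
Qed.

(** The part of the ball below x in which the inner integral of f exceeds half
    of its value at x. *)
Definition upper_half f x :=
  below x `&` [set y | 2^-1%:E * inner f x < inner f y].

Lemma measurable_upper_half f x : nn_measurable f ->
  measurable (upper_half f x).
Proof.
move=> nf; apply: measurableI => //; apply: measurable_gt_level.
exact: nn_measurable_inner.
Qed.

(** The upper half carries at least half of the mass, since the rest is a
    sublevel set of the inner integral. *)
Lemma upper_half_ge f x : nn_measurable f -> inner f x < +oo ->
  2^-1%:E * inner f x <= \int[mu]_(y in upper_half f x) f y.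
Proof.
move=> nf fin; set m := inner f x.
have m0 : 0 <= m by exact: nn_integral_ge0.
have mE : m \is a fin_num by rewrite ge0_fin_numE.
have mH := measurable_upper_half x nf.
pose D := [set y | inner f y <= 2^-1%:E * m].
have mD : measurable D by apply: measurable_le_level; exact: nn_measurable_inner.
have hm0 : 0 <= 2^-1%:E * m by rewrite mule_ge0// lee_fin invr_ge0.
have : m <= 2^-1%:E * m + \int[mu]_(y in upper_half f x) f y.
  apply: (@le_trans _ _ (\int[mu]_(y in D `|` upper_half f x) f y)).
    apply: nn_subset_integral => //; first exact: measurableU.
    by move=> y xy; have [h|h] := leP (inner f y) (2^-1%:E * m); [left|right].
  rewrite ge0_integral_setU//.
  - by rewrite leeD2r//; exact: inner_sublevel.
  - exact: nn_measurableW.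
  - by move=> *; exact: nn_measurable_ge0.
  - apply/disj_setPS => y [/= Dy [_ /=]].
    by rewrite ltNge Dy.
case: (m) mE (\int[mu]_(y in _) f y) => [r| |]// _ [J| |].
- by rewrite -!EFinM -!EFinD !lee_fin => h; lra.
- by move=> _; rewrite leey.
- by rewrite addeNy leeNy_eq.
Qed.

(** The q-th power of the inner integral F of f is controlled by the integral
    of its derivative F^(q-1) f: on the upper half, F is at least half of its
    value at x. *)
Lemma inner_poweR_le f x (q : R) : nn_measurable f -> inner f x < +oo ->
  (1 <= q)%R ->
  inner f x `^ q <=
  (2 `^ q)%:E * inner (fun y => inner f y `^ (q - 1) * f y) x.
Proof.
move=> nf fin q1; set m := inner f x.
have m0 : 0 <= m by exact: nn_integral_ge0.
have nF := nn_measurable_inner mu mrho nf.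
have mH := measurable_upper_half x nf.
have nFf : nn_measurable (fun y => inner f y `^ (q - 1) * f y) by nnm.
have h0 : 0 <= 2^-1%:E * m by rewrite mule_ge0// lee_fin invr_ge0.
have -> : m `^ q = (2 `^ q)%:E * ((2^-1%:E * m) `^ (q - 1) * (2^-1%:E * m)).
  rewrite -{2}(poweRe1 h0) -poweRD_ge0// ?subr_ge0// subrK poweRM//.
  by rewrite muleA -EFinM -powRM// mulfV// powR1 mul1e.
apply: lee_wpmul2l; first by rewrite lee_fin powR_ge0.
apply: (@le_trans _ _ (\int[mu]_(y in upper_half f x)
    ((2^-1%:E * m) `^ (q - 1) * f y))); last first.
  apply: (@le_trans _ _ (\int[mu]_(y in upper_half f x)
    (inner f y `^ (q - 1) * f y))).
    apply: ge0_le_integral => //.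
    - by move=> y _; apply: mule_ge0 => //; exact: nn_measurable_ge0.
    - by apply: measurable_funeM; exact: nn_measurableW nf.
    - exact: (nn_measurableW nFf).
    - move=> y [_ /= /ltW h]; apply: lee_wpmul2r; first exact: nn_measurable_ge0.
      by apply: le_poweR; rewrite ?subr_ge0.
  by apply: nn_subset_integral => // y [].
rewrite ge0_integralZl//; last 2 first.
- exact: nn_measurableW.
- by move=> *; exact: nn_measurable_ge0.
by apply: lee_wpmul2l => //; exact: upper_half_ge.
Qed.

End radial_levels.

(** * Weighted Hoelder inequality *)

Section weighted_hoelder.
Context d (T : measurableType d) (R : realType).
Variable mu : {measure set T -> \bar R}.
Implicit Types f g w : T -> \bar R.

Lemma nn_ae_eq_integral f g : nn_measurable f -> nn_measurable g ->
  {ae mu, forall x, f x = g x} -> \int[mu]_x f x = \int[mu]_x g x.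
Proof.
move=> [mf f0] [mg g0] fg; apply: ge0_ae_eq_integral => //.
by apply: filterS fg => x /=.
Qed.

Lemma nn_integral_eq0 f A : nn_measurable f -> measurable A ->
  \int[mu]_(x in A) f x = 0 -> {ae mu, forall x, A x -> f x = 0}.
Proof.
move=> nf mA f0; have /(ae_eq_integral_abs mu mA) : measurable_fun A f.
  exact: nn_measurableW.
case=> h _; apply: h; rewrite -[RHS]f0; apply: eq_integral => x _.
by rewrite gee0_abs// nn_measurable_ge0.
Qed.

Lemma nn_integral_fin_ae f : nn_measurable f -> \int[mu]_x f x < +oo ->
  {ae mu, forall x, f x \is a fin_num}.
Proof.
move=> [mf f0] ffin; have : mu.-integrable setT f.
  apply/integrableP; split => //.
  by under eq_integral do rewrite gee0_abs//.
by move=> /integrable_ae-/(_ measurableT); apply: filterS => x /(_ I).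
Qed.

(** Hoelder's inequality for nonnegative functions, infinite values included. *)
Lemma nn_hoelder f g (p q : R) : nn_measurable f -> nn_measurable g ->
  (0 < p)%R -> (0 < q)%R -> (p^-1 + q^-1 = 1)%R ->
  \int[mu]_x (f x * g x) <=
  (\int[mu]_x (f x `^ p)) `^ p^-1 * (\int[mu]_x (g x `^ q)) `^ q^-1.
Proof.
move=> nf ng p0 q0 pq.
have zero (f1 g1 : T -> \bar R) (r : R) : (0 < r)%R -> nn_measurable f1 ->
    nn_measurable g1 -> \int[mu]_x (f1 x `^ r) = 0 ->
    \int[mu]_x (f1 x * g1 x) = 0.
  move=> r0 nf1 ng1 f10; rewrite -[RHS](integral0 mu setT).
  apply: nn_ae_eq_integral; [by nnm|exact: nn_measurable_cst|].
  have nfr : nn_measurable (fun x => f1 x `^ r) by nnm.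
  apply: filterS (nn_integral_eq0 nfr measurableT f10) => x /= /(_ I) h.
  by rewrite (poweR_eq0_eq0 _ h) ?mul0e// nn_measurable_ge0.
have nfp : nn_measurable (fun x => f x `^ p) by nnm.
have ngq : nn_measurable (fun x => g x `^ q) by nnm.
set A := \int[mu]_x (f x `^ p); set B := \int[mu]_x (g x `^ q).
have A0 : 0 <= A by exact: nn_integral_ge0.
have B0 : 0 <= B by exact: nn_integral_ge0.
have [AE|An0] := eqVneq A 0; first by rewrite (zero _ _ p)// mule_ge0.
have [BE|Bn0] := eqVneq B 0.
  under eq_integral do rewrite muleC.
  by rewrite (zero _ _ q)// mule_ge0.
have Ap : 0 < A `^ p^-1 by rewrite poweR_gt0// lt0e An0.
have Bp : 0 < B `^ q^-1 by rewrite poweR_gt0// lt0e Bn0.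
have [Ay|An] := eqVneq A +oo.
  by rewrite Ay poweRyr ?invr_neq0 ?gt_eqF// gt0_mulye// leey.
have [By|Bn] := eqVneq B +oo.
  by rewrite By poweRyr ?invr_neq0 ?gt_eqF// gt0_muley// leey.
have aef : {ae mu, forall x, f x = (fine (f x))%:E}.
  apply: filterS (nn_integral_fin_ae nfp _); last by rewrite ltey.
  move=> x; case: (f x) (nn_measurable_ge0 x nf) => //= _.
  by rewrite gt_eqF.
have aeg : {ae mu, forall x, g x = (fine (g x))%:E}.
  apply: filterS (nn_integral_fin_ae ngq _); last by rewrite ltey.
  move=> x; case: (g x) (nn_measurable_ge0 x ng) => //= _.
  by rewrite gt_eqF.
have mff : measurable_fun setT (fine \o f).
  by apply: measurableT_comp => //; exact: nn_measurableW.
have mgg : measurable_fun setT (fine \o g).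
  by apply: measurableT_comp => //; exact: nn_measurableW.
have fine0 h x : nn_measurable h -> (0 <= fine (h x : \bar R))%R.
  by move=> nh; apply: fine_ge0; exact: nn_measurable_ge0.
have nff : nn_measurable (fun x => (fine (f x))%:E).
  by apply: nn_measurable_EFin => // x; exact: fine0.
have ngg : nn_measurable (fun x => (fine (g x))%:E).
  by apply: nn_measurable_EFin => // x; exact: fine0.
have := hoelder mu mff mgg p0 q0 pq.
rewrite Lnorm1 unlock.
have -> : \int[mu]_x `|(EFin \o ((fine \o f) \* (fine \o g))%R) x| =
    \int[mu]_x (f x * g x).
  transitivity (\int[mu]_x ((fine (f x))%:E * (fine (g x))%:E)).
    apply: eq_integral => x _ /=.
    by rewrite ger0_norm ?mulr_ge0 ?fine0// EFinM.
  apply: nn_ae_eq_integral; [by nnm|by nnm|].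
  by apply: filterS2 aef aeg => x /= <- <-.
have -> : \int[mu]_x `|(EFin \o (fine \o f)) x| `^ p = A.
  apply: nn_ae_eq_integral; [|by nnm|].
    under eq_fun do rewrite gee0_abs/= ?lee_fin ?fine0//.
    exact: (nn_measurable_poweR p nff).
  by apply: filterS aef => x h; rewrite [in RHS]h /= ger0_norm ?fine0.
have -> : \int[mu]_x `|(EFin \o (fine \o g)) x| `^ q = B.
  apply: nn_ae_eq_integral; [|by nnm|].
    under eq_fun do rewrite gee0_abs/= ?lee_fin ?fine0//.
    exact: (nn_measurable_poweR q ngg).
  by apply: filterS aeg => x h; rewrite [in RHS]h /= ger0_norm ?fine0.
by [].
Qed.

Lemma nn_whoelder f g w (p q : R) : nn_measurable f -> nn_measurable g ->
  nn_measurable w -> (0 < p)%R -> (0 < q)%R -> (p^-1 + q^-1 = 1)%R ->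
  \int[mu]_x (f x * g x * w x) <=
  (\int[mu]_x (f x `^ p * w x)) `^ p^-1 * (\int[mu]_x (g x `^ q * w x)) `^ q^-1.
Proof.
move=> nf ng nw p0 q0 pq.
have E h r : (0 < r)%R -> nn_measurable h -> \int[mu]_x (h x `^ r * w x) =
    \int[mu]_x ((h x * w x `^ r^-1) `^ r).
  move=> r0 nh; apply: eq_integral => x _; rewrite poweRM//.
    by rewrite poweRVK// ?gt_eqF// nn_measurable_ge0.
  exact: nn_measurable_ge0.
rewrite (E f p)// (E g q)//.
have -> : \int[mu]_x (f x * g x * w x) =
    \int[mu]_x ((f x * w x `^ p^-1) * (g x * w x `^ q^-1)).
  apply: eq_integral => x _.
  rewrite muleACA -poweRD_ge0 ?invr_ge0 ?ltW// pq poweRe1//.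
  exact: nn_measurable_ge0.
by apply: nn_hoelder => //; nnm.
Qed.

End weighted_hoelder.

(** * Products of inner integrals, and the reversed radius *)

Section radial_products.
Context d (T : measurableType d) (R : realType).
Variables (mu : {sigma_finite_measure set T -> \bar R}) (rho : T -> R).
Hypothesis mrho : measurable_fun setT rho.
Hypothesis sphere0 : forall r, mu [set x | rho x = r] = 0.
Implicit Types f g w : T -> \bar R.

Local Notation below := (below rho).
Local Notation inner := (inner_integral mu rho).
Local Notation outer := (outer_integral mu rho).

Let nn_inner f (nf : nn_measurable f) : nn_measurable (inner f) :=
  nn_measurable_inner mu mrho nf.

(** Inner integrals are monotone in the radius, so that the upper halves at x
    are nested. *)
Lemma upper_half_total f1 f2 x :
  nn_measurable f1 -> nn_measurable f2 ->
  upper_half mu rho f1 x `<=` upper_half mu rho f2 x \/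
  upper_half mu rho f2 x `<=` upper_half mu rho f1 x.
Proof.
move=> nf1 nf2; have [|] := pselect (upper_half mu rho f1 x `<=`
  upper_half mu rho f2 x); first by left.
move=> /existsNP[y /not_implyP[[yx h1] /not_andP[//|/negP]]].
rewrite -leNgt => h2; right => z [zx h3]; split => //.
apply: (lt_le_trans h1); apply: inner_mono => //.
rewrite leNgt; apply/negP => zy.
have := le_trans (inner_mono mu mrho nf2 (ltW zy)) h2.
by rewrite leNgt h3.
Qed.

(** On the smaller of the two upper halves, both inner integrals are at least
    half of their values at x. *)
Lemma inner_poweR_mul_le_sub f1 f2 x (q : R) :
  nn_measurable f1 -> nn_measurable f2 -> inner f1 x < +oo -> (1 <= q)%R ->
  upper_half mu rho f1 x `<=` upper_half mu rho f2 x ->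
  inner f1 x `^ q * inner f2 x `^ q <=
  (4 `^ q)%:E * inner (fun y => inner f2 y `^ q * inner f1 y `^ (q - 1) * f1 y) x.
Proof.
move=> nf1 nf2 fin1 q1 sub.
set m1 := inner f1 x; set m2 := inner f2 x.
have m10 : 0 <= m1 by exact: nn_integral_ge0.
have m20 : 0 <= m2 by exact: nn_integral_ge0.
have nF1 := nn_inner nf1.
have nF2 := nn_inner nf2.
have mH := @measurable_upper_half _ _ _ mu rho mrho f1 x nf1.
have nFf : nn_measurable
  (fun y => inner f2 y `^ q * inner f1 y `^ (q - 1) * f1 y) by nnm.
have h10 : 0 <= 2^-1%:E * m1 by rewrite mule_ge0// lee_fin invr_ge0.
have h20 : 0 <= 2^-1%:E * m2 by rewrite mule_ge0// lee_fin invr_ge0.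
set c := (2^-1%:E * m2) `^ q * (2^-1%:E * m1) `^ (q - 1).
have c0 : 0 <= c by exact: mule_ge0.
have -> : m1 `^ q * m2 `^ q = (4 `^ q)%:E * (c * (2^-1%:E * m1)).
  rewrite -muleA -{2}(poweRe1 h10) -poweRD_ge0// ?subr_ge0// subrK !poweRM//.
  rewrite muleACA !muleA -!EFinM -!powRM//.
  by rewrite (_ : 4 * 2^-1 * 2^-1 = 1)%R ?powR1 ?mul1e 1?muleC//; field.
apply: lee_wpmul2l; first by rewrite lee_fin powR_ge0.
apply: (@le_trans _ _ (\int[mu]_(y in upper_half mu rho f1 x) (c * f1 y))).
  rewrite ge0_integralZl//; last 2 first.
  - exact: nn_measurableW.
  - by move=> *; exact: nn_measurable_ge0.
  by apply: lee_wpmul2l => //; exact: upper_half_ge.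
apply: (@le_trans _ _ (\int[mu]_(y in upper_half mu rho f1 x)
    (inner f2 y `^ q * inner f1 y `^ (q - 1) * f1 y))).
  apply: ge0_le_integral => //.
  - by move=> y _; apply: mule_ge0 => //; exact: nn_measurable_ge0.
  - by apply: measurable_funeM; exact: nn_measurableW nf1.
  - exact: (nn_measurableW nFf).
  - move=> y Hy; apply: lee_wpmul2r; first exact: nn_measurable_ge0.
    have [_ /= /ltW hy1] := Hy; have [_ /= /ltW hy2] := sub _ Hy.
    by apply: lee_pmul => //; apply: le_poweR; rewrite ?subr_ge0 ?(le_trans _ q1).
by apply: nn_subset_integral => //; [exact: measurable_below|move=> y []].
Qed.

(** The product rule: the product of the q-th powers of two inner integrals is
    controlled by the integral of its derivative. *)
Lemma inner_poweR_mul_le f1 f2 x (q : R) :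
  nn_measurable f1 -> nn_measurable f2 ->
  inner f1 x < +oo -> inner f2 x < +oo -> (1 <= q)%R ->
  inner f1 x `^ q * inner f2 x `^ q <= (4 `^ q)%:E *
   (inner (fun y => inner f2 y `^ q * inner f1 y `^ (q - 1) * f1 y) x +
    inner (fun y => inner f1 y `^ q * inner f2 y `^ (q - 1) * f2 y) x).
Proof.
move=> nf1 nf2 fin1 fin2 q1.
have nF1 := nn_inner nf1.
have nF2 := nn_inner nf2.
have [sub|sub] := upper_half_total x nf1 nf2.
  apply: (le_trans (inner_poweR_mul_le_sub nf1 nf2 fin1 q1 sub)).
  apply: lee_wpmul2l; first by rewrite lee_fin powR_ge0.
  by rewrite leeDl//; apply: nn_integral_ge0; nnm.
rewrite muleC.
apply: (le_trans (inner_poweR_mul_le_sub nf2 nf1 fin2 q1 sub)).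
apply: lee_wpmul2l; first by rewrite lee_fin powR_ge0.
by rewrite leeDr//; apply: nn_integral_ge0; nnm.
Qed.

End radial_products.

(** Reversing the radius exchanges the inner and the outer operators. *)
Section reversed_radius.
Context d (T : measurableType d) (R : realType).
Variables (mu : {sigma_finite_measure set T -> \bar R}) (rho : T -> R).
Hypothesis mrho : measurable_fun setT rho.
Hypothesis sphere0 : forall r, mu [set x | rho x = r] = 0.
Implicit Types f g w : T -> \bar R.

Local Notation outer := (outer_integral mu rho).
Local Notation rho' := (fun x => - rho x)%R.

Let mrho' : measurable_fun setT rho'. Proof. exact: measurableT_comp. Qed.
Let sphere0' r : mu [set x | rho' x = r] = 0.
Proof.
rewrite -[RHS](sphere0 (- r)); congr (mu _).
by apply/seteqP; split => x /= => [<-|->]; rewrite opprK.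
Qed.

Lemma outer_inner_opp f x : nn_measurable f ->
  outer f x = inner_integral mu rho' f x.
Proof.
move=> nf; rewrite (outerE mrho sphere0)//; congr (integral _ _ _).
by apply/seteqP; split => y; rewrite /below/= ltrN2.
Qed.

Lemma outer_poweR_le f x (q : R) : nn_measurable f -> outer f x < +oo ->
  (1 <= q)%R ->
  outer f x `^ q <=
  (2 `^ q)%:E * outer (fun y => outer f y `^ (q - 1) * f y) x.
Proof.
move=> nf; have nF := nn_measurable_outer mu mrho nf.
have E : outer f = inner_integral mu rho' f.
  by apply/funext => y; rewrite outer_inner_opp.
rewrite [X in _ <= _ * X]outer_inner_opp ?E; last by rewrite -E; nnm.
exact: inner_poweR_le.
Qed.

Lemma outer_sublevel w s : nn_measurable w -> 0 <= s ->
  \int[mu]_(y in [set y | outer w y <= s]) w y <= s.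
Proof.
move=> nw s0; have -> : outer w = inner_integral mu rho' w.
  by apply/funext => y; rewrite outer_inner_opp.
exact: inner_sublevel.
Qed.

End reversed_radius.

(** * Means with respect to a weight *)

Lemma powR_exprn (R : realType) (x r : R) (j : nat) : (0 <= x)%R ->
  ((x ^+ j) `^ r = (x `^ r) ^+ j)%R.
Proof.
move=> x0; elim: j => [|j IH]; first by rewrite !expr0 powR1.
by rewrite !exprS powRM ?exprn_ge0// IH.
Qed.

Lemma dyadic_bracket (R : realType) (t : R) : (1 <= t)%R ->
  exists j : nat, (2 ^+ j <= t <= 2 ^+ j.+1)%R.
Proof.
move=> t1; have ex : exists n : nat, (t <= 2 ^+ n)%R.
  exists (Num.bound t); apply/ltW/(lt_le_trans (archi_boundP _)).
    exact: le_trans t1.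
  by rewrite -natrX ler_nat ltnW// ltn_expl.
have [[|j] tj jmin] := ex_minnP ex.
  by exists 0%N; rewrite !expr0 t1/= (le_trans tj)// expr0 expr1 ler1n.
exists j; rewrite tj andbT; case: (leP (2 ^+ j) t)%R => // /ltW /jmin.
by rewrite ltnn.
Qed.

Section maximal.
Context d (T : measurableType d) (R : realType).
Variables (mu : {sigma_finite_measure set T -> \bar R}) (rho : T -> R).
Hypothesis mrho : measurable_fun setT rho.
Hypothesis sphere0 : forall r, mu [set x | rho x = r] = 0.
Implicit Types f g w : T -> \bar R.

Local Notation inner := (inner_integral mu rho).
Local Notation outer := (outer_integral mu rho).

Let nn_inner f (nf : nn_measurable f) : nn_measurable (inner f) :=
  nn_measurable_inner mu mrho nf.

Let mbelow x : measurable (below rho x). Proof. exact: measurable_below. Qed.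
Let mbelowC x : measurable (~` below rho x). Proof. exact: measurableC. Qed.
Hint Resolve mbelow mbelowC : core.

(** Covering A by the sets where h is at most c j and the inner integral of w
    at most s j bounds the integral of h w over A by the sum of the c j s j. *)
Lemma integral_levels_le h w (A : set T) (c s : nat -> R) (K : \bar R) :
  nn_measurable h -> nn_measurable w -> measurable A ->
  (forall j, 0 <= c j)%R -> (forall j, 0 <= s j)%R ->
  (forall y, A y -> exists j, h y <= (c j)%:E /\ inner w y <= (s j)%:E) ->
  (forall n, (\sum_(0 <= j < n) c j * s j)%:E <= K) ->
  \int[mu]_(y in A) (h y * w y) <= K.
Proof.
move=> nh nw mA c0 s0 Acs csK.
pose E j := [set y | inner w y <= (s j)%:E].
have mE j : measurable (E j) by apply: measurable_le_level; exact: nn_inner.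
pose u j y := (c j)%:E * (w y * (\1_(E j) y)%:E).
have nu j : nn_measurable (u j).
  apply: nn_measurableM; first by apply: nn_measurable_cst; rewrite lee_fin.
  by apply: nn_measurableM => //; exact: nn_measurable_indic.
have nhw : nn_measurable (fun y => h y * w y) by nnm.
apply: (@le_trans _ _ (\int[mu]_(y in A) (\sum_(0 <= j <oo) u j y))).
  apply: ge0_le_integral => //.
  - by move=> y _; exact: (nn_measurable_ge0 y nhw).
  - exact: (nn_measurableW nhw).
  - apply: ge0_emeasurable_sum => [j y _|j _]; last exact: nn_measurableW.
    by move=> _; exact: nn_measurable_ge0.
  - move=> y /Acs[j [hj wj]]; have w0 := nn_measurable_ge0 y nw.
    have uy0 i : 0 <= u i y by exact: nn_measurable_ge0.
    apply: (@le_trans _ _ (u j y)).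
      by rewrite /u indicE mem_set// mule1; exact: lee_wpmul2r.
    have := @nneseries_lim_ge _ (u ^~ y) xpredT 0%N j.+1 (fun n _ _ => uy0 n).
    apply: le_trans; rewrite big_nat_recr//= leeDr//.
    exact: sume_ge0.
rewrite integral_nneseries//; last 2 first.
- by move=> j; exact: nn_measurableW.
- by move=> j y _; exact: nn_measurable_ge0.
have us j : \int[mu]_(y in A) u j y <= (c j * s j)%:E.
  apply: (@le_trans _ _ (\int[mu]_y u j y)); first exact: nn_subset_integral.
  rewrite /u nn_integralZl ?lee_fin//; last first.
    by apply: nn_measurableM => //; exact: nn_measurable_indic.
  rewrite -nn_integral_indic// EFinM; apply: lee_wpmul2l; rewrite ?lee_fin//.
  by apply: inner_sublevel => //; rewrite lee_fin.
apply: lime_le.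
  apply: is_cvg_nneseries => j _ _.
  by apply: nn_integral_ge0.
apply: nearW => n; apply: le_trans (csK n).
by rewrite -sumEFin; exact: lee_sum.
Qed.

Lemma geometric_sum_le (K t : R) (n : nat) : (0 <= K)%R -> (0 < t < 1)%R ->
  (\sum_(0 <= j < n) K * t ^+ j <= K / (1 - t))%R.
Proof.
move=> K0 /andP[t0 t1]; have := @geometric_le_lim R n K t K0 t0.
by rewrite ger0_norm ?(ltW t0)// => /(_ t1).
Qed.

(** With V = inner w, the integral of V^(-1/2) w below x is at most a multiple of
    V(x)^(1/2). The level sets where V(y) is about 2^-j V(x) have w-mass at most
    2^-j V(x), and their contributions form a geometric series. *)
Lemma inner_rsqrt : exists2 c : R, (0 <= c)%R & forall w x,
  nn_measurable w -> (forall y, inner w y < +oo) ->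
  inner (fun y => inner w y `^ (- 2^-1) * w y) x <= c%:E * inner w x `^ 2^-1.
Proof.
have t01 : (0 < (2^-1 : R) `^ 2^-1 < 1)%R.
  have e1 : (1 `^ 2^-1 = 1 :> R)%R by rewrite powR1.
  rewrite powR_gt0//= -[ltRHS]e1.
  by apply: gt0_ltr_powR; rewrite ?nnegrE//; lra.
exists (2 `^ 2^-1 / (1 - 2^-1 `^ 2^-1))%R.
  by rewrite divr_ge0 ?powR_ge0// subr_ge0 ltW//; case/andP: t01.
move=> w x nw fin.
have nV := nn_inner nw.
have V0 y : 0 <= inner w y by exact: nn_measurable_ge0.
have finV y : inner w y = (fine (inner w y))%:E.
  by rewrite fineK// ge0_fin_numE.
set v := fine (inner w x).
have v0 : (0 <= v)%R by exact: fine_ge0.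
rewrite [inner w x]finV -/v poweR_EFin -EFinM.
pose c j := ((2^-1 ^+ j.+1 * v) `^ (- 2^-1))%R.
pose s j := (2^-1 ^+ j * v)%R.
apply: (@integral_levels_le _ _ _ c s) => //; try by nnm.
- by move=> j; exact: powR_ge0.
- by move=> j; rewrite mulr_ge0// exprn_ge0// invr_ge0.
- move=> y yx; have yv : (fine (inner w y) <= v)%R.
    by rewrite -lee_fin -!finV; apply: inner_mono => //; exact: ltW.
  rewrite finV; set z := fine (inner w y) in yv *.
  have z0 : (0 <= z)%R by exact: fine_ge0.
  have [->|zn0] := eqVneq z 0%R.
    (* A negative power of 0 is 0. *)
    exists 0%N; rewrite poweR_EFin powR0// ?oppr_eq0 ?invr_eq0// !lee_fin.
    by rewrite powR_ge0; split => //; rewrite mulr_ge0// exprn_ge0// invr_ge0.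
  have zp : (0 < z)%R by rewrite lt_neqAle eq_sym zn0.
  have [j /andP[j1 j2]] : exists j : nat, (2 ^+ j <= v / z <= 2 ^+ j.+1)%R.
    by apply: dyadic_bracket; rewrite ler_pdivlMr// mul1r.
  exists j; rewrite poweR_EFin !lee_fin; split.
    rewrite /c !powRN lef_pV2 ?posrE ?powR_gt0//; last first.
      by rewrite mulr_gt0 ?exprn_gt0// (lt_le_trans zp).
    apply: ge0_ler_powR; rewrite ?nnegrE//.
      by rewrite mulr_ge0// exprn_ge0// invr_ge0.
    rewrite exprVn mulrC ler_pdivrMr ?exprn_gt0//.
    by rewrite mulrC -ler_pdivrMr.
  rewrite /s exprVn mulrC ler_pdivlMr ?exprn_gt0// mulrC.
  by rewrite -ler_pdivlMr.
- move=> n; rewrite lee_fin.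
  apply: le_trans (_ : 2 `^ 2^-1 * v `^ 2^-1 / (1 - 2^-1 `^ 2^-1) <= _)%R; last first.
    by rewrite mulrAC.
  apply: le_trans (geometric_sum_le n _ t01); last by rewrite mulr_ge0 ?powR_ge0.
  apply: ler_sum => j _; rewrite /c /s.
  have [->|vn0] := eqVneq v 0%R; first by rewrite !mulr0 powR0// !mulr0 mul0r.
  have vp : (0 < v)%R by rewrite lt_neqAle eq_sym vn0.
  have hp : (0 < (2^-1 : R) ^+ j)%R by rewrite exprn_gt0.
  have E : ((2^-1 ^+ j * v) `^ 2^-1 = (2^-1 `^ 2^-1) ^+ j * v `^ 2^-1 :> R)%R.
    rewrite powRM ?(ltW hp)//; congr (_ * _)%R.
    by rewrite powR_exprn// invr_ge0.
  set z := (2^-1 ^+ j * v)%R in E *.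
  have z0 : (0 < z)%R by exact: mulr_gt0.
  have -> : (2^-1 ^+ j.+1 * v = 2 `^ (-1) * z :> R)%R.
    by rewrite powR_inv1// exprS mulrA.
  rewrite powRM ?powR_ge0 ?(ltW z0)// -powRrM mulN1r opprK -mulrA.
  rewrite -[X in (_ * (_ * X))%R](powRr1 (ltW z0)) -powRD; last first.
    by rewrite (gt_eqF z0) implybT.
  rewrite (_ : - 2^-1 + 1 = 2^-1 :> R)%R; last by field.
  by rewrite E (mulrA (2 `^ _)%R) (mulrAC (2 `^ _)%R).
Qed.

(** Dually, for s > 1, the integral of V^-s w above x is at most a multiple of
    V(x)^(1-s); the level sets are now those where V(y) is about 2^j V(x). *)
Lemma outer_poweRN (s : R) : (1 < s)%R -> exists2 c : R, (0 <= c)%R &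
  forall w x, nn_measurable w -> (forall y, inner w y < +oo) ->
  inner w x `^ (s - 1) * outer (fun y => inner w y `^ (- s) * w y) x <= c%:E.
Proof.
move=> s1; set t := (2 `^ (1 - s) : R)%R.
have t01 : (0 < t < 1)%R.
  have e1 : (1 `^ (s - 1) = 1 :> R)%R by rewrite powR1.
  rewrite /t powR_gt0//= -opprB powRN invf_lt1 ?powR_gt0// -[ltLHS]e1.
  by apply: gt0_ltr_powR; rewrite ?nnegrE//; lra.
have [t0 t1] := andP t01.
exists (2 / (1 - t))%R; first by rewrite divr_ge0// subr_ge0 ltW.
move=> w x nw fin.
have nV := nn_inner nw.
have V0 y : 0 <= inner w y by exact: nn_measurable_ge0.
have finV y : inner w y = (fine (inner w y))%:E.
  by rewrite fineK// ge0_fin_numE.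
set v := fine (inner w x).
have v0 : (0 <= v)%R by exact: fine_ge0.
rewrite [inner w x]finV -/v poweR_EFin.
have [->|vn0] := eqVneq v 0%R.
  rewrite powR0 ?mul0e ?lee_fin ?divr_ge0// ?subr_ge0 ?(ltW t1)//.
  by rewrite subr_eq0 gt_eqF.
have vp : (0 < v)%R by rewrite lt_neqAle eq_sym vn0.
have -> : (2 / (1 - t))%:E =
    (v `^ (s - 1))%:E * ((2 * v `^ (1 - s)) / (1 - t))%:E :> \bar R.
  rewrite -EFinM mulrA mulrCA -powRD; last by rewrite vn0 implybT.
  by rewrite (_ : s - 1 + (1 - s) = 0)%R ?powRr0 ?mulr1//; ring.
apply: lee_wpmul2l; first by rewrite lee_fin powR_ge0.
pose c j := ((2 ^+ j * v) `^ (- s))%R.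
pose l j := (2 ^+ j.+1 * v)%R.
apply: (@integral_levels_le _ _ _ c l) => //; try by nnm.
- by move=> j; exact: powR_ge0.
- by move=> j; rewrite mulr_ge0// exprn_ge0.
- move=> y /negP; rewrite -leNgt => xy; have vz : (v <= fine (inner w y))%R.
    by rewrite -lee_fin -!finV; apply: inner_mono.
  rewrite finV; set z := fine (inner w y) in vz *.
  have [j /andP[j1 j2]] : exists j : nat, (2 ^+ j <= z / v <= 2 ^+ j.+1)%R.
    by apply: dyadic_bracket; rewrite ler_pdivlMr// mul1r.
  have zp : (0 < z)%R by exact: lt_le_trans vz.
  exists j; rewrite poweR_EFin !lee_fin; split; last by rewrite -ler_pdivrMr.
  rewrite /c !powRN lef_pV2 ?posrE ?powR_gt0 ?mulr_gt0 ?exprn_gt0//.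
  apply: ge0_ler_powR; rewrite ?nnegrE ?mulr_ge0 ?exprn_ge0//.
  + by rewrite (le_trans _ (ltW s1)).
  + exact: ltW.
  + by rewrite -ler_pdivlMr.
- move=> n; rewrite lee_fin.
  apply: le_trans (geometric_sum_le n _ t01); last by rewrite mulr_ge0 ?powR_ge0.
  apply: ler_sum => j _; rewrite /c /l.
  have hp : (0 < (2 : R) ^+ j)%R by rewrite exprn_gt0.
  have E : ((2 ^+ j * v) `^ (1 - s) = t ^+ j * v `^ (1 - s) :> R)%R.
    by rewrite powRM ?(ltW hp)// powR_exprn.
  set z := (2 ^+ j * v)%R in E *.
  have z0 : (0 < z)%R by exact: mulr_gt0.
  rewrite exprS -mulrA -/z mulrCA.
  rewrite -[X in (_ * (_ * X))%R](powRr1 (ltW z0)) -powRD; last first.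
    by rewrite (gt_eqF z0) implybT.
  by rewrite (addrC (- s)%R) E -mulrA (mulrC (t ^+ j)%R).
Qed.

(** Hardy's averaging inequality: the mean of g over the ball below x, with
    respect to the weight w, has a majorant M whose norm in L^p(w) is controlled
    by that of g. The proof is Schur's test with powers of V = inner w:
    M = k S^(1/p) V^(-s/p), where S = inner (g^p V^(s-1) w) and s = (p+1)/2. *)
Lemma maximal_average (p : R) : (1 < p)%R -> exists2 c : R, (0 <= c)%R &
  forall w g, nn_measurable w -> nn_measurable g ->
  (forall y, inner w y < +oo) ->
  exists M, [/\ nn_measurable M,
    forall x, inner (fun y => g y * w y) x <= M x * inner w x &
    \int[mu]_x (M x `^ p * w x) <= c%:E * \int[mu]_x (g x `^ p * w x)].
Proof.
move=> p1; have p0 : (0 < p)%R by exact: lt_trans p1.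
have pn0 : p != 0%R by rewrite gt_eqF.
have p1n0 : (p - 1)%R != 0%R by rewrite subr_eq0 gt_eqF.
have p1p : (0 < p - 1)%R by rewrite subr_gt0.
pose p' := (p / (p - 1))%R.
have p'0 : (0 < p')%R by rewrite divr_gt0.
pose s := ((p + 1) / 2)%R.
have s1 : (1 < s)%R by rewrite /s; lra.
have [c1 c10 hc1] := inner_rsqrt.
have [c2 c20 hc2] := outer_poweRN s1.
pose k := (c1 `^ p'^-1)%R.
exists (k `^ p * c2)%R; first by rewrite mulr_ge0 ?powR_ge0.
move=> w g nw ng fin.
have nV := nn_inner nw.
have V0 y : 0 <= inner w y by exact: nn_measurable_ge0.
pose h y := g y `^ p * inner w y `^ (s - 1) * w y.
have nh : nn_measurable h by rewrite /h; nnm.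
have nS := nn_inner nh.
have S0 y : 0 <= inner h y by exact: nn_measurable_ge0.
(* The exponent e satisfies e p = s - 1 and e p' = 1/2. *)
pose e := ((p - 1) / (2 * p))%R.
have bound x : inner (fun y => g y * w y) x <=
    inner h x `^ p^-1 * (k%:E * (inner w x `^ 2^-1) `^ p'^-1).
  have -> : inner (fun y => g y * w y) x =
      \int[mu]_y ((g y * inner w y `^ e) * inner w y `^ (- e) *
        (w y * (\1_(below rho x) y)%:E)).
    rewrite [LHS]nn_integral_indic//; apply: nn_ae_eq_integral.
    - by apply: nn_measurableM; [nnm|exact: nn_measurable_indic].
    - apply: nn_measurableM; [nnm|apply: nn_measurableM => //].
      exact: nn_measurable_indic.
    (* Where V = 0, the factors V^e and V^(-e) do not cancel; that set has no
       w-mass. *)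
    have mD := measurable_le_level 0 nV.
    have wD0 : \int[mu]_(y in [set y | inner w y <= 0]) w y = 0.
      by apply/eqP; rewrite eq_le nn_integral_ge0// andbT; exact: inner_sublevel.
    apply: filterS (nn_integral_eq0 nw mD wD0) => y /= hy.
    have [/hy ->|Vp] := leP (inner w y) 0; first by rewrite !(mule0,mul0e).
    rewrite -(muleA (g y) (_ `^ e)) -poweRD ?subrr ?poweRe0 ?mule1 ?muleA//.
    by rewrite /poweRD_def subrr eqxx/= gt_eqF//= ge0_fin_numE// fin.
  have ni : nn_measurable (fun y => w y * (\1_(below rho x) y)%:E).
    by apply: nn_measurableM => //; exact: nn_measurable_indic.
  have ngV : nn_measurable (fun y => g y * inner w y `^ e) by nnm.
  have nVe : nn_measurable (fun y => inner w y `^ (- e)) by nnm.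
  have pp' : (p^-1 + p'^-1 = 1)%R by rewrite /p'; field; rewrite ?pn0 ?p1n0.
  apply: (le_trans (nn_whoelder mu ngV nVe ni p0 p'0 pp')).
  have -> : \int[mu]_y ((g y * inner w y `^ e) `^ p *
      (w y * (\1_(below rho x) y)%:E)) = inner h x.
    rewrite [RHS]nn_integral_indic//; apply: eq_integral => y _.
    rewrite muleA; congr (_ * _ * _); rewrite poweRM ?(nn_measurable_ge0 _ ng)//.
    by rewrite -poweRrM; congr (_ * _ `^ _); rewrite /e /s; field.
  apply: lee_wpmul2l => //.
  have -> : \int[mu]_y ((inner w y `^ (- e)) `^ p' *
      (w y * (\1_(below rho x) y)%:E)) =
      inner (fun y => inner w y `^ (- 2^-1) * w y) x.
    rewrite [RHS]nn_integral_indic//; apply: eq_integral => y _.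
    rewrite muleA; congr (_ * _ * _); rewrite -poweRrM; congr (_ `^ _).
    by rewrite /e /p'; field; rewrite ?pn0 ?p1n0.
  apply: (@le_trans _ _ ((c1%:E * inner w x `^ 2^-1) `^ p'^-1)).
    apply: le_poweR; [by rewrite invr_ge0 ltW| |exact: hc1].
    by apply: nn_integral_ge0; nnm.
  by rewrite poweRM ?lee_fin.
pose r := (- (s / p))%R.
exists (fun x => k%:E * (inner h x `^ p^-1 * inner w x `^ r)); split.
- by apply: nn_measurableM; [apply: nn_measurable_cst; rewrite lee_fin powR_ge0|nnm].
- move=> x; apply: (le_trans (bound x)); have := V0 x.
  rewrite le_eqVlt => /orP[/eqP<-|Vp].
    rewrite [X in X `^ p'^-1]poweR0r ?invr_eq0//.
    by rewrite poweR0r ?invr_eq0 ?gt_eqF// !mule0.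
  have fV : inner w x \is a fin_num by rewrite ge0_fin_numE.
  rewrite muleCA -!muleA; apply: lee_wpmul2l; first by rewrite lee_fin powR_ge0.
  apply: lee_wpmul2l => //; rewrite -poweRrM.
  rewrite -[X in _ <= _ * X](poweRe1 (V0 x)) -poweRD.
    rewrite (_ : 2^-1 * p'^-1 = r + 1)%R//.
    by rewrite /p' /r /s; field; rewrite ?pn0 ?p1n0.
  rewrite /poweRD_def fV gt_eqF// (_ : r + 1 = (p - 1) / (2 * p))%R.
    by rewrite divr_gt0// mulr_gt0.
  by rewrite /r /s; field.
- have kp0 : (0 <= k `^ p)%R by exact: powR_ge0.
  have E1 x : (k%:E * (inner h x `^ p^-1 * inner w x `^ r)) `^ p * w x =
      (k `^ p)%:E * ((inner w x `^ (- s) * w x) * inner h x).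
    rewrite poweRM ?mule_ge0 ?lee_fin ?powR_ge0// poweRM// poweRVK// -poweRrM.
    rewrite /r mulNr divfK// -muleA poweR_EFin; congr (_ * _).
    by rewrite [RHS]muleC muleA.
  under eq_integral do rewrite E1.
  rewrite nn_integralZl ?lee_fin//; last by nnm.
  rewrite EFinM -muleA; apply: lee_wpmul2l; first by rewrite lee_fin.
  rewrite (inner_outer_adjoint mrho sphere0)//; last by nnm.
  rewrite -nn_integralZl ?lee_fin//; last by nnm.
  have no := nn_measurable_outer mu mrho (_ : nn_measurable
    (fun x => inner w x `^ (- s) * w x)).
  apply: nn_le_integral; [by apply: nn_measurableM => //; apply: no; nnm| |].
    by apply: nn_measurableM; [apply: nn_measurable_cst; rewrite lee_fin|nnm].
  move=> x; rewrite /h.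
  rewrite (_ : _ * outer _ x = (g x `^ p * w x) * (inner w x `^ (s - 1) *
    outer (fun x => inner w x `^ (- s) * w x) x)); last first.
    by rewrite -!muleA; congr (_ * _); rewrite muleCA.
  rewrite [leRHS]muleC; apply: lee_wpmul2l; last exact: hc2.
  by apply: mule_ge0 => //; exact: nn_measurable_ge0.
Qed.

End maximal.

(** * Conjugate exponents and the basic estimate *)

Section exponents.
Context {R : realType}.
Implicit Types p q r : R.

Lemma conj_gt1 p : (1 < p -> 1 < p^')%R.
Proof.
by move=> p1; rewrite /conjugate_exponent ltr_pdivlMr ?subr_gt0//; lra.
Qed.

Lemma conj_gt0 p : (1 < p -> 0 < p^')%R.
Proof. by move=> /conj_gt1; apply: lt_trans. Qed.

Lemma conjV_gt0 p : (1 < p -> 0 < p^'^-1)%R.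
Proof. by move=> /conj_gt0; rewrite invr_gt0. Qed.

Lemma conjVE p : (1 < p -> p^'^-1 = 1 - p^-1)%R.
Proof.
move=> p1; have p0 : p != 0%R by apply/lt0r_neq0/(lt_trans _ p1).
have p10 : (p - 1 != 0)%R by rewrite subr_eq0 gt_eqF.
by rewrite /conjugate_exponent invf_div; field.
Qed.

Lemma conj_sum p : (1 < p -> p^-1 + p^'^-1 = 1)%R.
Proof. by move=> /conjVE ->; rewrite addrC subrK. Qed.

(** The exponent r attached to q < p by 1/r = 1/q - 1/p. *)
Lemma harmonic_gapE q r p : (q != 0 -> p != 0 -> p - q != 0 ->
  r^-1 = q^-1 - p^-1 -> r = p * q / (p - q))%R.
Proof.
by move=> q0 p0 pq rE; rewrite -[LHS]invrK rE; field; rewrite ?q0 ?p0 ?pq.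
Qed.

Lemma harmonic_gap_gt q r p : (0 < q -> 0 < p -> q < p ->
  r^-1 = q^-1 - p^-1 -> q < r)%R.
Proof.
move=> q0 p0 qp rE; have rV : (0 < r^-1)%R.
  by rewrite rE subr_gt0 ltf_pV2.
have r0 : (0 < r)%R by rewrite -invr_gt0.
by rewrite -ltf_pV2 ?posrE// rE; have := p0; rewrite -invr_gt0; lra.
Qed.

End exponents.

Section hardy_sufficiency.
Context d (T : measurableType d) (R : realType).
Variables (mu : {sigma_finite_measure set T -> \bar R}) (rho : T -> R).
Hypothesis mrho : measurable_fun setT rho.
Hypothesis sphere0 : forall r, mu [set x | rho x = r] = 0.
Implicit Types f g w phi Psi : T -> \bar R.

Local Notation inner := (inner_integral mu rho).
Local Notation outer := (outer_integral mu rho).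

Let nn_inner f (nf : nn_measurable f) : nn_measurable (inner f) :=
  nn_measurable_inner mu mrho nf.
Let nn_outer f (nf : nn_measurable f) : nn_measurable (outer f) :=
  nn_measurable_outer mu mrho nf.

(** The p-th power of the norm of g in L^p(w). *)
Local Notation norm_pow p g w := (\int[mu]_x (g x `^ p * w x)).

Lemma inner_hoelder (p : R) w g x : (1 < p)%R ->
  nn_measurable w -> nn_measurable g ->
  inner (fun y => g y * w y) x <=
  (norm_pow p g w) `^ p^-1 * inner w x `^ (p^')^-1.
Proof.
move=> p1 nw ng; have p0 : (0 < p)%R by exact: lt_trans p1.
have mB : measurable (below rho x) by exact: measurable_below.
have ni : nn_measurable (fun y => w y * (\1_(below rho x) y)%:E).
  by apply: nn_measurableM => //; exact: nn_measurable_indic.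
have n1 : nn_measurable (fun _ : T => 1 : \bar R) by exact: nn_measurable_cst.
have := nn_whoelder mu ng n1 ni p0 (conj_gt0 p1) (conj_sum p1).
have -> : \int[mu]_y (g y * 1 * (w y * (\1_(below rho x) y)%:E)) =
    inner (fun y => g y * w y) x.
  rewrite [RHS]nn_integral_indic//; apply: eq_integral => y _.
  by rewrite mule1 muleA.
have -> : \int[mu]_y (1 `^ p^' * (w y * (\1_(below rho x) y)%:E)) = inner w x.
  rewrite [RHS]nn_integral_indic//; apply: eq_integral => y _.
  by rewrite poweR1r mul1e.
move=> /le_trans; apply; apply: lee_wpmul2r => //.
apply: le_poweR; first by rewrite invr_ge0 ltW.
  by apply: nn_integral_ge0; nnm.
apply: nn_le_integral; [by nnm|by nnm|move=> y; rewrite muleA].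
rewrite -[leRHS]mule1; apply: lee_wpmul2l.
  by apply: mule_ge0 => //; exact: nn_measurable_ge0.
by rewrite lee_fin indicE; case: (_ \in _).
Qed.

Lemma inner_fin (p : R) w g x : (1 < p)%R ->
  nn_measurable w -> nn_measurable g -> inner w x < +oo ->
  norm_pow p g w < +oo -> inner (fun y => g y * w y) x < +oo.
Proof.
move=> p1 nw ng Vfin Nfin; apply: (le_lt_trans (inner_hoelder x p1 nw ng)).
apply: lte_mul_pinfty => //; last exact: poweR_lty.
by apply: fin_num_poweR; rewrite ge0_fin_numE//; apply: nn_integral_ge0; nnm.
Qed.

(** The basic estimate of the linear theory bounds the integral of
    Psi F^(q-1) g w, for F = inner (g w). For q < p it is Hoelder's inequality
    with exponents r / q and p / q, once F has been replaced by M V, with M the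
    majorant of the means of g. *)
Lemma power_term_lt (p q r : R) : (1 < q)%R -> (q < p)%R ->
  (r^-1 = q^-1 - p^-1)%R -> exists2 c : R, (0 <= c)%R & forall w g Psi,
  nn_measurable w -> nn_measurable g -> nn_measurable Psi ->
  (forall y, inner w y < +oo) ->
  \int[mu]_x (Psi x * inner (fun y => g y * w y) x `^ (q - 1) * (g x * w x)) <=
  c%:E * (\int[mu]_x (Psi x `^ (r / q) * inner w x `^ (r / q^') * w x)) `^ (q / r)
    * (norm_pow p g w) `^ (q / p).
Proof.
move=> q1 qp rE.
have q0 : (0 < q)%R by exact: lt_trans q1.
have p0 : (0 < p)%R by exact: lt_trans qp.
have p1 : (1 < p)%R by exact: lt_trans qp.
have qr := harmonic_gap_gt q0 p0 qp rE.
have r0 : (0 < r)%R by exact: lt_trans qr.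
have q10 : (0 <= q - 1)%R by rewrite subr_ge0 ltW.
have qn0 := lt0r_neq0 q0; have pn0 := lt0r_neq0 p0; have rn0 := lt0r_neq0 r0.
have q1n0 : (q - 1 != 0)%R by rewrite subr_eq0 gt_eqF.
have [c0 c00 hmax] := maximal_average mrho sphere0 p1.
exists ((c0 `^ (q^')^-1) `^ (q / p))%R; first by exact: powR_ge0.
move=> w g Psi nw ng nP fin.
have nV := nn_inner nw.
have [M [nM FM MN]] := hmax w g nw ng fin.
set F := inner (fun y => g y * w y) in FM *.
have nF : nn_measurable F by apply: nn_inner; nnm.
set N := norm_pow p g w in MN *.
have N0 : 0 <= N by apply: nn_integral_ge0; nnm.
pose h1 x := Psi x * inner w x `^ (q - 1).
pose h2 x := M x `^ (q - 1) * g x.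
have nh1 : nn_measurable h1 by rewrite /h1; nnm.
have nh2 : nn_measurable h2 by rewrite /h2; nnm.
apply: (@le_trans _ _ (\int[mu]_x (h1 x * h2 x * w x))).
  apply: nn_le_integral; [by nnm|by nnm|move=> x].
  rewrite muleA; apply: lee_wpmul2r; first exact: nn_measurable_ge0.
  rewrite /h2 muleA; apply: lee_wpmul2r; first exact: nn_measurable_ge0.
  rewrite /h1 -muleA; apply: lee_wpmul2l; first exact: nn_measurable_ge0.
  rewrite muleC -poweRM; [|exact: nn_measurable_ge0..].
  by apply: le_poweR => //; exact: nn_measurable_ge0.
have e1 : ((r / q)^-1 + (p / q)^-1 = 1)%R.
  by rewrite !invf_div -mulrDr rE subrK mulfV.
have := nn_whoelder mu nh1 nh2 nw (divr_gt0 r0 q0) (divr_gt0 p0 q0) e1.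
move=> /le_trans; apply; rewrite (invf_div r q) (invf_div p q).
have -> : \int[mu]_x (h1 x `^ (r / q) * w x) =
    \int[mu]_x (Psi x `^ (r / q) * inner w x `^ (r / q^') * w x).
  apply: eq_integral => x _; rewrite /h1 poweRM//; last exact: nn_measurable_ge0.
  rewrite -poweRrM; congr (_ * _ `^ _ * _).
  by rewrite /conjugate_exponent; field; rewrite ?qn0 ?q1n0.
rewrite [(_)%:E * _]muleC -[leRHS]muleA; apply: lee_wpmul2l => //.
rewrite -poweR_EFin -poweRM ?lee_fin ?powR_ge0//.
apply: le_poweR; [by rewrite divr_ge0 ?ltW|by apply: nn_integral_ge0; nnm|].
pose a x := M x `^ (p / q^'); pose b x := g x `^ (p / q).
have na : nn_measurable a by rewrite /a; nnm.
have nb : nn_measurable b by rewrite /b; nnm.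
have -> : \int[mu]_x (h2 x `^ (p / q) * w x) = \int[mu]_x (a x * b x * w x).
  apply: eq_integral => x _; rewrite /h2 poweRM//; last exact: nn_measurable_ge0.
  rewrite -poweRrM; congr (_ `^ _ * _ * _).
  by rewrite /conjugate_exponent; field; rewrite ?qn0 ?q1n0.
have e2 : ((q^')^-1 + q^-1 = 1)%R by rewrite addrC conj_sum.
apply: (le_trans (nn_whoelder mu na nb nw (conj_gt0 q1) q0 e2)).
have -> : \int[mu]_x (a x `^ q^' * w x) = norm_pow p M w.
  apply: eq_integral => x _; rewrite /a -poweRrM divfK//.
  exact: lt0r_neq0 (conj_gt0 q1).
have -> : \int[mu]_x (b x `^ q * w x) = N.
  by apply: eq_integral => x _; rewrite /b -poweRrM divfK.
rewrite -[X in _ <= _ * X](poweRe1 N0) -e2 poweRD_ge0; last 2 first.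
- exact/ltW/conjV_gt0.
- by rewrite invr_ge0 ltW.
rewrite muleA; apply: lee_wpmul2r => //.
rewrite -poweR_EFin -poweRM ?lee_fin//.
apply: le_poweR => //; first exact/ltW/conjV_gt0.
by apply: nn_integral_ge0; nnm.
Qed.

(** The basic estimate for p <= q: the factor F^(q-p) is estimated pointwise by
    Hoelder's inequality, and the factor F^(p-1) by means of the majorant M. *)
Lemma power_term_le (p q : R) : (1 < p)%R -> (p <= q)%R ->
  exists2 c : R, (0 <= c)%R & forall w g Psi (A : \bar R),
  nn_measurable w -> nn_measurable g -> nn_measurable Psi ->
  (forall y, inner w y < +oo) -> 0 <= A ->
  (forall x, Psi x * inner w x `^ (q / p^') <= A) ->
  \int[mu]_x (Psi x * inner (fun y => g y * w y) x `^ (q - 1) * (g x * w x)) <=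
  c%:E * A * (norm_pow p g w) `^ (q / p).
Proof.
move=> p1 pq.
have p0 : (0 < p)%R by exact: lt_trans p1.
have pn0 := lt0r_neq0 p0.
have p1n0 : (p - 1 != 0)%R by rewrite subr_eq0 gt_eqF.
have p10 : (0 <= p - 1)%R by rewrite subr_ge0 ltW.
have qp0 : (0 <= q - p)%R by rewrite subr_ge0.
have [c0 c00 hmax] := maximal_average mrho sphere0 p1.
exists (c0 `^ (p^')^-1)%R; first by exact: powR_ge0.
move=> w g Psi A nw ng nP fin A0 hA.
have nV := nn_inner nw.
have [M [nM FM MN]] := hmax w g nw ng fin.
have Fh x := inner_hoelder x p1 nw ng.
set F := inner (fun y => g y * w y) in FM Fh *.
have nF : nn_measurable F by apply: nn_inner; nnm.
set N := norm_pow p g w in MN Fh *.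
have N0 : 0 <= N by apply: nn_integral_ge0; nnm.
pose K := A * N `^ ((q - p) / p).
have K0 : 0 <= K by exact: mule_ge0.
have FK x : Psi x * F x `^ (q - 1) <= K * M x `^ (p - 1).
  rewrite (_ : q - 1 = (q - p) + (p - 1))%R; last by ring.
  rewrite poweRD_ge0//.
  have h1 : F x `^ (q - p) <= N `^ ((q - p) / p) * inner w x `^ ((q - p) / p^').
    have [-> ->] : ((q - p) / p = p^-1 * (q - p) /\
      (q - p) / p^' = p^'^-1 * (q - p))%R by split; rewrite mulrC.
    rewrite !poweRrM -poweRM//.
    by apply: le_poweR => //; exact: nn_measurable_ge0.
  have h2 : F x `^ (p - 1) <= M x `^ (p - 1) * inner w x `^ (p - 1).
    rewrite -poweRM; [|exact: nn_measurable_ge0..].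
    by apply: le_poweR => //; exact: nn_measurable_ge0.
  apply: (@le_trans _ _ (Psi x * ((N `^ ((q - p) / p) *
      inner w x `^ ((q - p) / p^')) * (M x `^ (p - 1) * inner w x `^ (p - 1))))).
    apply: lee_wpmul2l; first exact: nn_measurable_ge0.
    exact: lee_pmul.
  rewrite muleACA -poweRD_ge0//; last first.
    by rewrite divr_ge0//; exact/ltW/conj_gt0.
  rewrite (_ : (q - p) / p^' + (p - 1) = q / p^')%R; last first.
    by rewrite /conjugate_exponent; field; rewrite ?pn0 ?p1n0.
  rewrite muleCA [leRHS](_ : _ = (N `^ ((q - p) / p) * M x `^ (p - 1)) * A).
    by apply: lee_wpmul2l => //; exact: mule_ge0.
  by rewrite /K -muleA muleC.
pose h x := M x `^ (p - 1).
have nh : nn_measurable h by rewrite /h; nnm.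
apply: (@le_trans _ _ (\int[mu]_x (K * (h x * g x * w x)))).
  apply: nn_le_integral; [by nnm| |move=> x].
    by apply: nn_measurableM; [exact: nn_measurable_cst|nnm].
  rewrite !muleA; apply: lee_wpmul2r; first exact: nn_measurable_ge0.
  by apply: lee_wpmul2r => //; exact: nn_measurable_ge0.
rewrite nn_integralZl//; last by nnm.
have -> : (q / p = (q - p) / p + 1)%R by field.
rewrite poweRD_ge0 ?divr_ge0 ?(ltW p0)// poweRe1//.
rewrite [leRHS](_ : _ = K * ((c0 `^ p^'^-1)%:E * N)); last first.
  by rewrite [_%:E * A]muleC muleACA /K.
apply: lee_wpmul2l => //.
apply: (le_trans (nn_whoelder mu nh ng nw (conj_gt0 p1) p0 _)).
  by rewrite addrC conj_sum.
have -> : \int[mu]_x (h x `^ p^' * w x) = norm_pow p M w.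
  apply: eq_integral => x _; rewrite /h -poweRrM; congr (_ `^ _ * _).
  by rewrite /conjugate_exponent; field; rewrite ?p1n0.
rewrite -/N -[X in _ <= _ * X](poweRe1 N0).
rewrite (_ : 1 = p^'^-1 + p^-1)%R; last by rewrite addrC conj_sum.
rewrite poweRD_ge0; last 2 first.
- exact/ltW/conjV_gt0.
- by rewrite invr_ge0 ltW.
rewrite muleA; apply: lee_wpmul2r => //.
rewrite -poweR_EFin -poweRM ?lee_fin//.
apply: le_poweR => //; first exact/ltW/conjV_gt0.
by apply: nn_integral_ge0; nnm.
Qed.

End hardy_sufficiency.

(** * Weighted Hardy inequalities *)

Section bilinear_sufficiency.
Context d (T : measurableType d) (R : realType).
Variables (mu : {sigma_finite_measure set T -> \bar R}) (rho : T -> R).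
Hypothesis mrho : measurable_fun setT rho.
Hypothesis sphere0 : forall r, mu [set x | rho x = r] = 0.
Implicit Types f g u w phi Psi : T -> \bar R.

Local Notation inner := (inner_integral mu rho).
Local Notation outer := (outer_integral mu rho).
Local Notation norm_pow p g w := (\int[mu]_x (g x `^ p * w x)).

Let nn_inner f (nf : nn_measurable f) : nn_measurable (inner f) :=
  nn_measurable_inner mu mrho nf.
Let nn_outer f (nf : nn_measurable f) : nn_measurable (outer f) :=
  nn_measurable_outer mu mrho nf.

(** [inner_poweR_le] integrated against phi, which adjointness turns into
    [outer phi]. *)
Lemma integral_inner_poweR_le f phi (q : R) : nn_measurable f ->
  nn_measurable phi -> (forall x, inner f x < +oo) -> (1 <= q)%R ->
  \int[mu]_x (inner f x `^ q * phi x) <= (2 `^ q)%:E *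
  \int[mu]_x (outer phi x * inner f x `^ (q - 1) * f x).
Proof.
move=> nf nphi fin q1; have nF := nn_inner nf; have nU := nn_outer nphi.
have nG : nn_measurable (fun x => inner f x `^ (q - 1) * f x) by nnm.
have nGi := nn_inner nG.
have -> : \int[mu]_x (outer phi x * inner f x `^ (q - 1) * f x) =
    \int[mu]_x (phi x * inner (fun x => inner f x `^ (q - 1) * f x) x).
  rewrite (inner_outer_adjoint mrho sphere0)//.
  by apply: eq_integral => x _; rewrite -muleA muleC.
have c0 : 0 <= (2 `^ q)%:E :> \bar R by rewrite lee_fin powR_ge0.
rewrite -nn_integralZl//; last by nnm.
apply: nn_le_integral; [by nnm| |move=> x].
  by apply: nn_measurableM; [exact: nn_measurable_cst|nnm].
rewrite muleC muleCA; apply: lee_wpmul2l; first exact: nn_measurable_ge0.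
exact: inner_poweR_le.
Qed.

(** The linear weighted Hardy inequality, for p <= q. *)
Lemma hardy_le (p q : R) : (1 < p)%R -> (p <= q)%R ->
  exists2 c : R, (0 <= c)%R & forall w g phi (A : \bar R),
  nn_measurable w -> nn_measurable g -> nn_measurable phi ->
  (forall y, inner w y < +oo) -> norm_pow p g w < +oo -> 0 <= A ->
  (forall x, outer phi x * inner w x `^ (q / p^') <= A) ->
  \int[mu]_x (inner (fun y => g y * w y) x `^ q * phi x) <=
  c%:E * A * (norm_pow p g w) `^ (q / p).
Proof.
move=> p1 pq; have [c c0 hc] := power_term_le mrho sphere0 p1 pq.
exists (2 `^ q * c)%R; first by rewrite mulr_ge0 ?powR_ge0.
move=> w g phi A nw ng nphi fin Nfin A0 hA.
have nU := nn_outer nphi.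
apply: (le_trans (integral_inner_poweR_le _ nphi _ _)).
- by nnm.
- by move=> x; exact: (inner_fin mrho p1 nw ng (fin x) Nfin).
- by rewrite (le_trans (ltW p1)).
rewrite EFinM -!muleA; apply: lee_wpmul2l; first by rewrite lee_fin powR_ge0.
by rewrite muleA; exact: hc.
Qed.

(** The linear weighted Hardy inequality, for q < p. *)
Lemma hardy_lt (p q r : R) : (1 < q)%R -> (q < p)%R ->
  (r^-1 = q^-1 - p^-1)%R -> exists2 c : R, (0 <= c)%R & forall w g phi,
  nn_measurable w -> nn_measurable g -> nn_measurable phi ->
  (forall y, inner w y < +oo) -> norm_pow p g w < +oo ->
  \int[mu]_x (inner (fun y => g y * w y) x `^ q * phi x) <= c%:E *
  (\int[mu]_x (outer phi x `^ (r / q) * inner w x `^ (r / q^') * w x)) `^ (q / r)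
    * (norm_pow p g w) `^ (q / p).
Proof.
move=> q1 qp rE; have [c c0 hc] := power_term_lt mrho sphere0 q1 qp rE.
exists (2 `^ q * c)%R; first by rewrite mulr_ge0 ?powR_ge0.
move=> w g phi nw ng nphi fin Nfin.
have nU := nn_outer nphi.
apply: (le_trans (integral_inner_poweR_le _ nphi _ _)).
- by nnm.
- by move=> x; exact: (inner_fin mrho (lt_trans q1 qp) nw ng (fin x) Nfin).
- exact: ltW.
rewrite EFinM -!muleA; apply: lee_wpmul2l; first by rewrite lee_fin powR_ge0.
by rewrite muleA; exact: hc.
Qed.

(** [inner_poweR_mul_le] integrated against u, which adjointness turns into
    [outer u]. *)
Lemma integral_inner2_poweR_le f1 f2 u (q : R) : nn_measurable f1 ->
  nn_measurable f2 -> nn_measurable u -> (forall x, inner f1 x < +oo) ->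
  (forall x, inner f2 x < +oo) -> (1 <= q)%R ->
  \int[mu]_x (inner f1 x `^ q * inner f2 x `^ q * u x) <= (4 `^ q)%:E *
  (\int[mu]_x (outer u x * inner f2 x `^ q * inner f1 x `^ (q - 1) * f1 x) +
   \int[mu]_x (outer u x * inner f1 x `^ q * inner f2 x `^ (q - 1) * f2 x)).
Proof.
move=> nf1 nf2 nu fin1 fin2 q1.
have nF1 := nn_inner nf1; have nF2 := nn_inner nf2; have nU := nn_outer nu.
pose G f f' x := inner f' x `^ q * inner f x `^ (q - 1) * f x.
have nG f f' : nn_measurable f -> nn_measurable (inner f) ->
  nn_measurable (inner f') -> nn_measurable (G f f') by move=> *; rewrite /G; nnm.
have nG1 := nG _ _ nf1 nF1 nF2; have nG2 := nG _ _ nf2 nF2 nF1.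
have nGi1 := nn_inner nG1; have nGi2 := nn_inner nG2.
have E f f' : nn_measurable (G f f') ->
    \int[mu]_x (outer u x * inner f' x `^ q * inner f x `^ (q - 1) * f x) =
    \int[mu]_x (u x * inner (G f f') x).
  move=> nGf; rewrite (inner_outer_adjoint mrho sphere0)//.
  by apply: eq_integral => x _; rewrite [RHS]muleC /G !muleA.
rewrite (E _ _ nG1) (E _ _ nG2) -nn_integralD; [|by nnm..].
have c0 : 0 <= (4 `^ q)%:E :> \bar R by rewrite lee_fin powR_ge0.
rewrite -nn_integralZl//; last by nnm.
apply: nn_le_integral; [by nnm| |move=> x].
  by apply: nn_measurableM; [exact: nn_measurable_cst|nnm].
rewrite -ge0_muleDr; [|exact: nn_measurable_ge0..].
rewrite [leLHS]muleC [leRHS]muleCA; apply: lee_wpmul2l; first exact: nn_measurable_ge0.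
exact: inner_poweR_mul_le.
Qed.

(** A term of the product rule, in which the power of the inner integral of
    g1 w1 has been differentiated, is bounded by applying the basic estimate to
    g1 w1, and then an inequality for g2 w2: Hoelder's one when p1 <= q. The
    hypothesis on the weights is the finiteness of [hardyD1]. *)
Lemma bilinear_term_le (p1 p2 q : R) : (1 < p1)%R -> (p1 <= q)%R ->
  (1 < p2)%R -> exists2 c : R, (0 <= c)%R & forall w1 w2 g1 g2 u (A : \bar R),
  nn_measurable w1 -> nn_measurable w2 -> nn_measurable g1 ->
  nn_measurable g2 -> nn_measurable u ->
  (forall y, inner w1 y < +oo) -> (forall y, inner w2 y < +oo) -> 0 <= A ->
  (forall x, outer u x * inner w1 x `^ (q / p1^') * inner w2 x `^ (q / p2^') <= A) ->
  \int[mu]_x (outer u x * inner (fun y => g2 y * w2 y) x `^ q *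
    inner (fun y => g1 y * w1 y) x `^ (q - 1) * (g1 x * w1 x)) <=
  c%:E * A * (norm_pow p1 g1 w1) `^ (q / p1) * (norm_pow p2 g2 w2) `^ (q / p2).
Proof.
move=> p11 p1q p21; have [c c0 hc] := power_term_le mrho sphere0 p11 p1q.
exists c => // w1 w2 g1 g2 u A nw1 nw2 ng1 ng2 nu fin1 fin2 A0 hA.
have q0 : (0 <= q)%R by rewrite (le_trans _ p1q)// ltW// (lt_trans _ p11).
have nU := nn_outer nu; have nV1 := nn_inner nw1; have nV2 := nn_inner nw2.
have nF : nn_measurable (inner (fun y => g2 y * w2 y)) by apply: nn_inner; nnm.
set N1 := norm_pow p1 g1 w1; set N2 := norm_pow p2 g2 w2.
rewrite [leRHS](_ : _ = c%:E * (A * N2 `^ (q / p2)) * N1 `^ (q / p1)); last first.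
  by rewrite muleAC !muleA.
apply: hc => //; first by nnm.
  by apply: mule_ge0.
move=> x; apply: (@le_trans _ _
  (outer u x * (N2 `^ (q / p2) * inner w2 x `^ (q / p2^')) *
   inner w1 x `^ (q / p1^'))).
  apply: lee_wpmul2r => //; apply: lee_wpmul2l; first exact: nn_measurable_ge0.
  have [-> ->] : (q / p2 = p2^-1 * q /\ q / p2^' = p2^'^-1 * q)%R.
    by split; rewrite mulrC.
  rewrite !poweRrM -poweRM//.
  by apply: le_poweR => //; [exact: nn_measurable_ge0|exact: inner_hoelder].
rewrite muleCA -muleA muleC; apply: lee_wpmul2r => //.
by rewrite muleAC.
Qed.

(** When q < p1, the basic estimate leaves an integral of the r1-th power of
    the inner integral of g2 w2, for which there is again a Hardy inequality.
    When p2 <= r1 it requires the finiteness of [hardyD3]. *)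
Lemma bilinear_term_lt_le (p1 p2 q r1 : R) : (1 < q)%R -> (q < p1)%R ->
  (1 < p2)%R -> (p2 <= r1)%R -> (r1^-1 = q^-1 - p1^-1)%R ->
  exists2 c : R, (0 <= c)%R & forall w1 w2 g1 g2 u (A : \bar R),
  nn_measurable w1 -> nn_measurable w2 -> nn_measurable g1 ->
  nn_measurable g2 -> nn_measurable u ->
  (forall y, inner w1 y < +oo) -> (forall y, inner w2 y < +oo) ->
  norm_pow p2 g2 w2 < +oo -> 0 <= A ->
  (forall x, outer (fun y => outer u y `^ (r1 / q) * inner w1 y `^ (r1 / q^') *
     w1 y) x * inner w2 x `^ (r1 / p2^') <= A) ->
  \int[mu]_x (outer u x * inner (fun y => g2 y * w2 y) x `^ q *
    inner (fun y => g1 y * w1 y) x `^ (q - 1) * (g1 x * w1 x)) <=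
  c%:E * A `^ (q / r1) * (norm_pow p1 g1 w1) `^ (q / p1) *
    (norm_pow p2 g2 w2) `^ (q / p2).
Proof.
move=> q1 qp1 p21 p2r1 rE.
have q0 : (0 < q)%R by exact: lt_trans q1.
have qr1 := harmonic_gap_gt q0 (lt_trans q0 qp1) qp1 rE.
have r0 : (0 < r1)%R by exact: lt_trans qr1.
have [c c0 hc] := power_term_lt mrho sphere0 q1 qp1 rE.
have [c' c'0 hc'] := hardy_le p21 p2r1.
exists (c * c' `^ (q / r1))%R; first by rewrite mulr_ge0 ?powR_ge0.
move=> w1 w2 g1 g2 u A nw1 nw2 ng1 ng2 nu fin1 fin2 N2fin A0 hA.
have nU := nn_outer nu; have nV1 := nn_inner nw1; have nV2 := nn_inner nw2.
have nF : nn_measurable (inner (fun y => g2 y * w2 y)) by apply: nn_inner; nnm.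
set N1 := norm_pow p1 g1 w1; set N2 := norm_pow p2 g2 w2.
have nP : nn_measurable
  (fun x => outer u x * inner (fun y => g2 y * w2 y) x `^ q) by nnm.
apply: (le_trans (hc w1 g1 _ nw1 ng1 nP fin1)).
rewrite [leRHS]muleAC; apply: lee_wpmul2r => //.
rewrite EFinM -!muleA; apply: lee_wpmul2l; first by rewrite lee_fin.
rewrite -poweR_EFin muleA -poweRM ?lee_fin//.
have -> : (q / p2 = (r1 / p2) * (q / r1))%R by field; rewrite !lt0r_neq0//; lra.
rewrite (poweRrM N2) -poweRM ?mule_ge0 ?lee_fin//.
apply: le_poweR; [by rewrite divr_ge0 ?ltW|by apply: nn_integral_ge0; nnm|].
pose phi y := outer u y `^ (r1 / q) * inner w1 y `^ (r1 / q^') * w1 y.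
have nphi : nn_measurable phi by rewrite /phi; nnm.
have := hc' w2 g2 phi A nw2 ng2 nphi fin2 N2fin A0 hA.
apply: le_trans; rewrite le_eqVlt; apply/orP; left; apply/eqP.
apply: eq_integral => x _; rewrite poweRM ?(nn_measurable_ge0 _ nU)//.
rewrite -poweRrM mulrCA mulfV ?mulr1 ?lt0r_neq0// /phi !muleA.
by rewrite [outer _ _ `^ _ * _]muleC.
Qed.

(** When q < p1 and r1 < p2, the second Hardy inequality requires the finiteness
    of [hardyD6]. *)
Lemma bilinear_term_lt_lt (p1 p2 q r1 k : R) : (1 < q)%R -> (q < p1)%R ->
  (r1 < p2)%R -> (r1^-1 = q^-1 - p1^-1)%R -> (k^-1 = r1^-1 - p2^-1)%R ->
  exists2 c : R, (0 <= c)%R & forall w1 w2 g1 g2 u,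
  nn_measurable w1 -> nn_measurable w2 -> nn_measurable g1 ->
  nn_measurable g2 -> nn_measurable u ->
  (forall y, inner w1 y < +oo) -> (forall y, inner w2 y < +oo) ->
  norm_pow p2 g2 w2 < +oo ->
  \int[mu]_x (outer u x * inner (fun y => g2 y * w2 y) x `^ q *
    inner (fun y => g1 y * w1 y) x `^ (q - 1) * (g1 x * w1 x)) <= c%:E *
  (\int[mu]_x (outer (fun y => outer u y `^ (r1 / q) *
     inner w1 y `^ (r1 / q^') * w1 y) x `^ (k / r1) *
     inner w2 x `^ (k / r1^') * w2 x)) `^ (q / k) *
    (norm_pow p1 g1 w1) `^ (q / p1) * (norm_pow p2 g2 w2) `^ (q / p2).
Proof.
move=> q1 qp1 r1p2 rE kE.
have q0 : (0 < q)%R by exact: lt_trans q1.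
have qr1 := harmonic_gap_gt q0 (lt_trans q0 qp1) qp1 rE.
have r11 : (1 < r1)%R by exact: lt_trans qr1.
have r0 : (0 < r1)%R by exact: lt_trans qr1.
have r1k := harmonic_gap_gt r0 (lt_trans r0 r1p2) r1p2 kE.
have k0 : (0 < k)%R by exact: lt_trans r1k.
have [c c0 hc] := power_term_lt mrho sphere0 q1 qp1 rE.
have [c' c'0 hc'] := hardy_lt r11 r1p2 kE.
exists (c * c' `^ (q / r1))%R; first by rewrite mulr_ge0 ?powR_ge0.
move=> w1 w2 g1 g2 u nw1 nw2 ng1 ng2 nu fin1 fin2 N2fin.
have nU := nn_outer nu; have nV1 := nn_inner nw1; have nV2 := nn_inner nw2.
have nF : nn_measurable (inner (fun y => g2 y * w2 y)) by apply: nn_inner; nnm.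
set N1 := norm_pow p1 g1 w1; set N2 := norm_pow p2 g2 w2.
have nP : nn_measurable
  (fun x => outer u x * inner (fun y => g2 y * w2 y) x `^ q) by nnm.
apply: (le_trans (hc w1 g1 _ nw1 ng1 nP fin1)).
rewrite [leRHS]muleAC; apply: lee_wpmul2r => //.
rewrite EFinM -!muleA; apply: lee_wpmul2l; first by rewrite lee_fin.
set D := (X in _ <= _ * (X `^ (q / k) * _)).
have -> : (q / p2 = (r1 / p2) * (q / r1))%R by field; rewrite !lt0r_neq0//; lra.
have -> : (q / k = (r1 / k) * (q / r1))%R by field; rewrite !lt0r_neq0//; lra.
rewrite -poweR_EFin muleA (poweRrM D) -poweRM ?lee_fin//.
rewrite (poweRrM N2) -poweRM ?mule_ge0 ?lee_fin//.
apply: le_poweR; [by rewrite divr_ge0 ?ltW|by apply: nn_integral_ge0; nnm|].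
pose phi y := outer u y `^ (r1 / q) * inner w1 y `^ (r1 / q^') * w1 y.
have nphi : nn_measurable phi by rewrite /phi; nnm.
have := hc' w2 g2 phi nw2 ng2 nphi fin2 N2fin.
apply: le_trans; rewrite le_eqVlt; apply/orP; left; apply/eqP.
apply: eq_integral => x _; rewrite poweRM ?(nn_measurable_ge0 _ nU)//.
rewrite -poweRrM mulrCA mulfV ?mulr1 ?lt0r_neq0// /phi !muleA.
by rewrite [outer _ _ `^ _ * _]muleC.
Qed.

End bilinear_sufficiency.

(** * Truncation of weights *)

(** Monotone convergence for a function h that is only known to lie below every
    upper bound of the sequence. *)
Lemma nn_integral_sup_le d (T : measurableType d) (R : realType)
  (mu : {measure set T -> \bar R}) (h_ : (T -> \bar R)^nat) (h : T -> \bar R) B :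
  (forall n, nn_measurable (h_ n)) -> nn_measurable h ->
  (forall x, nondecreasing_seq (h_ ^~ x)) ->
  (forall x L, (forall n, h_ n x <= L) -> h x <= L) ->
  (forall n, \int[mu]_x h_ n x <= B) -> \int[mu]_x h x <= B.
Proof.
move=> nh_ nh nd hL hB.
have mlim : measurable_fun setT (fun x => limn (h_ ^~ x)).
  apply: (emeasurable_fun_cvg h_) => [n|x _]; first exact: nn_measurableW.
  exact: ereal_nondecreasing_is_cvgn.
apply: (@le_trans _ _ (\int[mu]_x limn (h_ ^~ x))).
  apply: ge0_le_integral => //.
  - by move=> x _; exact: nn_measurable_ge0.
  - exact: nn_measurableW.
  - move=> x _; apply: hL => n.
    rewrite (cvg_lim _ (ereal_nondecreasing_cvgn (nd x)))//.
    by apply: ereal_sup_ubound; exists n.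
rewrite monotone_convergence//.
- apply: lime_le; last exact: nearW.
  apply: ereal_nondecreasing_is_cvgn => m n mn.
  by apply: nn_le_integral => // x; exact: nd.
- by move=> n; exact: nn_measurableW.
- by move=> n x _; exact: nn_measurable_ge0.
Qed.

Section hardy_necessity.
Context d (T : measurableType d) (R : realType).
Variables (mu : {sigma_finite_measure set T -> \bar R}) (rho : T -> R).
Hypothesis mrho : measurable_fun setT rho.
Hypothesis sphere0 : forall r, mu [set x | rho x = r] = 0.
Implicit Types w phi psi : T -> \bar R.

Local Notation inner := (inner_integral mu rho).
Local Notation outer := (outer_integral mu rho).

Let nn_inner f (nf : nn_measurable f) : nn_measurable (inner f) :=
  nn_measurable_inner mu mrho nf.
Let nn_outer f (nf : nn_measurable f) : nn_measurable (outer f) :=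
  nn_measurable_outer mu mrho nf.

(** The weight w has finite mass on every ball. *)
Definition ball_finite w :=
  forall t : R, \int[mu]_(x in [set x | (rho x < t)%R]) w x < +oo.

(** A nondecreasing sequence of bounded sets of finite phi-mass, exhausting
    the space up to a null set. *)
Definition exhausts phi (A : (set T)^nat) := [/\ nondecreasing_seq A,
  forall n, measurable (A n), forall n, A n `<=` [set x | (rho x < n%:R)%R],
  forall n, \int[mu]_(x in A n) phi x < +oo & mu (~` \bigcup_n A n) = 0].

Section truncation.
Variables (phi : T -> \bar R) (A : (set T)^nat).
Hypotheses (nphi : nn_measurable phi) (exA : exhausts phi A).

(** The restriction of phi to the n-th set of the sequence. *)
Definition truncation n x := phi x * (\1_(A n) x)%:E.

Let mA n : measurable (A n). Proof. by case: exA. Qed.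

Lemma nn_measurable_truncation n : nn_measurable (truncation n).
Proof. by apply: nn_measurableM => //; exact: nn_measurable_indic. Qed.

Lemma truncation_le n x : truncation n x <= phi x.
Proof.
rewrite /truncation -[leRHS]mule1; apply: lee_wpmul2l.
  exact: nn_measurable_ge0.
by rewrite lee_fin indicE; case: (_ \in _).
Qed.

Lemma truncation_nd x : nondecreasing_seq (truncation ^~ x).
Proof.
move=> m n mn; apply: lee_wpmul2l; first exact: nn_measurable_ge0.
rewrite lee_fin !indicE; have [ndA _ _ _ _] := exA.
have /subsetPset sA := ndA _ _ mn.
have [xA|] := boolP (x \in A m); last by rewrite ler0n.
by rewrite mem_set//; apply: sA; rewrite inE in xA.
Qed.

Lemma outer_truncation_nd x : nondecreasing_seq (fun n => outer (truncation n) x).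
Proof.
move=> m n mn; apply: ge0_le_integral.
- exact/measurableC/measurable_below.
- by move=> y _; exact: (nn_measurable_ge0 _ (nn_measurable_truncation _)).
- exact: (nn_measurableW (nn_measurable_truncation _)).
- exact: (nn_measurableW (nn_measurable_truncation _)).
- by move=> y _; exact: truncation_nd.
Qed.

Lemma outer_truncation_sup x L :
  (forall n, outer (truncation n) x <= L) -> outer phi x <= L.
Proof.
move=> hL; have [ndA _ _ _ A0] := exA.
have mC := measurableC (measurable_below mrho x).
apply: (@nn_integral_bigcup_le _ _ _ mu phi (fun n => ~` below rho x `&` A n)
  _ (~` \bigcup_n A n)) => //.
- move=> m n mn; apply/subsetPset => y [yx yA]; split => //.
  by have /subsetPset := ndA _ _ mn; apply.
- by move=> n; exact: measurableI.
- by apply: measurableC; exact: bigcupT_measurable.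
- move=> n; apply: le_trans (hL n); rewrite le_eqVlt; apply/orP; left; apply/eqP.
  rewrite /outer_integral nn_integral_indic; last exact: measurableI.
  rewrite [RHS]nn_integral_indic//; apply: eq_integral => y _.
  by rewrite indicI /truncation EFinM muleA muleAC.
- move=> y yx; have [[n _ yA]|yA] := pselect ((\bigcup_n A n) y); last by right.
  by left; exists n.
Qed.

Lemma outer_truncation_limit psi (t : R) B : (0 < t)%R -> nn_measurable psi ->
  (forall n, \int[mu]_x (outer (truncation n) x `^ t * psi x) <= B) ->
  \int[mu]_x (outer phi x `^ t * psi x) <= B.
Proof.
move=> t0 npsi.
have nUn n := nn_outer (nn_measurable_truncation n); have nU := nn_outer nphi.
apply: (@nn_integral_sup_le _ _ _ mu
  (fun n x => outer (truncation n) x `^ t * psi x)) => // [n||x|x L hL].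
- by apply: nn_measurableM => //; apply: nn_measurable_poweR; exact: nUn.
- by nnm.
- move=> m n mn; apply: lee_wpmul2r; first exact: nn_measurable_ge0.
  apply: le_poweR; [exact: ltW|exact: nn_measurable_ge0|].
  exact: outer_truncation_nd.
have tn0 := lt0r_neq0 t0.
have L0 : 0 <= L.
  by apply: le_trans (hL 0%N); apply: mule_ge0 => //; exact: nn_measurable_ge0.
have U0 : 0 <= outer phi x by exact: nn_measurable_ge0.
have := nn_measurable_ge0 x npsi; rewrite le_eqVlt => /orP[/eqP<-|psi0].
  by rewrite mule0.
case psiE : (psi x) hL psi0 => [v| |//]; last first.
  (* Where psi is infinite, the bound L is infinite unless the outer integrals
     of all the truncations vanish. *)
  move=> hL _; have [h0|/existsNP[n /negP]] :=
      pselect (forall n, outer (truncation n) x <= 0).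
    have -> : outer phi x = 0.
      by apply/eqP; rewrite eq_le U0 andbT; exact: outer_truncation_sup.
    by rewrite poweR0r// mul0e.
  rewrite -ltNge => s0; have := hL n.
  by rewrite gt0_muley ?poweR_gt0// leye_eq => /eqP->; rewrite leey.
rewrite lte_fin => hL v0; rewrite -lee_pdivlMr//.
rewrite -[leRHS](poweRVK tn0); last by rewrite mule_ge0// lee_fin invr_ge0 ltW.
apply: le_poweR => //; first exact: ltW.
apply: outer_truncation_sup => n.
rewrite -[leLHS](poweRK tn0); last exact: nn_measurable_ge0.
apply: le_poweR => //; first by rewrite invr_ge0 ltW.
by rewrite lee_pdivlMr.
Qed.

Lemma truncation_limit psi B : nn_measurable psi ->
  (forall n, \int[mu]_x (psi x * truncation n x) <= B) ->
  \int[mu]_x (psi x * phi x) <= B.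
Proof.
move=> npsi hB; have [ndA _ _ _ A0] := exA.
apply: (@nn_integral_bigcup_le _ _ _ mu _ A setT (~` \bigcup_n A n)) => //.
- by nnm.
- by apply: measurableC; exact: bigcupT_measurable.
- move=> n; apply: le_trans (hB n); rewrite nn_integral_indic//.
  by rewrite le_eqVlt; apply/orP; left; apply/eqP; apply: eq_integral => x _;
    rewrite /truncation muleA.
- by move=> x _; have [|] := pselect ((\bigcup_n A n) x); [left|right].
Qed.

End truncation.

End hardy_necessity.

(** * Necessity for the linear Hardy inequality *)

Section hardy_lt_necessity.
Context d (T : measurableType d) (R : realType).
Variables (mu : {sigma_finite_measure set T -> \bar R}) (rho : T -> R).
Hypothesis mrho : measurable_fun setT rho.
Hypothesis sphere0 : forall r, mu [set x | rho x = r] = 0.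
Implicit Types w phi : T -> \bar R.

Local Notation inner := (inner_integral mu rho).
Local Notation outer := (outer_integral mu rho).

Let nn_inner f (nf : nn_measurable f) : nn_measurable (inner f) :=
  nn_measurable_inner mu mrho nf.
Let nn_outer f (nf : nn_measurable f) : nn_measurable (outer f) :=
  nn_measurable_outer mu mrho nf.

(** Necessity of the integral conditions for q < p, in two equivalent forms I
    and J. With the weight phi truncated so that everything is finite, the
    inequality is tested on g = U_n^(r/(pq)) V^(r/(pq')), where U_n is the outer
    integral of the truncation and V = inner w. Then I_n is the p-th power of the
    norm of g and the left-hand side dominates J_n, so that J_n is at most a
    multiple of I_n^(q/p); [outer_poweR_le] and adjointness bound I_n by a
    multiple of J_n, and the bound improves itself since q/p < 1. *)
Lemma hardy_lt_necessary (p q r : R) : (1 < q)%R -> (q < p)%R ->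
  (r^-1 = q^-1 - p^-1)%R -> exists2 c : R, (0 <= c)%R &
  forall w phi (A : (set T)^nat) (K : R), nn_measurable w ->
  nn_measurable phi -> ball_finite mu rho w -> exhausts mu rho phi A ->
  (0 <= K)%R ->
  (forall g : T -> R, measurable_fun setT g -> (forall x, 0 <= g x)%R ->
    \int[mu]_x ((g x)%:E `^ p * w x) < +oo ->
    \int[mu]_x (inner (fun y => (g y)%:E * w y) x `^ q * phi x) <=
    K%:E * (\int[mu]_x ((g x)%:E `^ p * w x)) `^ (q / p)) ->
  \int[mu]_x (outer phi x `^ (r / q) * (inner w x `^ (r / q^') * w x)) <=
    (c * K `^ (r / q))%:E /\
  \int[mu]_x (outer phi x `^ (r / p) * (inner w x `^ (r / p^') * phi x)) <=
    (c * K `^ (r / q))%:E.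
Proof.
move=> q1 qp rE.
have q0 : (0 < q)%R by exact: lt_trans q1.
have p0 : (0 < p)%R by exact: lt_trans qp.
have p1 : (1 < p)%R by exact: lt_trans qp.
have qr := harmonic_gap_gt q0 p0 qp rE.
have r0 : (0 < r)%R by exact: lt_trans qr.
have qn0 := lt0r_neq0 q0; have pn0 := lt0r_neq0 p0; have rn0 := lt0r_neq0 r0.
have q1n0 : (q - 1 != 0)%R by rewrite subr_eq0 gt_eqF.
have p1n0 : (p - 1 != 0)%R by rewrite subr_eq0 gt_eqF.
have pqn0 : (p - q != 0)%R by rewrite subr_eq0 gt_eqF.
have rE' := harmonic_gapE qn0 pn0 pqn0 rE.
have q'0 := conj_gt0 q1; have p'0 := conj_gt0 p1.
pose s := (r / (p * q^') + 1)%R.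
have s1 : (1 <= s)%R by rewrite lerDr ltW// divr_gt0// mulr_gt0.
have s0 : (0 <= s)%R by rewrite (le_trans _ s1).
have sq : (s * q = r / p^')%R.
  by rewrite /s /conjugate_exponent rE'; field; rewrite ?qn0 ?pn0 ?pqn0 ?q1n0 ?p1n0.
have rq1 : (1 <= r / q)%R by rewrite ler_pdivlMr// mul1r ltW.
have rq_p : (r / q - 1 = r / p)%R by rewrite rE'; field; rewrite ?qn0 ?pn0 ?pqn0.
have rq' : (r / q^' + 1 = r / p^')%R.
  by rewrite /conjugate_exponent rE'; field; rewrite ?qn0 ?pn0 ?pqn0 ?q1n0 ?p1n0.
pose B := (2 `^ (s * q) * 2 `^ (r / p) : R)%R.
have B0 : (0 <= B)%R by rewrite mulr_ge0 ?powR_ge0.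
pose c := (2 `^ (r / q) * B `^ (r / q))%R.
exists c; first by rewrite mulr_ge0 ?powR_ge0.
move=> w phi A K nw nphi wfin exA K0 hK.
have [ndA mA subA finA A0] := exA.
have nV := nn_inner nw; have nU := nn_outer nphi.
have Vfin x : inner w x < +oo by exact: wfin.
have nt n := nn_measurable_truncation nphi exA n.
pose U n := outer (truncation phi A n).
have nUn n : nn_measurable (U n) by exact: nn_outer.
pose J n := \int[mu]_x (U n x `^ (r / p) *
  (inner w x `^ (r / p^') * truncation phi A n x)).
pose I n := \int[mu]_x (U n x `^ (r / q) * (inner w x `^ (r / q^') * w x)).
have c1 : (B `^ (r / q) <= c)%R.
  rewrite /c -[leLHS]mul1r; apply: ler_wpM2r; first exact: powR_ge0.
  have e1 : (1 `^ (r / q) = 1 :> R)%R by rewrite powR1.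
  by rewrite -{1}e1; apply: ge0_ler_powR; rewrite ?nnegrE ?divr_ge0 ?(ltW r0) ?(ltW q0) ?ler1n.
suff main n : J n <= ((B * K) `^ (r / q))%:E /\
    I n <= (2 `^ (r / q))%:E * ((B * K) `^ (r / q))%:E.
  have cK : ((B * K) `^ (r / q) <= c * K `^ (r / q))%R.
    by rewrite powRM// ler_wpM2r// powR_ge0.
  have nJ n : nn_measurable (fun x => inner w x `^ (r / p^') * truncation phi A n x).
    by have ? := nt n; nnm.
  split.
    apply: (outer_truncation_limit mrho nphi exA); [exact: divr_gt0|by nnm|].
    move=> n; apply: (le_trans (main n).2).
    by rewrite -EFinM lee_fin powRM// mulrA.
  have -> : \int[mu]_x (outer phi x `^ (r / p) * (inner w x `^ (r / p^') * phi x)) =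
      \int[mu]_x ((outer phi x `^ (r / p) * inner w x `^ (r / p^')) * phi x).
    by apply: eq_integral => x _; rewrite muleA.
  apply: (truncation_limit nphi exA); first by nnm.
  move=> m; have -> : \int[mu]_x (outer phi x `^ (r / p) * inner w x `^ (r / p^') *
      truncation phi A m x) = \int[mu]_x (outer phi x `^ (r / p) *
      (inner w x `^ (r / p^') * truncation phi A m x)).
    by apply: eq_integral => x _; rewrite -muleA.
  apply: (outer_truncation_limit mrho nphi exA) => //; first exact: divr_gt0.
  move=> n; apply: (@le_trans _ _ (J (maxn m n))).
    apply: nn_le_integral.
    - by apply: nn_measurableM; [exact: nn_measurable_poweR (nUn _)|exact: nJ].
    - by apply: nn_measurableM; [exact: nn_measurable_poweR (nUn _)|exact: nJ].
    - move=> x; apply: lee_pmul => //.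
      + by apply: mule_ge0 => //; exact: nn_measurable_ge0.
      + apply: le_poweR; [by rewrite divr_ge0 ?ltW|exact: (nn_measurable_ge0 x (nUn n))|].
        exact: (outer_truncation_nd mrho nphi exA x (leq_maxr m n)).
      + apply: lee_wpmul2l => //.
        exact: (truncation_nd nphi exA x (leq_maxl m n)).
  by apply: (le_trans (main _).1); rewrite lee_fin.
pose phin := truncation phi A n; pose Un := outer phin.
have nphin : nn_measurable phin by exact: nt.
have nUn' : nn_measurable Un by exact: nUn.
have Unb x : Un x <= \int[mu]_(y in A n) phi y.
  rewrite [leRHS]nn_integral_indic//; apply: nn_subset_integral => //.
  exact/measurableC/measurable_below.
have Unfin x : Un x < +oo by exact: le_lt_trans (Unb x) (finA n).
have Un0 x : (n%:R <= rho x)%R -> Un x = 0.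
  move=> nx; rewrite /Un /outer_integral integral0_eq// => y /negP.
  rewrite -leNgt /phin /truncation indicE => xy.
  rewrite memNset ?mule0// => /subA /=; rewrite ltNge.
  by rewrite (le_trans nx).
have Unfn x : Un x \is a fin_num.
  by rewrite ge0_fin_numE//; exact: nn_measurable_ge0.
have Vfn x : inner w x \is a fin_num.
  by rewrite ge0_fin_numE//; exact: nn_measurable_ge0.
pose gE y := Un y `^ (r / (p * q)) * inner w y `^ (r / (p * q^')).
have ngE : nn_measurable gE by rewrite /gE; nnm.
pose g y := fine (gE y).
have gEE y : (g y)%:E = gE y.
  by rewrite /g fineK// fin_numM// fin_num_poweR.
have mg : measurable_fun setT g.
  by apply: measurableT_comp => //; exact: (nn_measurableW ngE).
have g0 x : (0 <= g x)%R by apply: fine_ge0; exact: nn_measurable_ge0.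
have nwV : nn_measurable (fun x => inner w x `^ (r / q^') * w x) by nnm.
have IE : \int[mu]_x ((g x)%:E `^ p * w x) = I n.
  apply: eq_integral => x _; rewrite gEE /gE poweRM// -!poweRrM muleA.
  by congr (_ `^ _ * _ `^ _ * _);
    rewrite /conjugate_exponent; field; rewrite ?qn0 ?pn0 ?q1n0.
have I0 : 0 <= I n by apply: nn_integral_ge0; nnm.
have J0 : 0 <= J n by apply: nn_integral_ge0; nnm.
(* I_n is finite since U_n is bounded and vanishes outside a ball. *)
have Ifin : I n < +oo.
  pose W := \int[mu]_(x in [set x | (rho x < n%:R)%R]) w x.
  pose k := (\int[mu]_(y in A n) phi y) `^ (r / q) * W `^ (r / q^').
  have W0 : 0 <= W by exact: nn_integral_ge0.
  have b0 : 0 <= \int[mu]_(y in A n) phi y by exact: nn_integral_ge0.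
  have mn := measurable_lt_radius mrho n%:R.
  apply: (@le_lt_trans _ _ (k * W)).
    rewrite /W [X in _ * X]nn_integral_indic// -nn_integralZl; last 2 first.
    - by apply: nn_measurableM => //; exact: nn_measurable_indic.
    - exact: mule_ge0.
    apply: nn_le_integral; [by nnm| |move=> x].
      apply: nn_measurableM; first by apply: nn_measurable_cst; exact: mule_ge0.
      by apply: nn_measurableM => //; exact: nn_measurable_indic.
    have [xn|nx] := ltP (rho x) n%:R.
      rewrite indicE mem_set//= mule1 muleA; apply: lee_wpmul2r.
        exact: nn_measurable_ge0.
      apply: lee_pmul => //; apply: le_poweR.
      - by rewrite divr_ge0 ?(ltW r0) ?(ltW q0).
      - exact: nn_measurable_ge0.
      - exact: Unb.
      - by rewrite divr_ge0 ?(ltW r0) ?(ltW q'0).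
      - exact: nn_measurable_ge0.
      - apply: nn_subset_integral => //; first exact: measurable_below.
        by move=> y /= /lt_trans; apply.
    rewrite (Un0 x nx : U n x = 0) poweR0r ?mul0e; last by rewrite mulf_neq0 ?invr_eq0.
    apply: mule_ge0; first exact: mule_ge0.
    by apply: mule_ge0; [exact: nn_measurable_ge0|rewrite lee_fin indicE].
  have fb : \int[mu]_(y in A n) phi y \is a fin_num by rewrite ge0_fin_numE.
  have fW : W \is a fin_num by rewrite ge0_fin_numE//; exact: wfin.
  by rewrite ltey_eq fin_numM// fin_numM// fin_num_poweR.
(* A lower bound for the inner integral of the test function: U_n decreases in
   the radius and can be taken out of the integral. *)
have step1 x : Un x `^ (r / p) * inner w x `^ (r / p^') <=
    (2 `^ (s * q))%:E * inner (fun y => (g y)%:E * w y) x `^ q.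
  have h : Un x `^ (r / (p * q)) * inner w x `^ s <=
      (2 `^ s)%:E * inner (fun y => (g y)%:E * w y) x.
    apply: (@le_trans _ _ (Un x `^ (r / (p * q)) *
        ((2 `^ s)%:E * inner (fun y => inner w y `^ (s - 1) * w y) x))).
      by apply: lee_wpmul2l => //; exact: inner_poweR_le.
    rewrite muleCA; apply: lee_wpmul2l; first by rewrite lee_fin powR_ge0.
    have nVs : nn_measurable (fun y => inner w y `^ (s - 1) * w y) by nnm.
    have mB := measurable_below mrho x.
    rewrite /inner_integral -ge0_integralZl//; last 2 first.
    - exact: (nn_measurableW nVs).
    - by move=> y _; exact: (nn_measurable_ge0 y nVs).
    apply: ge0_le_integral => //.
    - move=> y _; apply: mule_ge0 => //; exact: (nn_measurable_ge0 y nVs).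
    - by apply: measurable_funeM; exact: (nn_measurableW nVs).
    - under eq_fun do rewrite gEE.
      have ngw : nn_measurable (fun y => gE y * w y) by nnm.
      exact: (nn_measurableW ngw).
    - move=> y /= yx; rewrite gEE /gE muleA; apply: lee_wpmul2r.
        exact: nn_measurable_ge0.
      rewrite (_ : s - 1 = r / (p * q^'))%R; last by rewrite /s addrK.
      apply: lee_wpmul2r => //; apply: le_poweR.
      + by rewrite divr_ge0 ?mulr_ge0 ?(ltW r0) ?(ltW q0) ?(ltW p0).
      + exact: nn_measurable_ge0.
      + exact: (outer_mono mu mrho nphin (ltW yx)).
  have ngw : nn_measurable (fun y => (g y)%:E * w y).
    by apply: nn_measurableM => //; exact: nn_measurable_EFin.
  have := le_poweR (ltW q0) _ h; rewrite poweRM//.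
  rewrite poweRM ?lee_fin ?powR_ge0//; last exact: nn_integral_ge0.
  rewrite poweR_EFin -powRrM -!poweRrM sq.
  rewrite (_ : r / (p * q) * q = r / p)%R; last by field; rewrite ?pn0 ?qn0.
  by apply; exact: mule_ge0.
have nF : nn_measurable (inner (fun y => (g y)%:E * w y)).
  by apply: nn_inner; apply: nn_measurableM => //; exact: nn_measurable_EFin.
have J1 : J n <= (2 `^ (s * q) * K)%:E * I n `^ (q / p).
  apply: (@le_trans _ _ (\int[mu]_x ((2 `^ (s * q))%:E *
      (inner (fun y => (g y)%:E * w y) x `^ q * phi x)))).
    apply: nn_le_integral; [by nnm| |move=> x].
      apply: nn_measurableM; last by nnm.
      by apply: nn_measurable_cst; rewrite lee_fin powR_ge0.
    rewrite [leLHS]muleA [leRHS]muleA; apply: lee_pmul.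
    - exact: mule_ge0.
    - exact: nn_measurable_ge0.
    - exact: step1.
    - exact: truncation_le.
  rewrite nn_integralZl ?lee_fin ?powR_ge0//; last by nnm.
  rewrite EFinM -muleA; apply: lee_wpmul2l; first by rewrite lee_fin powR_ge0.
  by rewrite -IE; apply: hK => //; rewrite IE.
have J2 : I n <= (2 `^ (r / q))%:E * J n.
  have nUp : nn_measurable (fun y => Un y `^ (r / p) * phin y) by nnm.
  have no := nn_outer nUp.
  have c0 : 0 <= (2 `^ (r / q))%:E :> \bar R by rewrite lee_fin powR_ge0.
  apply: (@le_trans _ _ (\int[mu]_x ((2 `^ (r / q))%:E *
      ((inner w x `^ (r / q^') * w x) *
        outer (fun y => Un y `^ (r / p) * phin y) x)))).
    apply: nn_le_integral; [by nnm| |move=> x].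
      by apply: nn_measurableM; [exact: nn_measurable_cst|nnm].
    rewrite [leRHS]muleCA [leLHS]muleC; apply: lee_wpmul2l.
      exact: (nn_measurable_ge0 x nwV).
    by have := outer_poweR_le mrho sphere0 nphin (Unfin x) rq1; rewrite rq_p.
  rewrite nn_integralZl//; last by nnm.
  apply: lee_wpmul2l => //; rewrite -(inner_outer_adjoint mrho sphere0)//.
  have nwVi := nn_inner nwV.
  apply: nn_le_integral; [by nnm|by nnm|move=> x].
  rewrite -muleA; apply: lee_wpmul2l => //; rewrite muleC.
  apply: lee_wpmul2r; first exact: nn_measurable_ge0.
  rewrite -rq' poweRD_ge0//; last by rewrite divr_ge0 ?(ltW r0) ?(ltW q'0).
  have Vx0 : 0 <= inner w x by exact: nn_measurable_ge0.
  have mB := measurable_below mrho x.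
  rewrite poweRe1// {2}/inner_integral -ge0_integralZl//; last 2 first.
  - exact: nn_measurableW.
  - by move=> y _; exact: nn_measurable_ge0.
  apply: ge0_le_integral => //.
  - by move=> y _; exact: (nn_measurable_ge0 y nwV).
  - exact: (nn_measurableW nwV).
  - by apply: measurable_funeM; exact: nn_measurableW.
  - move=> y /= yx; apply: lee_wpmul2r; first exact: nn_measurable_ge0.
    apply: le_poweR; first by rewrite divr_ge0 ?(ltW r0) ?(ltW q'0).
      exact: (nn_measurable_ge0 y nV).
    exact: (inner_mono mu mrho nw (ltW yx)).
have Jfin : J n < +oo.
  apply: (le_lt_trans J1); rewrite ltey_eq fin_numM// fin_num_poweR//.
  by rewrite ge0_fin_numE.
have JB : J n <= ((B * K) `^ (r / q))%:E.
  have -> : (r / q = (1 - q / p)^-1)%R.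
    by rewrite rE'; field; rewrite ?qn0 ?pn0 ?pqn0.
  apply: le_poweR_absorb => //.
  - by rewrite mulr_ge0.
  - by rewrite divr_gt0//= ltr_pdivrMr// mul1r.
  apply: (le_trans J1); rewrite /B EFinM [leRHS](_ : _ = (2 `^ (s * q) * K)%:E *
    ((2 `^ (r / q))%:E * J n) `^ (q / p)).
    apply: lee_wpmul2l; first by rewrite lee_fin mulr_ge0 ?powR_ge0.
    by apply: le_poweR => //; rewrite divr_ge0 ?(ltW q0) ?(ltW p0).
  rewrite poweRM ?lee_fin ?powR_ge0// poweR_EFin -powRrM.
  rewrite (_ : r / q * (q / p) = r / p)%R; last by field; rewrite ?pn0 ?qn0.
  by rewrite !muleA -!EFinM; congr (_%:E * _); rewrite mulrAC.
split => //; apply: (le_trans J2); apply: lee_wpmul2l => //.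
Qed.

End hardy_lt_necessity.

(** * Necessity for the bilinear Hardy inequality *)

Section bilinear_necessity.
Context d (T : measurableType d) (R : realType).
Variables (mu : {sigma_finite_measure set T -> \bar R}) (rho : T -> R).
Hypothesis mrho : measurable_fun setT rho.
Hypothesis sphere0 : forall r, mu [set x | rho x = r] = 0.
Implicit Types u w phi : T -> \bar R.

Local Notation inner := (inner_integral mu rho).
Local Notation outer := (outer_integral mu rho).
Local Notation norm_pow p g w := (\int[mu]_x ((g x)%:E `^ p * w x)).

Let nn_inner f (nf : nn_measurable f) : nn_measurable (inner f) :=
  nn_measurable_inner mu mrho nf.
Let nn_outer f (nf : nn_measurable f) : nn_measurable (outer f) :=
  nn_measurable_outer mu mrho nf.

(** The bilinear inequality raised to the power q, for functions written as
    products g w. *)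
Definition bilinear_bound (q p1 p2 : R) u w1 w2 (K : R) :=
  forall g1 g2 : T -> R, measurable_fun setT g1 -> measurable_fun setT g2 ->
  (forall x, 0 <= g1 x)%R -> (forall x, 0 <= g2 x)%R ->
  \int[mu]_x (inner (fun y => (g1 y)%:E * w1 y) x `^ q *
    inner (fun y => (g2 y)%:E * w2 y) x `^ q * u x) <=
  K%:E * (norm_pow p1 g1 w1) `^ (q / p1) * (norm_pow p2 g2 w2) `^ (q / p2).

Lemma bilinear_bound_sym q p1 p2 u w1 w2 K :
  bilinear_bound q p1 p2 u w1 w2 K -> bilinear_bound q p2 p1 u w2 w1 K.
Proof.
move=> hK g1 g2 mg1 mg2 g10 g20; rewrite muleAC.
under eq_integral do rewrite [X in X * u _]muleC.
exact: hK.
Qed.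

Section weights.
Variables (q p1 p2 : R) (u w1 w2 : T -> \bar R) (K : R).
Hypotheses (q1 : (1 < q)%R) (p11 : (1 < p1)%R) (p21 : (1 < p2)%R).
Hypotheses (nu : nn_measurable u) (nw1 : nn_measurable w1)
  (nw2 : nn_measurable w2).
Hypotheses (fin1 : ball_finite mu rho w1) (fin2 : ball_finite mu rho w2).
Hypotheses (pos1 : {ae mu, forall x, 0 < w1 x})
  (pos2 : {ae mu, forall x, 0 < w2 x}).
Hypotheses (K0 : (0 <= K)%R) (hK : bilinear_bound q p1 p2 u w1 w2 K).

Local Notation V1 := (inner w1).
Local Notation V2 := (inner w2).
Local Notation U := (outer u).

Let nV1 : nn_measurable V1. Proof. exact: nn_inner. Qed.
Let nV2 : nn_measurable V2. Proof. exact: nn_inner. Qed.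
Let nU : nn_measurable U. Proof. exact: nn_outer. Qed.
Let q0 : (0 < q)%R. Proof. exact: lt_trans q1. Qed.
Let p10 : (0 < p1)%R. Proof. exact: lt_trans p11. Qed.
Let p20 : (0 < p2)%R. Proof. exact: lt_trans p21. Qed.
Let mB x : measurable (below rho x). Proof. exact: measurable_below. Qed.
Let mC x : measurable (~` below rho x). Proof. exact/measurableC/mB. Qed.

Let nn_gw (g : T -> R) w : measurable_fun setT g -> (forall x, 0 <= g x)%R ->
  nn_measurable w -> nn_measurable (fun y => (g y)%:E * w y).
Proof.
by move=> mg g0 nw; apply: nn_measurableM => //; exact: nn_measurable_EFin.
Qed.

Lemma norm_pow_indic (p : R) w x : (0 < p)%R ->
  norm_pow p (\1_(below rho x) : T -> R) w = inner w x.
Proof.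
move=> p0; rewrite [RHS]nn_integral_indic//; apply: eq_integral => y _.
rewrite indicE; case: (_ \in _); first by rewrite poweR1r mul1e mule1.
by rewrite poweR0r ?lt0r_neq0// mul0e mule0.
Qed.

Lemma inner_indic w x y : (rho x <= rho y)%R ->
  inner (fun z => (\1_(below rho x) z)%:E * w z) y = inner w x.
Proof.
move=> xy; rewrite [RHS]nn_integral_indic// [LHS]nn_integral_indic//.
apply: eq_integral => z _; rewrite [_ * w z]muleC.
have [zx|zx] := boolP (z \in below rho x); last first.
  by rewrite [\1_(below rho x) z]indicE (negbTE zx) mule0 mul0e.
rewrite [\1_(below rho y) z]indicE mem_set ?mule1//.
by rewrite inE in zx; exact: lt_le_trans xy.
Qed.

(** Testing the first function on the indicator of the ball below x leaves a
    linear Hardy inequality for the second one, with the weight restricted to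
    the outside of that ball. *)
Lemma indicator_test x (g : T -> R) : measurable_fun setT g ->
  (forall x, 0 <= g x)%R -> norm_pow p2 g w2 < +oo ->
  \int[mu]_(y in ~` below rho x)
    (inner (fun y => (g y)%:E * w2 y) y `^ q * u y) * V1 x `^ (q / p1^') <=
  K%:E * (norm_pow p2 g w2) `^ (q / p2).
Proof.
move=> mg g0 Nfin.
have V10 : 0 <= V1 x by exact: nn_measurable_ge0.
have N0 : 0 <= norm_pow p2 g w2.
  apply: nn_integral_ge0; apply: nn_measurableM => //.
  by apply: nn_measurable_poweR; exact: nn_measurable_EFin.
have nG := nn_inner (nn_gw mg g0 nw2).
have [->|Vn0] := eqVneq (V1 x) 0.
  rewrite poweR0r ?mule0; first by rewrite mule_ge0 ?lee_fin.
  by rewrite mulf_neq0 ?invr_eq0 ?lt0r_neq0 ?conj_gt0.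
have Vp : 0 < V1 x by rewrite lt0e Vn0.
have Vfn : V1 x \is a fin_num by rewrite ge0_fin_numE//; exact: fin1.
have Wp : 0 < V1 x `^ (q / p1) by exact: poweR_gt0.
have Wfn : V1 x `^ (q / p1) \is a fin_num by exact: fin_num_poweR.
rewrite -(@lee_pmul2r _ (V1 x `^ (q / p1)))// -muleA -poweRD_ge0; last 2 first.
- by rewrite divr_ge0 ?(ltW q0)// ltW// conj_gt0.
- by rewrite divr_ge0 ?(ltW q0) ?(ltW p10).
rewrite -mulrDr addrC conj_sum// mulr1.
have i0 y : (0 <= (\1_(below rho x) y : R))%R by rewrite indicE ler0n.
have := hK (measurable_indic (mB x)) mg i0 g0.
rewrite norm_pow_indic// [leRHS]muleAC; apply: le_trans.
have nGu : nn_measurable (fun y => inner (fun y => (g y)%:E * w2 y) y `^ q * u y).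
  by nnm.
have nGi : nn_measurable (fun y => inner (fun y => (g y)%:E * w2 y) y `^ q * u y
    * (\1_(~` below rho x) y)%:E).
  by apply: nn_measurableM => //; exact: nn_measurable_indic.
have n1 : nn_measurable (inner (fun y => (\1_(below rho x) y : R)%:E * w1 y)).
  by apply: nn_inner; apply: nn_gw => //; exact: measurable_indic.
rewrite nn_integral_indic// muleC -nn_integralZl//.
apply: nn_le_integral; [by apply: nn_measurableM => //; exact: nn_measurable_cst
  |by nnm|move=> y].
have [yx|yx] := boolP (y \in ~` below rho x).
  rewrite [\1__ y]indicE yx mule1 -[leRHS]muleA inner_indic//.
  by rewrite inE in yx; rewrite leNgt; exact/negP.
rewrite [\1__ y]indicE (negbTE yx) !mule0.
apply: mule_ge0; [exact: mule_ge0|exact: nn_measurable_ge0].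
Qed.

(** Testing both functions on the indicator of the ball below x. *)
Lemma bilinear_bound_D1 x :
  U x * V1 x `^ (q / p1^') * V2 x `^ (q / p2^') <= K%:E.
Proof.
have V20 : 0 <= V2 x by exact: nn_measurable_ge0.
have [->|Vn0] := eqVneq (V2 x) 0.
  rewrite poweR0r ?mule0 ?lee_fin//.
  by rewrite mulf_neq0 ?invr_eq0 ?lt0r_neq0 ?conj_gt0.
have Vp : 0 < V2 x by rewrite lt0e Vn0.
have Vfn : V2 x \is a fin_num by rewrite ge0_fin_numE//; exact: fin2.
have Wp : 0 < V2 x `^ (q / p2) by exact: poweR_gt0.
have Wfn : V2 x `^ (q / p2) \is a fin_num by exact: fin_num_poweR.
rewrite -(@lee_pmul2r _ (V2 x `^ (q / p2)))// -muleA -poweRD_ge0; last 2 first.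
- by rewrite divr_ge0 ?(ltW q0)// ltW// conj_gt0.
- by rewrite divr_ge0 ?(ltW q0) ?(ltW p20).
rewrite -mulrDr addrC conj_sum// mulr1.
have i0 y : (0 <= (\1_(below rho x) y : R))%R by rewrite indicE ler0n.
have mi : measurable_fun setT (\1_(below rho x) : T -> R).
  exact: measurable_indic.
have := @indicator_test x (\1_(below rho x)) mi i0.
rewrite norm_pow_indic// => /(_ (fin2 _)); apply: le_trans.
rewrite muleAC; apply: lee_wpmul2r => //.
rewrite [leLHS]muleC.
rewrite -(outerZl mu mrho (k := V2 x `^ q) x nu); last exact: poweR_ge0.
have nI : nn_measurable (fun y =>
    inner (fun z => (\1_(below rho x) z : R)%:E * w2 z) y `^ q * u y).
  by have := nn_inner (nn_gw mi i0 nw2) => ?; nnm.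
apply: (outer_le mu mrho) => //.
  by apply: nn_measurableM => //; exact: nn_measurable_cst.
by move=> y xy; rewrite inner_indic.
Qed.

(** The sets used to exhaust the space: there the outer integral of u is
    bounded, so that their u-mass is finite. *)
Definition finite_part n := [set x | U x <= n%:R%:E] `&`
  [set x | (rho x < n%:R)%R].

Lemma measurable_finite_part n : measurable (finite_part n).
Proof.
apply: measurableI; first exact: measurable_le_level.
exact: measurable_lt_radius.
Qed.

Lemma inner_gt0_ae w : nn_measurable w -> {ae mu, forall x, 0 < w x} ->
  {ae mu, forall x, 0 < inner w x}.
Proof.
move=> nw pos; have nV := nn_inner nw.
have mD := measurable_le_level 0 nV.
have D0 : \int[mu]_(y in [set y | inner w y <= 0]) w y = 0.
  by apply/eqP; rewrite eq_le nn_integral_ge0// andbT; exact: inner_sublevel.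
apply: filterS2 pos (nn_integral_eq0 nw mD D0) => x wx /= hx.
by rewrite ltNge; apply/negP => /hx w0; rewrite w0 ltxx in wx.
Qed.

Lemma finite_part_exhausts phi (k : nat -> \bar R) : nn_measurable phi ->
  (forall n, k n < +oo) ->
  (forall n, \int[mu]_(x in finite_part n) phi x <= k n) ->
  exhausts mu rho phi finite_part.
Proof.
move=> nphi kfin hk; split.
- move=> m n mn; apply/subsetPset => x [/= Ux rx]; split => /=.
    by apply: (le_trans Ux); rewrite lee_fin ler_nat.
  by apply: (lt_le_trans rx); rewrite ler_nat.
- exact: measurable_finite_part.
- by move=> n x [].
- by move=> n; exact: le_lt_trans (hk n) (kfin n).
- have mU : measurable (\bigcup_n finite_part n).
    by apply: bigcupT_measurable; exact: measurable_finite_part.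
  apply/negligibleP; first exact: measurableC.
  have : {ae mu, forall x, (\bigcup_n finite_part n) x}.
    apply: filterS2 (inner_gt0_ae nw1 pos1) (inner_gt0_ae nw2 pos2) => x Vx1 Vx2.
    have Ufin : U x < +oo.
      rewrite ltey; apply/eqP => Uy; have := bilinear_bound_D1 x.
      by rewrite Uy !gt0_mulye ?poweR_gt0// leye_eq.
    have Ufn : U x \is a fin_num.
      by rewrite ge0_fin_numE//; exact: nn_measurable_ge0.
    exists (maxn (Num.bound (fine (U x))) (Num.bound `|rho x|))%R => //; split => /=.
      rewrite -[leLHS]fineK// lee_fin; apply/ltW.
      apply: (lt_le_trans (archi_boundP _)); last by rewrite ler_nat leq_maxl.
      by apply: fine_ge0; exact: nn_measurable_ge0.
    apply: (le_lt_trans (ler_norm _)).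
    apply: (lt_le_trans (archi_boundP _)) => //.
    by rewrite ler_nat leq_maxr.
  by rewrite /almost_everywhere.
Qed.

Lemma finite_part_mass n : \int[mu]_(x in finite_part n) u x <= n%:R%:E.
Proof.
apply: (@le_trans _ _ (\int[mu]_(x in [set x | U x <= n%:R%:E]) u x)).
  apply: nn_subset_integral => //; first exact: measurable_finite_part.
  - exact: measurable_le_level.
  - by move=> x [].
by apply: outer_sublevel => //; rewrite lee_fin ler0n.
Qed.

(** The linear inequality of [indicator_test] holds with a constant depending on
    x, and its necessary condition, whose outer integrals agree with U outside
    the ball below x, gives the finiteness of [hardyD2]. *)
Lemma bilinear_bound_D2 (r : R) : (q < p2)%R -> (r^-1 = q^-1 - p2^-1)%R ->
  exists2 c : R, (0 <= c)%R & forall x,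
  (\int[mu]_(y in ~` below rho x) (U y `^ (r / q) * V2 y `^ (r / q^') * w2 y)) *
    V1 x `^ (r / p1^') <= c%:E.
Proof.
move=> qp2 rE; have [c c0 hc] := hardy_lt_necessary mrho sphere0 q1 qp2 rE.
have qr := harmonic_gap_gt q0 p20 qp2 rE.
have r0 : (0 < r)%R by exact: lt_trans qr.
exists (c * K `^ (r / q))%R; first by rewrite mulr_ge0 ?powR_ge0.
move=> x; have V10 : 0 <= V1 x by exact: nn_measurable_ge0.
have cK0 : 0 <= (c * K `^ (r / q))%:E :> \bar R.
  by rewrite lee_fin mulr_ge0 ?powR_ge0.
have [->|Vn0] := eqVneq (V1 x) 0.
  by rewrite poweR0r ?mule0// mulf_neq0 ?invr_eq0 ?lt0r_neq0 ?conj_gt0.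
have Vp : 0 < V1 x by rewrite lt0e Vn0.
have Vfn : V1 x \is a fin_num by rewrite ge0_fin_numE//; exact: fin1.
set v := fine (V1 x); have vE : V1 x = v%:E by rewrite fineK.
have v0 : (0 < v)%R by rewrite -lte_fin -vE.
pose phi y := u y * (\1_(~` below rho x) y)%:E.
have nphi : nn_measurable phi.
  by apply: nn_measurableM => //; exact: nn_measurable_indic.
have phiu y : phi y <= u y.
  rewrite /phi -[leRHS]mule1; apply: lee_wpmul2l; first exact: nn_measurable_ge0.
  by rewrite lee_fin indicE; case: (_ \in _).
have exA : exhausts mu rho phi finite_part.
  apply: (finite_part_exhausts (k := fun n => n%:R%:E)) => // n; first exact: ltry.
  apply: le_trans (finite_part_mass n); apply: ge0_le_integral => //.
  - exact: measurable_finite_part.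
  - by move=> y _; exact: nn_measurable_ge0.
  - exact: nn_measurableW.
  - exact: nn_measurableW.
pose K' := (K * v `^ (- (q / p1^')))%R.
have K'0 : (0 <= K')%R by rewrite mulr_ge0 ?powR_ge0.
have vq : (0 < v `^ (q / p1^'))%R by exact: powR_gt0.
have [|hI _] := hc w2 phi finite_part K' nw2 nphi fin2 exA K'0.
  move=> g mg g0 Nfin; have := indicator_test x mg g0 Nfin.
  rewrite vE poweR_EFin -lee_pdivlMr// => h; apply: (le_trans (le_trans _ h)).
    rewrite [leRHS]nn_integral_indic// le_eqVlt; apply/orP; left; apply/eqP.
    by apply: eq_integral => y _; rewrite /phi muleA.
  by rewrite /K' powRN EFinM muleAC.
rewrite vE poweR_EFin -lee_pdivlMr ?powR_gt0//.
have -> : (c * K `^ (r / q))%:E * (v `^ (r / p1^'))^-1%:E = (c * K' `^ (r / q))%:E.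
  rewrite -EFinM /K' powRM ?powR_ge0// -powRrM -powRN -mulrA.
  congr (_ * (_ * _ `^ _))%:E; field.
  by rewrite ?(lt0r_neq0 q0) ?lt0r_neq0 ?conj_gt0.
apply: le_trans hI; rewrite nn_integral_indic//.
have nUV : nn_measurable (fun y => U y `^ (r / q) * V2 y `^ (r / q^') * w2 y) by nnm.
have nop := nn_outer nphi.
apply: nn_le_integral; [|by nnm|move=> y].
  by apply: nn_measurableM => //; exact: nn_measurable_indic.
have [yx|yx] := boolP (y \in ~` below rho x); last first.
  rewrite indicE (negbTE yx) mule0; apply: mule_ge0 => //.
  by apply: mule_ge0 => //; exact: nn_measurable_ge0.
rewrite [\1__ y]indicE yx mule1 -muleA (_ : U y = outer phi y)//.
apply: eq_integral => z; rewrite !inE => zy; rewrite /phi indicE mem_set ?mule1//.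
move=> zx; apply: zy; move: yx; rewrite inE => /negP; rewrite -leNgt.
exact: lt_le_trans.
Qed.

Section iterated.
Variable r1 : R.
Hypotheses (qp1 : (q < p1)%R) (r1E : (r1^-1 = q^-1 - p1^-1)%R).

Let qr1 : (q < r1)%R. Proof. exact: harmonic_gap_gt q0 p10 qp1 r1E. Qed.
Let r10 : (0 < r1)%R. Proof. exact: lt_trans qr1. Qed.
Let r11 : (1 < r1)%R. Proof. exact: lt_trans qr1. Qed.

Local Notation m1 := (fun x => U x `^ (r1 / q) * V1 x `^ (r1 / q^') * w1 x).
Local Notation m2 := (fun x => U x `^ (r1 / p1) * V1 x `^ (r1 / p1^') * u x).

(** With the second function g w2 fixed, the first one satisfies a linear Hardy
    inequality with the weight F^q u, F = inner (g w2). As the outer integral of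
    this weight is at least F^q U, the necessary conditions for that inequality
    are Hardy inequalities for g w2, with exponent r1 and the weights m1, m2. *)
Lemma bilinear_bound_iterated : exists2 c : R, (0 <= c)%R & forall g : T -> R,
  measurable_fun setT g -> (forall x, 0 <= g x)%R -> norm_pow p2 g w2 < +oo ->
  \int[mu]_x (inner (fun y => (g y)%:E * w2 y) x `^ r1 * m1 x) <=
    c%:E * (norm_pow p2 g w2) `^ (r1 / p2) /\
  \int[mu]_x (inner (fun y => (g y)%:E * w2 y) x `^ r1 * m2 x) <=
    c%:E * (norm_pow p2 g w2) `^ (r1 / p2).
Proof.
have [c c0 hc] := hardy_lt_necessary mrho sphere0 q1 qp1 r1E.
exists (c * K `^ (r1 / q))%R; first by rewrite mulr_ge0 ?powR_ge0.
move=> g mg g0 Nfin.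
have ng : nn_measurable (fun y => (g y)%:E) by exact: nn_measurable_EFin.
have ngw := nn_gw mg g0 nw2; have nF := nn_inner ngw.
set F := inner (fun y => (g y)%:E * w2 y) in nF *.
set N := norm_pow p2 g w2 in Nfin *.
have N0 : 0 <= N by apply: nn_integral_ge0; nnm.
have Nfn : N \is a fin_num by rewrite ge0_fin_numE.
pose phi x := F x `^ q * u x.
have nphi : nn_measurable phi by rewrite /phi; nnm.
pose W n := \int[mu]_(x in [set x | (rho x < n%:R)%R]) w2 x.
have W0 n : 0 <= W n by exact: nn_integral_ge0.
have Wfn n : W n \is a fin_num by rewrite ge0_fin_numE//; exact: fin2.
pose b n := (N `^ p2^-1 * W n `^ p2^'^-1) `^ q.
have bfn n : b n \is a fin_num.
  by rewrite fin_num_poweR// fin_numM// fin_num_poweR.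
have exA : exhausts mu rho phi finite_part.
  apply: (finite_part_exhausts (k := fun n => b n * n%:R%:E)) => // n.
    by rewrite ltey_eq fin_numM.
  have mfn := measurable_finite_part n.
  apply: (@le_trans _ _ (\int[mu]_(x in finite_part n) (b n * u x))).
    apply: ge0_le_integral => //.
    - by move=> y _; exact: nn_measurable_ge0.
    - exact: nn_measurableW.
    - by apply: measurable_funeM; exact: nn_measurableW nu.
    - move=> x [_ /= xn]; apply: lee_wpmul2r; first exact: nn_measurable_ge0.
      apply: le_poweR; [exact: ltW|exact: nn_measurable_ge0|].
      apply: (le_trans (inner_hoelder mu mrho x p21 nw2 ng)).
      apply: lee_wpmul2l => //; apply: le_poweR.
      + exact/ltW/conjV_gt0.
      + exact: nn_measurable_ge0.
      + apply: nn_subset_integral => //; first exact: measurable_lt_radius.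
        by move=> y /= /lt_trans; apply.
  rewrite ge0_integralZl//; last 2 first.
  - exact: nn_measurableW.
  - by move=> y _; exact: nn_measurable_ge0.
  by apply: lee_wpmul2l; [exact: poweR_ge0|exact: finite_part_mass].
pose K' := (K * fine N `^ (q / p2))%R.
have K'0 : (0 <= K')%R by rewrite mulr_ge0 ?powR_ge0.
have K'E : (c * K' `^ (r1 / q))%:E = (c * K `^ (r1 / q))%:E * N `^ (r1 / p2).
  rewrite /K' powRM ?powR_ge0// -powRrM -{2}(fineK Nfn) poweR_EFin -EFinM mulrA.
  congr (_ * _ `^ _)%:E; field.
  by rewrite ?(lt0r_neq0 q0) ?(lt0r_neq0 p20).
have [|hI hJ] := hc w1 phi finite_part K' nw1 nphi fin1 exA K'0.
  move=> g1 mg1 g10 N1fin; have := hK mg1 mg g10 g0.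
  rewrite [X in _ <= X -> _]muleAC /K' EFinM -poweR_EFin fineK// => h.
  apply: le_trans h; rewrite le_eqVlt; apply/orP; left; apply/eqP.
  by apply: eq_integral => x _; rewrite /phi muleA.
rewrite -K'E; have no := nn_outer nphi.
have FU x : F x `^ q * U x <= outer phi x.
  rewrite -(outerZl mu mrho (k := F x `^ q) x nu); last exact: poweR_ge0.
  apply: (outer_le mu mrho) => //.
    by apply: nn_measurableM => //; exact: nn_measurable_cst.
  move=> y xy; apply: lee_wpmul2r; first exact: nn_measurable_ge0.
  by apply: le_poweR; [exact: ltW|exact: nn_measurable_ge0|exact: inner_mono].
have Fq0 x : 0 <= F x `^ q * U x.
  by apply: mule_ge0 => //; exact: nn_measurable_ge0.
have U0 x : 0 <= U x by exact: nn_measurable_ge0.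
split.
  apply: le_trans hI; apply: nn_le_integral; [by nnm|by nnm|move=> x].
  rewrite !muleA -[leRHS]muleA -[leLHS]muleA; apply: lee_wpmul2r.
    by apply: mule_ge0 => //; exact: nn_measurable_ge0.
  have -> : F x `^ r1 * U x `^ (r1 / q) = (F x `^ q * U x) `^ (r1 / q).
    by rewrite poweRM// -poweRrM mulrCA mulfV ?mulr1// lt0r_neq0.
  by apply: le_poweR => //; rewrite divr_ge0 ?(ltW r10) ?(ltW q0).
apply: le_trans hJ; apply: nn_le_integral; [by nnm|by nnm|move=> x].
have -> : F x `^ r1 * m2 x = (F x `^ q * U x) `^ (r1 / p1) *
    (V1 x `^ (r1 / p1^') * phi x).
  have e : (r1 = q * (r1 / p1) + q)%R.
    have p1n := lt0r_neq0 p10; have qn := lt0r_neq0 q0.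
    have pq : (p1 - q != 0)%R by rewrite subr_eq0 gt_eqF.
    by rewrite (harmonic_gapE qn p1n pq r1E); field; rewrite ?p1n ?qn ?pq.
  rewrite poweRM// -poweRrM /phi {1}e poweRD_ge0 ?(ltW q0)//; last first.
    by rewrite mulr_ge0 ?divr_ge0 ?(ltW q0) ?(ltW r10) ?(ltW p10).
  by rewrite muleACA !muleA.
apply: lee_wpmul2r.
  by apply: mule_ge0 => //; exact: nn_measurable_ge0.
by apply: le_poweR => //; rewrite divr_ge0 ?(ltW r10) ?(ltW p10).
Qed.

Section last_case.
Variable k : R.
Hypotheses (r1p2 : (r1 < p2)%R) (kE : (k^-1 = r1^-1 - p2^-1)%R).

Let r1k : (r1 < k)%R. Proof. exact: harmonic_gap_gt r10 p20 r1p2 kE. Qed.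
Let k0 : (0 < k)%R. Proof. exact: lt_trans r1k. Qed.

Let W n := \int[mu]_(x in [set x | (rho x < n%:R)%R]) w1 x.
Let W0 n : 0 <= W n. Proof. exact: nn_integral_ge0. Qed.
Let Wfn n : W n \is a fin_num.
Proof. by rewrite ge0_fin_numE//; exact: fin1. Qed.

(* On the n-th set, U and V1 are bounded, so that the mass of U^s V1^t w there is
   at most a multiple of that of w. *)
Let exhausts_density (s t : R) w (l : nat -> \bar R) : (0 <= s)%R -> (0 <= t)%R ->
  nn_measurable w -> (forall n, l n \is a fin_num) ->
  (forall n, \int[mu]_(x in finite_part n) w x <= l n) ->
  exhausts mu rho (fun x => U x `^ s * V1 x `^ t * w x) finite_part.
Proof.
move=> s0 t0 nw lfn hl.
pose b n := n%:R%:E `^ s * W n `^ t.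
have b0 n : 0 <= b n by exact: mule_ge0.
have bfn n : b n \is a fin_num by rewrite fin_numM// fin_num_poweR.
have nphi : nn_measurable (fun x => U x `^ s * V1 x `^ t * w x) by nnm.
apply: (finite_part_exhausts (k := fun n => b n * l n)) => // n.
  by rewrite ltey_eq fin_numM.
have mfn := measurable_finite_part n.
apply: (@le_trans _ _ (\int[mu]_(x in finite_part n) (b n * w x))).
  apply: ge0_le_integral => //.
  - by move=> y _; exact: (nn_measurable_ge0 y nphi).
  - exact: (nn_measurableW nphi).
  - by apply: measurable_funeM; exact: nn_measurableW nw.
  - move=> x [/= Un xn]; apply: lee_wpmul2r; first exact: nn_measurable_ge0.
    apply: lee_pmul => //; apply: le_poweR => //.
    + exact: nn_measurable_ge0.
    + exact: nn_measurable_ge0.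
    + apply: nn_subset_integral => //; first exact: measurable_lt_radius.
      by move=> y /= /lt_trans; apply.
rewrite ge0_integralZl//; last 2 first.
- exact: nn_measurableW.
- by move=> y _; exact: nn_measurable_ge0.
exact: lee_wpmul2l.
Qed.

(** The first necessary condition, for the weight m1. *)
Lemma bilinear_bound_D6 :
  \int[mu]_x (outer m1 x `^ (k / r1) * V2 x `^ (k / r1^') * w2 x) < +oo.
Proof.
have [c c0 hc] := bilinear_bound_iterated.
have [c' c'0 hc'] := hardy_lt_necessary mrho sphere0 r11 r1p2 kE.
have nm1 : nn_measurable m1 by nnm.
have exA : exhausts mu rho m1 finite_part.
  apply: (@exhausts_density _ _ w1 W) => //.
  - by rewrite divr_ge0 ?(ltW r10) ?(ltW q0).
  - by rewrite divr_ge0 ?(ltW r10)// ltW// conj_gt0.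
  - move=> n; apply: nn_subset_integral => //.
    + exact: measurable_finite_part.
    + exact: measurable_lt_radius.
    + by move=> x [].
have [|hI _] := hc' w2 m1 finite_part c nw2 nm1 fin2 exA c0.
  by move=> g mg g0 Nfin; exact: (hc g mg g0 Nfin).1.
under eq_integral do rewrite -muleA.
exact: le_lt_trans hI (ltry _).
Qed.

(** The second necessary condition, for the weight m2, whose outer integral is
    at least a multiple of V1^(r1/p1') U^(r1/q). *)
Lemma bilinear_bound_D4 :
  \int[mu]_x (U x `^ (k / p1 + k / p2) * V1 x `^ (k / p1^') *
    V2 x `^ (k / p2^') * u x) < +oo.
Proof.
have [c c0 hc] := bilinear_bound_iterated.
have [c' c'0 hc'] := hardy_lt_necessary mrho sphere0 r11 r1p2 kE.
have nm2 : nn_measurable m2 by nnm.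
have p1'0 := conj_gt0 p11; have p2'0 := conj_gt0 p21.
have exA : exhausts mu rho m2 finite_part.
  apply: (@exhausts_density _ _ u (fun n => n%:R%:E)) => //.
  - by rewrite divr_ge0 ?(ltW r10) ?(ltW p10).
  - by rewrite divr_ge0 ?(ltW r10) ?(ltW p1'0).
  - exact: finite_part_mass.
have [|_ hJ] := hc' w2 m2 finite_part c nw2 nm2 fin2 exA c0.
  by move=> g mg g0 Nfin; exact: (hc g mg g0 Nfin).2.
have p1n := lt0r_neq0 p10; have p2n := lt0r_neq0 p20; have qn := lt0r_neq0 q0.
have r1n := lt0r_neq0 r10; have kn := lt0r_neq0 k0.
have rq1 : (1 <= r1 / q)%R by rewrite ler_pdivlMr// mul1r ltW.
have r1p1 : (r1 / q - 1 = r1 / p1)%R.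
  have pq : (p1 - q != 0)%R by rewrite subr_eq0 gt_eqF.
  by rewrite (harmonic_gapE qn p1n pq r1E); field; rewrite ?p1n ?qn ?pq.
have kp2 : (k / p2 + 1 = k / r1)%R.
  have e : (k * k^-1 = k * (r1^-1 - p2^-1))%R by rewrite kE.
  by move: e; rewrite mulfV// mulrBr => ->; rewrite addrC subrK.
have no := nn_outer nm2.
have m20 x : 0 <= m2 x by exact: (nn_measurable_ge0 x nm2).
pose C := (2 `^ (r1 / q) : R)%R.
have C0 : 0 <= C%:E :> \bar R by rewrite lee_fin powR_ge0.
have h1 x : U x < +oo ->
    V1 x `^ (r1 / p1^') * U x `^ (r1 / q) <= C%:E * outer m2 x.
  move=> Ufin; have nUu : nn_measurable (fun y => U y `^ (r1 / p1) * u y) by nnm.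
  have := outer_poweR_le mrho sphere0 nu Ufin rq1; rewrite r1p1 => h.
  apply: (@le_trans _ _ (V1 x `^ (r1 / p1^') *
      (C%:E * outer (fun y => U y `^ (r1 / p1) * u y) x))).
    exact: lee_wpmul2l.
  rewrite muleCA; apply: lee_wpmul2l => //.
  rewrite -(outerZl mu mrho (k := V1 x `^ (r1 / p1^')) x nUu); last exact: poweR_ge0.
  apply: (outer_le mu mrho) => //.
    by apply: nn_measurableM => //; exact: nn_measurable_cst.
  move=> y xy; rewrite muleA [V1 x `^ _ * _]muleC; apply: lee_wpmul2r.
    exact: nn_measurable_ge0.
  apply: lee_wpmul2l => //; apply: le_poweR.
  - by rewrite divr_ge0 ?(ltW r10) ?(ltW p1'0).
  - exact: nn_measurable_ge0.
  - exact: inner_mono.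
pose C2 := (C `^ (k / p2))%R.
have h2 x : U x `^ (k / p1 + k / p2) * V1 x `^ (k / p1^') *
    V2 x `^ (k / p2^') * u x <=
    C2%:E * (outer m2 x `^ (k / p2) * (V2 x `^ (k / p2^') * m2 x)).
  have rhs0 : 0 <= C2%:E * (outer m2 x `^ (k / p2) * (V2 x `^ (k / p2^') * m2 x)).
    apply: mule_ge0; first by rewrite lee_fin powR_ge0.
    by apply: mule_ge0 => //; exact: mule_ge0.
  have [V10|V1n0] := eqVneq (V1 x) 0.
    apply: le_trans rhs0; rewrite V10 poweR0r ?mule0 ?mul0e//.
    by rewrite mulf_neq0 ?invr_eq0 ?lt0r_neq0.
  have [V20|V2n0] := eqVneq (V2 x) 0.
    apply: le_trans rhs0; rewrite V20 [0 `^ (k / p2^')]poweR0r; last first.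
      by rewrite mulf_neq0 ?invr_eq0 ?lt0r_neq0.
    by rewrite mule0 mul0e.
  have Vp1 : 0 < V1 x by rewrite lt0e V1n0; exact: nn_measurable_ge0.
  have Vp2 : 0 < V2 x by rewrite lt0e V2n0; exact: nn_measurable_ge0.
  have Ufin : U x < +oo.
    rewrite ltey; apply/eqP => Uy; have := bilinear_bound_D1 x.
    by rewrite Uy !gt0_mulye ?poweR_gt0// leye_eq.
  have -> : U x `^ (k / p1 + k / p2) * V1 x `^ (k / p1^') *
      V2 x `^ (k / p2^') * u x = (V1 x `^ (r1 / p1^') * U x `^ (r1 / q)) `^ (k / p2) *
      (V2 x `^ (k / p2^') * m2 x).
    rewrite poweRM// -!poweRrM.
    have -> : (k / p1 + k / p2 = r1 / q * (k / p2) + r1 / p1)%R.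
      have -> : (r1 / q = r1 / p1 + 1)%R by rewrite -r1p1 subrK.
      rewrite mulrDl mul1r addrAC; congr (_ + _)%R.
      rewrite -[X in (_ + X)%R]mulr1 -mulrDr kp2; field.
      by rewrite ?p1n ?r1n.
    have -> : (k / p1^' = r1 / p1^' * (k / p2) + r1 / p1^')%R.
      rewrite -[X in (_ + X)%R]mulr1 -mulrDr kp2; field.
      by rewrite ?r1n ?lt0r_neq0.
    have kp20 : (0 <= k / p2)%R by rewrite divr_ge0 ?(ltW k0) ?(ltW p20).
    have e1 : (0 <= r1 / q * (k / p2))%R.
      by apply: mulr_ge0 => //; rewrite divr_ge0 ?(ltW r10) ?(ltW q0).
    have e2 : (0 <= r1 / p1)%R by rewrite divr_ge0 ?(ltW r10) ?(ltW p10).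
    have e3 : (0 <= r1 / p1^')%R by rewrite divr_ge0 ?(ltW r10) ?(ltW p1'0).
    have e4 : (0 <= r1 / p1^' * (k / p2))%R by rewrite mulr_ge0.
    rewrite (poweRD_ge0 _ e1 e2) (poweRD_ge0 _ e4 e3).
    rewrite muleACA [X in X * _ * _ * _]muleC -!muleA; congr (_ * (_ * _)).
    by rewrite [RHS]muleCA; congr (_ * _); rewrite [RHS]muleCA.
  rewrite (muleA C2%:E); apply: lee_wpmul2r; first exact: mule_ge0.
  rewrite /C2 -poweR_EFin -poweRM//; last exact: nn_measurable_ge0.
  apply: le_poweR; [by rewrite divr_ge0 ?(ltW k0) ?(ltW p20)|exact: mule_ge0|].
  exact: h1.
apply: (@le_lt_trans _ _ (\int[mu]_x (C2%:E *
    (outer m2 x `^ (k / p2) * (V2 x `^ (k / p2^') * m2 x))))).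
  apply: nn_le_integral => //; first by nnm.
  apply: nn_measurableM; last by nnm.
  by apply: nn_measurable_cst; rewrite lee_fin powR_ge0.
rewrite nn_integralZl ?lee_fin ?powR_ge0//; last by nnm.
apply: (@le_lt_trans _ _ (C2%:E * (c' * c `^ (k / r1))%:E)).
  by apply: lee_wpmul2l; [rewrite lee_fin powR_ge0|exact: hJ].
by rewrite -EFinM ltry.
Qed.

End last_case.

End iterated.

End weights.
End bilinear_necessity.

(** * Sufficiency for the bilinear Hardy inequality *)

Section bilinear_equivalence.
Context d (T : measurableType d) (R : realType).
Variables (mu : {sigma_finite_measure set T -> \bar R}) (rho : T -> R).
Hypothesis mrho : measurable_fun setT rho.
Hypothesis sphere0 : forall r, mu [set x | rho x = r] = 0.
Implicit Types u w : T -> \bar R.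

Local Notation inner := (inner_integral mu rho).
Local Notation outer := (outer_integral mu rho).
Local Notation norm_pow p g w := (\int[mu]_x (g x `^ p * w x)).

Let nn_inner f (nf : nn_measurable f) : nn_measurable (inner f) :=
  nn_measurable_inner mu mrho nf.
Let nn_outer f (nf : nn_measurable f) : nn_measurable (outer f) :=
  nn_measurable_outer mu mrho nf.

(** The bound on the term of the product rule in which the power of the first
    inner integral is differentiated. *)
Definition term_bound (q p1 p2 : R) u w1 w2 (c : R) :=
  forall g1 g2 : T -> \bar R, nn_measurable g1 -> nn_measurable g2 ->
  norm_pow p1 g1 w1 < +oo -> norm_pow p2 g2 w2 < +oo ->
  \int[mu]_x (outer u x * inner (fun y => g2 y * w2 y) x `^ q *
    inner (fun y => g1 y * w1 y) x `^ (q - 1) * (g1 x * w1 x)) <=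
  c%:E * (norm_pow p1 g1 w1) `^ (q / p1) * (norm_pow p2 g2 w2) `^ (q / p2).

Lemma norm_pow_eq0_inner (p : R) g w x : (0 < p)%R ->
  nn_measurable g -> nn_measurable w -> norm_pow p g w = 0 ->
  inner (fun y => g y * w y) x = 0.
Proof.
move=> p0 ng nw N0; have ngp : nn_measurable (fun y => g y `^ p * w y) by nnm.
have ngw : nn_measurable (fun y => g y * w y) by nnm.
apply/eqP; rewrite eq_le nn_integral_ge0// andbT.
have <- : \int[mu]_y (g y * w y) = 0.
  rewrite -[RHS](integral0 mu setT); apply: nn_ae_eq_integral => //.
  apply: filterS (nn_integral_eq0 ngp measurableT N0) => y /= /(_ I) /eqP.
  rewrite mule_eq0 => /orP[/eqP h|/eqP ->]; last by rewrite mule0.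
  by rewrite (poweR_eq0_eq0 (nn_measurable_ge0 y ng) h) mul0e.
by apply: nn_subset_integral => //; exact: measurable_below.
Qed.

Section weights.
Variables (q p1 p2 : R) (u w1 w2 : T -> \bar R).
Hypotheses (q1 : (1 < q)%R) (p11 : (1 < p1)%R) (p21 : (1 < p2)%R).
Hypotheses (nu : nn_measurable u) (nw1 : nn_measurable w1)
  (nw2 : nn_measurable w2).
Hypotheses (fin1 : ball_finite mu rho w1) (fin2 : ball_finite mu rho w2).

Let q0 : (0 < q)%R. Proof. exact: lt_trans q1. Qed.
Let p10 : (0 < p1)%R. Proof. exact: lt_trans p11. Qed.
Let p20 : (0 < p2)%R. Proof. exact: lt_trans p21. Qed.

Let Vfin1 x : inner w1 x < +oo. Proof. exact: fin1. Qed.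
Let Vfin2 x : inner w2 x < +oo. Proof. exact: fin2. Qed.

(** By the product rule, the bounds on both terms give the bilinear inequality.
    When the norm of one function is 0 or infinite the inequality is trivial. *)
Lemma bilinear_bound_suff (c c' : R) : (0 <= c)%R -> (0 <= c')%R ->
  term_bound q p1 p2 u w1 w2 c -> term_bound q p2 p1 u w2 w1 c' ->
  exists2 K, (0 <= K)%R & bilinear_bound mu rho q p1 p2 u w1 w2 K.
Proof.
move=> c0 c'0 hc hc'; pose K := (4 `^ q * (c + c') + 1)%R.
have K0 : (0 < K)%R.
  by rewrite ltr_wpDl// mulr_ge0 ?powR_ge0// addr_ge0.
exists K => [|g1 g2 mg1 mg2 g10 g20]; first exact: ltW.
have ng1 : nn_measurable (fun y => (g1 y)%:E) by exact: nn_measurable_EFin.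
have ng2 : nn_measurable (fun y => (g2 y)%:E) by exact: nn_measurable_EFin.
have nf1 : nn_measurable (fun y => (g1 y)%:E * w1 y) by nnm.
have nf2 : nn_measurable (fun y => (g2 y)%:E * w2 y) by nnm.
set N1 := norm_pow p1 (fun y => (g1 y)%:E) w1.
set N2 := norm_pow p2 (fun y => (g2 y)%:E) w2.
have N10 : 0 <= N1 by apply: nn_integral_ge0; nnm.
have N20 : 0 <= N2 by apply: nn_integral_ge0; nnm.
have rhs0 : 0 <= K%:E * N1 `^ (q / p1) * N2 `^ (q / p2).
  by rewrite mule_ge0// mule_ge0// lee_fin ltW.
have [N1z|N1n0] := eqVneq N1 0.
  rewrite integral0_eq// => x _; rewrite (norm_pow_eq0_inner _ p10 ng1 nw1 N1z).
  by rewrite poweR0r ?mul0e// lt0r_neq0.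
have [N2z|N2n0] := eqVneq N2 0.
  rewrite integral0_eq// => x _; rewrite (norm_pow_eq0_inner _ p20 ng2 nw2 N2z).
  by rewrite [0 `^ q]poweR0r ?mule0 ?mul0e// lt0r_neq0.
have N1p : 0 < N1 by rewrite lt0e N1n0.
have N2p : 0 < N2 by rewrite lt0e N2n0.
have [N1y|N1y] := eqVneq N1 +oo.
  rewrite N1y poweRyr ?gt0_muley ?lte_fin// ?gt0_mulye ?poweR_gt0 ?leey//.
  by rewrite mulf_neq0 ?invr_eq0 ?lt0r_neq0.
have [N2y|N2y] := eqVneq N2 +oo.
  rewrite N2y poweRyr ?gt0_muley ?leey ?mule_gt0 ?lte_fin ?poweR_gt0//.
  by rewrite mulf_neq0 ?invr_eq0 ?lt0r_neq0.
have N1fin : N1 < +oo by rewrite ltey.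
have N2fin : N2 < +oo by rewrite ltey.
have F1 x := inner_fin mrho p11 nw1 ng1 (fin1 (rho x)) N1fin.
have F2 x := inner_fin mrho p21 nw2 ng2 (fin2 (rho x)) N2fin.
apply: (le_trans (integral_inner2_poweR_le mrho sphere0 nf1 nf2 nu F1 F2 (ltW q1))).
have h1 := hc _ _ ng1 ng2 N1fin N2fin; have h2 := hc' _ _ ng2 ng1 N2fin N1fin.
rewrite -/N1 -/N2 in h1 h2.
apply: (@le_trans _ _ ((4 `^ q)%:E * (c%:E * N1 `^ (q / p1) * N2 `^ (q / p2) +
   c'%:E * N2 `^ (q / p2) * N1 `^ (q / p1)))).
  by apply: lee_wpmul2l; [rewrite lee_fin powR_ge0|exact: leeD].
rewrite [X in _ * (_ + X)]muleAC -!muleA -ge0_muleDl ?lee_fin// -EFinD.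
rewrite (muleA (4 `^ q)%:E) -EFinM; apply: lee_wpmul2r; first exact: mule_ge0.
by rewrite lee_fin /K lerDl.
Qed.

Lemma term_bound_le (A : R) : (p1 <= q)%R -> (0 <= A)%R ->
  (forall x, outer u x * inner w1 x `^ (q / p1^') * inner w2 x `^ (q / p2^')
    <= A%:E) ->
  exists2 c : R, (0 <= c)%R & term_bound q p1 p2 u w1 w2 c.
Proof.
move=> p1q A0 hA; have [c c0 hc] := bilinear_term_le mrho sphere0 p11 p1q p21.
exists (c * A)%R => [|g1 g2 ng1 ng2 _ _]; first exact: mulr_ge0.
by rewrite EFinM; apply: hc.
Qed.

Variable r1 : R.
Hypotheses (qp1 : (q < p1)%R) (r1E : (r1^-1 = q^-1 - p1^-1)%R).

Local Notation tail := (outer (fun y =>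
  outer u y `^ (r1 / q) * inner w1 y `^ (r1 / q^') * w1 y)).

Lemma term_bound_lt_le (A : R) : (p2 <= r1)%R -> (0 <= A)%R ->
  (forall x, tail x * inner w2 x `^ (r1 / p2^') <= A%:E) ->
  exists2 c : R, (0 <= c)%R & term_bound q p1 p2 u w1 w2 c.
Proof.
move=> p2r A0 hA.
have [c c0 hc] := bilinear_term_lt_le mrho sphere0 q1 qp1 p21 p2r r1E.
exists (c * A `^ (q / r1))%R => [|g1 g2 ng1 ng2 _ N2].
  by rewrite mulr_ge0 ?powR_ge0.
by rewrite EFinM -poweR_EFin; apply: hc.
Qed.

Lemma term_bound_lt_lt (k : R) : (r1 < p2)%R -> (k^-1 = r1^-1 - p2^-1)%R ->
  \int[mu]_x (tail x `^ (k / r1) * inner w2 x `^ (k / r1^') * w2 x) < +oo ->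
  exists2 c : R, (0 <= c)%R & term_bound q p1 p2 u w1 w2 c.
Proof.
move=> r1p2 kE Dfin.
have [c c0 hc] := bilinear_term_lt_lt mrho sphere0 q1 qp1 r1p2 r1E kE.
set D := \int[mu]_x _ in Dfin.
have nt : nn_measurable tail.
  have nU := nn_outer nu; have nV := nn_inner nw1.
  by apply: nn_outer; nnm.
have nV2 := nn_inner nw2.
have D0 : 0 <= D by apply: nn_integral_ge0; nnm.
have Dfn : D \is a fin_num by rewrite ge0_fin_numE.
exists (c * fine D `^ (q / k))%R => [|g1 g2 ng1 ng2 _ N2].
  by rewrite mulr_ge0 ?powR_ge0.
rewrite EFinM -poweR_EFin fineK//.
by apply: hc.
Qed.

End weights.
End bilinear_equivalence.

(** * Metric measure spaces with a polar decomposition *)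

(** A sigma-finite measure, as an element of the type of such measures. *)
Lemma sigma_finite_measure_ex d (T : measurableType d) (R : realType)
  (mu : {measure set T -> \bar R}) : sigma_finite setT mu ->
  exists nu : {sigma_finite_measure set T -> \bar R},
    mu = nu :> {measure set T -> \bar R}.
Proof.
move=> mufin; pose H1 := isSFinite.Build _ _ _ _
  (sfinite_measure_sigma_finite mufin).
pose H2 := isSigmaFinite.Build _ _ _ _ mufin.
pose nu := HB.pack_for (SigmaFiniteMeasure.type T R) (Measure.sort mu) H1 H2.
by exists nu; exact: eq_measure.
Qed.

Section borel_metric.
Context {d : measure_display} {R : realType} {X : borelMetricType d R}.
Variables (mu : {measure set X -> \bar R}) (a : X).

Local Notation rho := (fun x : X => mdist a x).

Lemma open_metric_ball (r : R) : open (ball a r).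
Proof.
rewrite openE => x; rewrite ballEmdist /= => xr.
apply/nbhs_ballP; exists (r - mdist a x)%R; first by rewrite /= subr_gt0.
move=> y; rewrite !ballEmdist /= => xy.
by apply: (le_lt_trans (metric_triangle _ x _)); rewrite -ltrBrDl.
Qed.

Lemma measurable_metric_ball (r : R) : measurable (ball a r).
Proof.
rewrite borel_measurableE; apply: sub_sigma_algebra; exact: open_metric_ball.
Qed.

Lemma measurable_radius : measurable_fun setT rho.
Proof.
apply: (measurability _ (RGenInftyO.measurableE R)) => _ [_ [r ->] <-].
rewrite setTI; have -> : rho @^-1` `]-oo, r[ = ball a r.
  by apply/seteqP; split => x; rewrite ballEmdist /= in_itv.
exact: measurable_metric_ball.
Qed.

Lemma centered_ballE x : centered_ball a x = below rho x.
Proof. by rewrite /centered_ball ballEmdist. Qed.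

(** A measure that carries an a.e. positive weight of finite mass on balls is
    sigma-finite: the part of a ball where w is at least 1/(n+1) has finite
    measure. *)
Lemma weight_sigma_finite (w : X -> R) : measurable_fun setT w ->
  (forall x, 0 <= w x)%R -> {ae mu, forall x, (0 < w x)%R} ->
  (forall t : R, \int[mu]_(x in [set x | (rho x < t)%R]) (w x)%:E < +oo) ->
  sigma_finite setT mu.
Proof.
move=> mw w0 wpos wfin.
have mle c : measurable [set x | (w x <= c)%R].
  have -> : [set x | (w x <= c)%R] = w @^-1` `]-oo, c].
    by apply/seteqP; split => x; rewrite /= in_itv.
  by rewrite -[X in measurable X]setTI; exact: mw.
have mge c : measurable [set x | (c <= w x)%R].
  have -> : [set x | (c <= w x)%R] = w @^-1` `[c, +oo[.
    by apply/seteqP; split => x; rewrite /= in_itv/= andbT.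
  by rewrite -[X in measurable X]setTI; exact: mw.
have mrho := measurable_radius.
have mlt t := measurable_lt_radius mrho t.
exists (fun n => ([set x | (n.+1%:R^-1 <= w x)%R] `&` [set x | (rho x < n%:R)%R])
    `|` [set x | (w x <= 0)%R]).
  apply/seteqP; split => // x _.
  have [wx|wx] := leP (w x) 0%R; first by exists 0%N => //; right.
  pose n := (maxn (Num.bound (w x)^-1) (Num.bound (rho x)))%R.
  exists n => //; left; split => /=.
    rewrite invf_ple ?posrE//; apply/ltW/(lt_le_trans (archi_boundP _)).
      by rewrite invr_ge0.
    rewrite ler_nat; exact: leq_trans (leq_maxl _ _) (leqnSn _).
  apply: (lt_le_trans (archi_boundP (mdist_ge0 _ _))).
  by rewrite ler_nat leq_maxr.
move=> n; split; first by apply: measurableU => //; exact: measurableI.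
have null0 : mu [set x | (w x <= 0)%R] = 0.
  apply/negligibleP => //; apply: negligibleS wpos => x /= wx.
  by apply/negP; rewrite -leNgt.
rewrite (le_lt_trans (measureU2 _ _ _))//; first exact: measurableI.
rewrite [X in _ + X]null0 adde0.
have mI : measurable ([set x | (n.+1%:R^-1 <= w x)%R] `&` [set x | (rho x < n%:R)%R]).
  exact: measurableI.
have n0 : (0 < n.+1%:R^-1 :> R)%R by rewrite invr_gt0.
rewrite ltey; apply/eqP => mu_oo.
have mwE : measurable_fun [set x | (rho x < n%:R)%R] (fun x => (w x)%:E).
  by apply/measurable_EFinP; exact: measurable_funS mw.
have := le_integral_abse mu (mlt n%:R) mwE n0.
have -> : [set x | (rho x < n%:R)%R] `&` [set x | n.+1%:R^-1%:E <= `|(w x)%:E|] =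
    [set x | (n.+1%:R^-1 <= w x)%R] `&` [set x | (rho x < n%:R)%R].
  rewrite setIC; congr (_ `&` _); apply/seteqP.
  by split => x /=; rewrite lee_fin ger0_norm.
rewrite mu_oo gt0_muley ?lte_fin// leye_eq => /eqP h.
have := wfin n%:R; rewrite -h; under eq_integral do rewrite gee0_abs ?lee_fin//.
by rewrite ltxx.
Qed.

(** In a space with a polar decomposition every sphere is null: the indicator
    of a part of finite measure of a sphere has a nonzero integral over the
    sphere of a single radius only. *)
Lemma polar_sphere_null (r : R) : sigma_finite setT mu ->
  polar_decomposition mu a -> mu [set x | rho x = r] = 0.
Proof.
move=> [F FT Ffin] [lambda [sigma [_ polar]]].
have mS : measurable [set x | rho x = r] by exact: measurable_sphere measurable_radius r.
have null n : mu ([set x | rho x = r] `&` F n) = 0.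
  set E := _ `&` _; have [mF muF] := Ffin n.
  have mE : measurable E by exact: measurableI.
  have muE : mu E < +oo by apply: le_lt_trans muF; apply: measureIr.
  have := polar (\1_E) _; case=> [|_ _].
    apply/integrableP; split; first exact/measurable_EFinP/measurable_indic.
    under eq_integral do rewrite /= ger0_norm ?indicE//.
    by rewrite (integral_indic mu) ?setIT.
  rewrite integral_indic// setIT => ->.
  pose G := fun s : R => \int[sigma s]_(x in metric_sphere a s)
    (\1_E x * lambda x)%:E.
  have G0 s : (`]0%R, +oo[ `\ r)%classic s -> G s = 0.
    move=> [_ /= sr]; rewrite /G integral0_eq// => x; rewrite /metric_sphere /= => xs.
    rewrite indicE memNset ?mul0r// => -[/= xr _]; apply: sr.
    by rewrite -xs metric_sym xr.
  have mD : measurable (`]0%R, +oo[ `\ r : set R) by exact: measurableD.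
  rewrite -(@integral_setD1 R G r `]0%R, +oo[)//.
    by rewrite integral0_eq.
  apply: (eq_measurable_fun (cst 0)) => // s; rewrite inE => /G0 ->.
  by [].
have -> : [set x | rho x = r] = \bigcup_n ([set x | rho x = r] `&` F n).
  by rewrite -setI_bigcupr -FT setIT.
have mI n : measurable ([set x | rho x = r] `&` F n).
  by apply: measurableI => //; exact: (Ffin n).1.
apply/negligibleP; first exact: bigcupT_measurable.
by apply: negligible_bigcup => n; apply/negligibleP; [exact: mI|exact: null].
Qed.

Implicit Types (p : R) (v : X -> R).

Lemma measurable_dual_weight p v : measurable_fun setT v ->
  measurable_fun setT (dual_weight p v).
Proof. by move=> mv; exact: (measurableT_comp (measurable_powR _) mv). Qed.

Lemma dual_weight_ge0 p v (x : X) : (0 <= dual_weight p v x)%R.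
Proof. exact: powR_ge0. Qed.

Lemma dual_weight_gt0_ae p v :
  {ae mu, forall x, (0 < v x)%R} ->
  {ae mu, forall x, (0 < dual_weight p v x)%R}.
Proof. by apply: filterS => x vx; exact: powR_gt0. Qed.

Lemma dual_weight_ball_fin p v (t : R) :
  metric_locally_integrable mu setT (dual_weight p v) ->
  \int[mu]_(x in [set x | (rho x < t)%R]) (dual_weight p v x)%:E < +oo.
Proof.
move=> [_ _ h]; have := h [set x | (rho x < t)%R] (measurable_lt_radius measurable_radius t).
under eq_integral do rewrite ger0_norm ?dual_weight_ge0//.
apply; first by exists a, t => y /= /ltW.
by exists 1%R => // x y _; case.
Qed.

End borel_metric.

(** * The conditions in terms of inner and outer integrals *)

Section transfer.
Context {d : measure_display} {R : realType} {X : borelMetricType d R}.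
Variables (mu : {sigma_finite_measure set X -> \bar R}) (a : X).

Local Notation rho := (fun x : X => mdist a x).
Hypothesis sphere0 : forall r, mu [set x | rho x = r] = 0.
Implicit Types (p q r k : R) (u v : X -> R).

Local Notation inner := (inner_integral mu rho).
Local Notation outer := (outer_integral mu rho).

Let mrho : measurable_fun setT rho. Proof. exact: measurable_radius. Qed.

(** The dual weight as a nonnegative extended-real density. *)
Definition dual_density (p : R) (v : X -> R) (x : X) : \bar R :=
  (dual_weight p v x)%:E.

(** The weight u, made nonnegative everywhere. *)
Definition pos_part (u : X -> R) (x : X) : \bar R := (Num.max (u x) 0%R)%:E.

Lemma nn_measurable_dual_density p v : measurable_fun setT v ->
  nn_measurable (dual_density p v).
Proof.
move=> mv; apply: nn_measurable_EFin; first exact: measurable_dual_weight.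
exact: dual_weight_ge0.
Qed.

Lemma nn_measurable_pos_part u : measurable_fun setT u ->
  nn_measurable (pos_part u).
Proof.
move=> mf; apply: nn_measurable_EFin; first exact: measurable_maxr.
by move=> x; rewrite le_max lexx orbT.
Qed.

Lemma hardyV_inner p v : hardyV mu a p v = inner (dual_density p v).
Proof. by apply/funext => x; rewrite /hardyV centered_ballE. Qed.

Lemma hardyU_outer u : measurable_fun setT u ->
  {ae mu, forall x, (0 < u x)%R} -> hardyU mu a u = outer (pos_part u).
Proof.
move=> mf u0; apply/funext => x; rewrite /hardyU centered_ballE.
apply: ae_eq_integral.
- exact/measurableC/measurable_below.
- by apply/measurable_EFinP; exact: measurable_funS mf.
- exact: (nn_measurableW (nn_measurable_pos_part mf)).
- by apply: filterS u0 => y uy _; rewrite /pos_part max_l// ltW.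
Qed.

Lemma hardy_tail_outer q r p u v : measurable_fun setT u ->
  {ae mu, forall x, (0 < u x)%R} ->
  hardy_tail mu a q r p u v = outer (fun y => outer (pos_part u) y `^ (r / q) *
    inner (dual_density p v) y `^ (r / q^') * dual_density p v y).
Proof.
move=> mf u0; apply/funext => x.
by rewrite /hardy_tail (hardyU_outer mf u0) hardyV_inner centered_ballE.
Qed.

Lemma inner_center f : inner f a = 0.
Proof.
rewrite /inner_integral (_ : below rho a = set0) ?integral_set0//.
by apply/seteqP; split => // y; rewrite /below /= mdistxx ltNge mdist_ge0.
Qed.

(** A supremum over the points other than a is finite when some power of the
    function is bounded; at a itself the function vanishes. *)
Lemma sup_ltyP (f : X -> \bar R) (t : R) : (0 < t)%R ->
  (forall x, 0 <= f x) -> f a = 0 ->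
  ereal_sup [set f x | x in [set~ a]] < +oo <->
  exists2 K : R, (0 <= K)%R & forall x, f x `^ t <= K%:E.
Proof.
move=> t0 f0 fa; split=> [|[K K0 hK]].
  set S := ereal_sup _ => Sfin.
  have SK : S <= (Num.max (fine S) 0%R)%:E.
    case: S Sfin => [s| |]//= _; first by rewrite lee_fin le_max lexx.
    by rewrite leNye.
  have K0 : (0 <= Num.max (fine S) 0)%R by rewrite le_max lexx orbT.
  exists (Num.max (fine S) 0 `^ t)%R; first exact: powR_ge0.
  move=> x; rewrite -poweR_EFin; apply: le_poweR => //; first exact: ltW.
  have [->|/eqP xa] := eqVneq x a; first by rewrite fa lee_fin.
  by apply: le_trans SK; apply: ereal_sup_ubound; exists x.
apply: (@le_lt_trans _ _ (K `^ t^-1)%:E); last exact: ltry.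
apply: ge_ereal_sup => _ [x _ <-]; rewrite -(poweRK (lt0r_neq0 t0) (f0 x)).
by rewrite -poweR_EFin; apply: le_poweR => //; rewrite invr_ge0 ltW.
Qed.

Lemma poweRV_ltyP (x : \bar R) (k : R) : (0 < k)%R -> 0 <= x ->
  x `^ k^-1 < +oo <-> x < +oo.
Proof.
move=> k0 x0; split; last exact: poweR_lty.
by apply: lty_poweRy; rewrite invr_neq0// lt0r_neq0.
Qed.

Section weights.
Variables (q p1 p2 : R) (u v1 v2 : X -> R).
Hypotheses (q0 : (0 < q)%R) (p11 : (1 < p1)%R) (p21 : (1 < p2)%R).
Hypotheses (mu_ : measurable_fun setT u) (mv1 : measurable_fun setT v1)
  (mv2 : measurable_fun setT v2).
Hypotheses (u0 : {ae mu, forall x, (0 < u x)%R})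
  (v10 : {ae mu, forall x, (0 < v1 x)%R})
  (v20 : {ae mu, forall x, (0 < v2 x)%R}).

Local Notation w1 := (dual_density p1 v1).
Local Notation w2 := (dual_density p2 v2).
Local Notation up := (pos_part u).

Let nn_inner f (nf : nn_measurable f) : nn_measurable (inner f) :=
  nn_measurable_inner mu mrho nf.
Let nw1 : nn_measurable w1. Proof. exact: nn_measurable_dual_density. Qed.
Let nw2 : nn_measurable w2. Proof. exact: nn_measurable_dual_density. Qed.
Let nup : nn_measurable up. Proof. exact: nn_measurable_pos_part. Qed.

(** Writing f = g v^(1-p'), the norm of f in L^p(v) is that of g with respect
    to the dual density. *)
Lemma norm_dual (p : R) (v f g : X -> R) : (1 < p)%R ->
  measurable_fun setT v -> measurable_fun setT f -> measurable_fun setT g ->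
  (forall x, 0 <= g x)%R ->
  {ae mu, forall x, (0 < v x)%R} ->
  {ae mu, forall x, f x = (g x * dual_weight p v x)%R} ->
  \int[mu]_x (f x `^ p * v x)%:E =
  \int[mu]_x ((g x)%:E `^ p * dual_density p v x).
Proof.
move=> pgt1 mv mf mg g0 v0 fg; apply: ae_eq_integral => //.
- apply/measurable_EFinP; apply: measurable_funM => //.
  exact: (measurableT_comp (measurable_powR _) mf).
- have ng : nn_measurable (fun x => (g x)%:E) by exact: nn_measurable_EFin.
  have nd := nn_measurable_dual_density p mv.
  have ngd : nn_measurable (fun x => (g x)%:E `^ p * dual_density p v x) by nnm.
  exact: (nn_measurableW ngd).
have pn0 : (p - 1 != 0)%R by rewrite subr_eq0 gt_eqF.
apply: filterS2 v0 fg => x vx fgx _.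
rewrite fgx poweR_EFin /dual_density -EFinM powRM ?dual_weight_ge0// -mulrA.
congr (_ * _)%:E; rewrite /dual_weight -powRrM -[X in (_ * X)%R](powRr1 (ltW vx)).
rewrite -powRD; last by rewrite (gt_eqF vx) implybT.
by congr (_ `^ _)%R; rewrite /conjugate_exponent; field.
Qed.

Lemma inner_dual (p : R) (v f g : X -> R) x :
  measurable_fun setT v -> measurable_fun setT f -> measurable_fun setT g ->
  (forall x, 0 <= g x)%R ->
  {ae mu, forall x, f x = (g x * dual_weight p v x)%R} ->
  \int[mu]_(y in centered_ball a x) (f y)%:E =
  inner (fun y => (g y)%:E * dual_density p v y) x.
Proof.
move=> mv mf mg g0 fg; rewrite centered_ballE; apply: ae_eq_integral.
- exact: measurable_below.
- by apply/measurable_EFinP; exact: measurable_funS mf.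
- have ng : nn_measurable (fun x => (g x)%:E) by exact: nn_measurable_EFin.
  have nd := nn_measurable_dual_density p mv.
  have ngd : nn_measurable (fun x => (g x)%:E * dual_density p v x) by nnm.
  exact: (nn_measurableW ngd).
- by apply: filterS fg => y fgy _; rewrite fgy EFinM.
Qed.

(* The function g such that f = g v^(1-p') wherever v > 0. *)
Let quotient p v (f : X -> R) x := (f x * v x `^ (p^' - 1))%R.

Let quotientP p v (f : X -> R) : measurable_fun setT v -> measurable_fun setT f ->
  (forall x, 0 <= f x)%R -> {ae mu, forall x, (0 < v x)%R} ->
  [/\ measurable_fun setT (quotient p v f), forall x, (0 <= quotient p v f x)%R &
    {ae mu, forall x, f x = (quotient p v f x * dual_weight p v x)%R}].
Proof.
move=> mv mf f0 v0; split.
- apply: measurable_funM => //.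
  exact: (measurableT_comp (measurable_powR _) mv).
- by move=> x; rewrite mulr_ge0 ?powR_ge0.
apply: filterS v0 => x vx; rewrite /quotient /dual_weight -mulrA -powRD.
  by rewrite (_ : p^' - 1 + (1 - p^') = 0)%R ?powRr0 ?mulr1//; ring.
by rewrite (gt_eqF vx) implybT.
Qed.

Lemma H2B_dual (f1 f2 g1 g2 : X -> R) :
  measurable_fun setT f1 -> measurable_fun setT f2 ->
  measurable_fun setT g1 -> measurable_fun setT g2 ->
  (forall x, 0 <= g1 x)%R -> (forall x, 0 <= g2 x)%R ->
  {ae mu, forall x, f1 x = (g1 x * dual_weight p1 v1 x)%R} ->
  {ae mu, forall x, f2 x = (g2 x * dual_weight p2 v2 x)%R} ->
  \int[mu]_x (H2B mu a f1 f2 x `^ q * (u x)%:E) =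
  \int[mu]_x (inner (fun y => (g1 y)%:E * w1 y) x `^ q *
    inner (fun y => (g2 y)%:E * w2 y) x `^ q * up x).
Proof.
move=> mf1 mf2 mg1 mg2 g10 g20 fg1 fg2.
have ng1 : nn_measurable (fun y => (g1 y)%:E) by exact: nn_measurable_EFin.
have ng2 : nn_measurable (fun y => (g2 y)%:E) by exact: nn_measurable_EFin.
have nF1 : nn_measurable (inner (fun y => (g1 y)%:E * w1 y)).
  by apply: nn_inner; nnm.
have nF2 : nn_measurable (inner (fun y => (g2 y)%:E * w2 y)).
  by apply: nn_inner; nnm.
have HE x : H2B mu a f1 f2 x `^ q = inner (fun y => (g1 y)%:E * w1 y) x `^ q *
    inner (fun y => (g2 y)%:E * w2 y) x `^ q.
  rewrite /H2B (inner_dual x mv1 mf1 mg1 g10 fg1) (inner_dual x mv2 mf2 mg2 g20 fg2).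
  by rewrite poweRM//; exact: nn_measurable_ge0.
have nFF : nn_measurable (fun x => inner (fun y => (g1 y)%:E * w1 y) x `^ q *
    inner (fun y => (g2 y)%:E * w2 y) x `^ q) by nnm.
apply: ae_eq_integral => //.
- under eq_fun do rewrite HE.
  apply: emeasurable_funM; first exact: (nn_measurableW nFF).
  exact/measurable_EFinP.
- have nFu := nn_measurableM nFF nup.
  exact: (nn_measurableW nFu).
- apply: filterS u0 => x ux _.
  by rewrite HE /pos_part max_l// ltW.
Qed.

(** The bilinear Hardy inequality is the q-th root of [bilinear_bound], with the
    dual densities for weights. *)
Lemma bilinear_hardyP : bilinear_hardy mu a q p1 p2 u v1 v2 <->
  exists2 K, (0 <= K)%R & bilinear_bound mu rho q p1 p2 up w1 w2 K.
Proof.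
have p10 : (0 < p1)%R by exact: lt_trans p11.
have p20 : (0 < p2)%R by exact: lt_trans p21.
have qn0 := lt0r_neq0 q0.
split=> [[C C0 hC]|[K K0 hK]].
  exists (C `^ q)%R => [|g1 g2 mg1 mg2 g10 g20]; first exact: powR_ge0.
  pose f1 x := (g1 x * dual_weight p1 v1 x)%R.
  pose f2 x := (g2 x * dual_weight p2 v2 x)%R.
  have mf1 : measurable_fun setT f1.
    by apply: measurable_funM => //; exact: measurable_dual_weight.
  have mf2 : measurable_fun setT f2.
    by apply: measurable_funM => //; exact: measurable_dual_weight.
  have f10 x : (0 <= f1 x)%R by rewrite mulr_ge0// dual_weight_ge0.
  have f20 x : (0 <= f2 x)%R by rewrite mulr_ge0// dual_weight_ge0.
  have fg1 : {ae mu, forall x, f1 x = (g1 x * dual_weight p1 v1 x)%R}.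
    exact: nearW.
  have fg2 : {ae mu, forall x, f2 x = (g2 x * dual_weight p2 v2 x)%R}.
    exact: nearW.
  have := hC f1 f2 mf1 mf2 f10 f20.
  rewrite (H2B_dual mf1 mf2 mg1 mg2 g10 g20 fg1 fg2).
  rewrite (norm_dual p11 mv1 mf1 mg1 g10 v10 fg1).
  rewrite (norm_dual p21 mv2 mf2 mg2 g20 v20 fg2).
  set L := \int[mu]_x _; set N1 := \int[mu]_x _; set N2 := \int[mu]_x _ => h.
  have ng1 : nn_measurable (fun y => (g1 y)%:E) by exact: nn_measurable_EFin.
  have ng2 : nn_measurable (fun y => (g2 y)%:E) by exact: nn_measurable_EFin.
  have nF1 : nn_measurable (inner (fun y => (g1 y)%:E * w1 y)).
    by apply: nn_inner; nnm.
  have nF2 : nn_measurable (inner (fun y => (g2 y)%:E * w2 y)).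
    by apply: nn_inner; nnm.
  have L0 : 0 <= L by apply: nn_integral_ge0; nnm.
  have C0' : 0 <= C%:E by rewrite lee_fin.
  have := le_poweR (ltW q0) (poweR_ge0 _ _) h.
  rewrite poweRVK// poweRM ?mule_ge0// poweRM// poweR_EFin -!poweRrM.
  by rewrite ![(_^-1 * q)%R]mulrC.
exists (K `^ q^-1)%R => [|f1 f2 mf1 mf2 f10 f20]; first exact: powR_ge0.
have [mg1 g10 fg1] := quotientP p1 mv1 mf1 f10 v10.
have [mg2 g20 fg2] := quotientP p2 mv2 mf2 f20 v20.
have := hK _ _ mg1 mg2 g10 g20.
rewrite (H2B_dual mf1 mf2 mg1 mg2 g10 g20 fg1 fg2).
rewrite (norm_dual p11 mv1 mf1 mg1 g10 v10 fg1).
rewrite (norm_dual p21 mv2 mf2 mg2 g20 v20 fg2).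
set L := \int[mu]_x _; set N1 := \int[mu]_x _; set N2 := \int[mu]_x _ => h.
have ng1 := nn_measurable_EFin mg1 g10.
have ng2 := nn_measurable_EFin mg2 g20.
have nF1 : nn_measurable (inner (fun y => (quotient p1 v1 f1 y)%:E * w1 y)).
  by apply: nn_inner; nnm.
have nF2 : nn_measurable (inner (fun y => (quotient p2 v2 f2 y)%:E * w2 y)).
  by apply: nn_inner; nnm.
have nFF := nn_measurableM (nn_measurableM (nn_measurable_poweR q nF1)
  (nn_measurable_poweR q nF2)) nup.
have L0 : 0 <= L by exact: (nn_integral_ge0 mu setT nFF).
have K0' : 0 <= K%:E by rewrite lee_fin.
have qV0 : (0 <= q^-1)%R by rewrite invr_ge0 ltW.
have := le_poweR qV0 L0 h.
rewrite poweRM ?mule_ge0// poweRM// poweR_EFin -!poweRrM.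
have e (s : R) : (q / s * q^-1 = s^-1)%R by rewrite mulrAC mulfV// mul1r.
by rewrite !e.
Qed.

Lemma hardyD1P : hardyD1 mu a q p1 p2 u v1 v2 < +oo <->
  exists2 K : R, (0 <= K)%R & forall x,
    outer up x * inner w1 x `^ (q / p1^') * inner w2 x `^ (q / p2^') <= K%:E.
Proof.
rewrite /hardyD1 (hardyU_outer mu_ u0) !hardyV_inner.
pose f x := outer up x `^ q^-1 * inner w1 x `^ (p1^')^-1 * inner w2 x `^ (p2^')^-1.
have f0 x : 0 <= f x by rewrite mule_ge0// mule_ge0.
have fa : f a = 0.
  by rewrite /f inner_center poweR0r ?mule0 ?mul0e// gt_eqF// conjV_gt0.
have fE x : f x `^ q =
    outer up x * inner w1 x `^ (q / p1^') * inner w2 x `^ (q / p2^').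
  rewrite /f poweRM ?mule_ge0// poweRM// poweRVK ?lt0r_neq0//; last first.
    exact: nn_integral_ge0.
  by rewrite -!poweRrM ![(_^-1 * q)%R]mulrC.
apply: (iff_trans (sup_ltyP q0 f0 fa)).
by split=> -[K K0 hK]; exists K => // x; have := hK x; rewrite fE.
Qed.

Lemma hardy_supP (p r : R) (w t : X -> \bar R) : (1 < p)%R -> (0 < r)%R ->
  (forall x, 0 <= t x) ->
  ereal_sup [set inner w x `^ (p^')^-1 * t x `^ r^-1 | x in [set~ a]] < +oo <->
  exists2 K : R, (0 <= K)%R & forall x, t x * inner w x `^ (r / p^') <= K%:E.
Proof.
move=> p_gt1 r0 t0; pose f x := inner w x `^ (p^')^-1 * t x `^ r^-1.
have f0 x : 0 <= f x by rewrite mule_ge0.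
have fa : f a = 0.
  by rewrite /f inner_center poweR0r ?mul0e// gt_eqF// conjV_gt0.
have fE x : f x `^ r = t x * inner w x `^ (r / p^').
  rewrite /f poweRM// poweRVK ?lt0r_neq0// -poweRrM muleC.
  by rewrite [(_^-1 * r)%R]mulrC.
apply: (iff_trans (sup_ltyP r0 f0 fa)).
by split=> -[K K0 hK]; exists K => // x; have := hK x; rewrite fE.
Qed.

Hypotheses (bf1 : forall t : R,
    \int[mu]_(x in [set x | (rho x < t)%R]) (dual_weight p1 v1 x)%:E < +oo)
  (bf2 : forall t : R,
    \int[mu]_(x in [set x | (rho x < t)%R]) (dual_weight p2 v2 x)%:E < +oo).

Let fin1 : ball_finite mu rho w1. Proof. exact: bf1. Qed.
Let fin2 : ball_finite mu rho w2. Proof. exact: bf2. Qed.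
Let pos1 : {ae mu, forall x, 0 < w1 x}.
Proof. by apply: filterS (dual_weight_gt0_ae p1 v10) => x; rewrite lte_fin. Qed.
Let pos2 : {ae mu, forall x, 0 < w2 x}.
Proof. by apply: filterS (dual_weight_gt0_ae p2 v20) => x; rewrite lte_fin. Qed.

Local Notation tail r w := (outer (fun y =>
  outer up y `^ (r / q) * inner w y `^ (r / q^') * w y)).

Let nn_tail r w : nn_measurable w -> nn_measurable (tail r w).
Proof.
move=> nw; have nU := nn_measurable_outer mu mrho nup; have nV := nn_inner nw.
by apply: nn_measurable_outer => //; nnm.
Qed.

Lemma hardyD2P r2 : (0 < r2)%R -> hardyD2 mu a q p1 p2 r2 u v1 v2 < +oo <->
  exists2 K : R, (0 <= K)%R & forall x,
    tail r2 w2 x * inner w1 x `^ (r2 / p1^') <= K%:E.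
Proof.
move=> r20; rewrite /hardyD2 (hardy_tail_outer _ _ _ _ mu_ u0) hardyV_inner.
apply: hardy_supP => // x; exact: (nn_measurable_ge0 x (nn_tail r2 nw2)).
Qed.

Lemma hardyD3P r1 : (0 < r1)%R -> hardyD3 mu a q p1 p2 r1 u v1 v2 < +oo <->
  exists2 K : R, (0 <= K)%R & forall x,
    tail r1 w1 x * inner w2 x `^ (r1 / p2^') <= K%:E.
Proof.
move=> r10; rewrite /hardyD3 (hardy_tail_outer _ _ _ _ mu_ u0) hardyV_inner.
apply: hardy_supP => // x; exact: (nn_measurable_ge0 x (nn_tail r1 nw1)).
Qed.

Lemma hardyD4P k : (0 < k)%R -> hardyD4 mu a p1 p2 k u v1 v2 < +oo <->
  \int[mu]_x (outer up x `^ (k / p1 + k / p2) * inner w1 x `^ (k / p1^') *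
    inner w2 x `^ (k / p2^') * up x) < +oo.
Proof.
move=> k0; rewrite /hardyD4 (hardyU_outer mu_ u0) !hardyV_inner.
have nU := nn_measurable_outer mu mrho nup.
have nV1 := nn_inner nw1; have nV2 := nn_inner nw2.
pose h x := outer up x `^ (k / p1 + k / p2) * inner w1 x `^ (k / p1^') *
  inner w2 x `^ (k / p2^').
have nh : nn_measurable h by rewrite /h; nnm.
have nhu := nn_measurableM nh nup.
have -> : \int[mu]_x (outer up x `^ (k / p1 + k / p2) * inner w1 x `^ (k / p1^') *
    inner w2 x `^ (k / p2^') * (u x)%:E) = \int[mu]_x (h x * up x).
  apply: ae_eq_integral => //.
  - apply: emeasurable_funM; first exact: (nn_measurableW nh).
    exact/measurable_EFinP.
  - exact: (nn_measurableW nhu).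
  - by apply: filterS u0 => x ux _; rewrite /pos_part max_l// ltW.
by apply: poweRV_ltyP => //; exact: (nn_integral_ge0 mu setT nhu).
Qed.

Lemma hardyD5P r2 k : (0 < k)%R -> hardyD5 mu a q p1 p2 r2 k u v1 v2 < +oo <->
  \int[mu]_x (tail r2 w2 x `^ (k / r2) * inner w1 x `^ (k / r2^') * w1 x) < +oo.
Proof.
move=> k0; rewrite /hardyD5 (hardy_tail_outer _ _ _ _ mu_ u0) hardyV_inner.
have nt := nn_tail r2 nw2; have nV1 := nn_inner nw1.
apply: poweRV_ltyP => //; apply: nn_integral_ge0.
exact: (nn_measurableM (nn_measurableM (nn_measurable_poweR _ nt)
  (nn_measurable_poweR _ nV1)) nw1).
Qed.

Lemma hardyD6P r1 k : (0 < k)%R -> hardyD6 mu a q p1 p2 r1 k u v1 v2 < +oo <->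
  \int[mu]_x (tail r1 w1 x `^ (k / r1) * inner w2 x `^ (k / r1^') * w2 x) < +oo.
Proof.
move=> k0; rewrite /hardyD6 (hardy_tail_outer _ _ _ _ mu_ u0) hardyV_inner.
have nt := nn_tail r1 nw1; have nV2 := nn_inner nw2.
apply: poweRV_ltyP => //; apply: nn_integral_ge0.
exact: (nn_measurableM (nn_measurableM (nn_measurable_poweR _ nt)
  (nn_measurable_poweR _ nV2)) nw2).
Qed.

Lemma D1_sym (K : R) :
  (forall x, outer up x * inner w1 x `^ (q / p1^') * inner w2 x `^ (q / p2^')
    <= K%:E) ->
  forall x, outer up x * inner w2 x `^ (q / p2^') * inner w1 x `^ (q / p1^')
    <= K%:E.
Proof. by move=> hK x; rewrite muleAC. Qed.

Lemma hardy_case_i : (p1 <= q)%R -> (p2 <= q)%R ->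
  bilinear_hardy mu a q p1 p2 u v1 v2 <->
  hardyD1 mu a q p1 p2 u v1 v2 < +oo.
Proof.
move=> p1q p2q; have q1 : (1 < q)%R by exact: lt_le_trans p1q.
split=> [/bilinear_hardyP[K K0 hK]|/hardyD1P[K K0 hK]].
  apply/hardyD1P; exists K => //.
  exact: (bilinear_bound_D1 mrho q1 p11 p21 nup nw1 nw2 fin1 fin2 K0 hK).
apply/bilinear_hardyP.
have [c c0 hc] := term_bound_le mrho sphere0 p11 p21 nup nw1 nw2 fin1 fin2 p1q K0 hK.
have [c' c'0 hc'] := term_bound_le mrho sphere0 p21 p11 nup nw2 nw1 fin2 fin1
  p2q K0 (D1_sym hK).
exact: (bilinear_bound_suff mrho sphere0 q1 p11 p21 nup nw1 nw2 fin1 fin2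
  c0 c'0 hc hc').
Qed.

Lemma hardy_case_ii r2 : (p1 <= q)%R -> (q < p2)%R -> (r2^-1 = q^-1 - p2^-1)%R ->
  bilinear_hardy mu a q p1 p2 u v1 v2 <->
  hardyD1 mu a q p1 p2 u v1 v2 < +oo /\ hardyD2 mu a q p1 p2 r2 u v1 v2 < +oo.
Proof.
move=> p1q qp2 rE; have q1 : (1 < q)%R by exact: lt_le_trans p1q.
have qr2 := harmonic_gap_gt q0 (lt_trans q0 qp2) qp2 rE.
have r20 : (0 < r2)%R by exact: lt_trans qr2.
split=> [/bilinear_hardyP[K K0 hK]|[/hardyD1P[K K0 hK] /(hardyD2P r20)[L L0 hL]]].
  split; first apply/hardyD1P; last apply/(hardyD2P r20).
    exists K => //.
    exact: (bilinear_bound_D1 mrho q1 p11 p21 nup nw1 nw2 fin1 fin2 K0 hK).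
  exact: (bilinear_bound_D2 mrho sphere0 q1 p11 p21 nup nw1 nw2 fin1 fin2
    pos1 pos2 K0 hK qp2 rE).
apply/bilinear_hardyP.
have p1r2 : (p1 <= r2)%R by rewrite (le_trans p1q)// ltW.
have [c c0 hc] := term_bound_le mrho sphere0 p11 p21 nup nw1 nw2 fin1 fin2 p1q K0 hK.
have [c' c'0 hc'] := term_bound_lt_le mrho sphere0 q1 p11 nup nw2 nw1 fin2 fin1
  qp2 rE p1r2 L0 hL.
exact: (bilinear_bound_suff mrho sphere0 q1 p11 p21 nup nw1 nw2 fin1 fin2
  c0 c'0 hc hc').
Qed.

Lemma hardy_case_iii r1 r2 : (q < p1)%R -> (q < p2)%R -> (1 < q)%R ->
  (q^-1 <= p1^-1 + p2^-1)%R ->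
  (r1^-1 = q^-1 - p1^-1)%R -> (r2^-1 = q^-1 - p2^-1)%R ->
  bilinear_hardy mu a q p1 p2 u v1 v2 <->
  [/\ hardyD1 mu a q p1 p2 u v1 v2 < +oo,
      hardyD2 mu a q p1 p2 r2 u v1 v2 < +oo &
      hardyD3 mu a q p1 p2 r1 u v1 v2 < +oo].
Proof.
move=> qp1 qp2 q1 qpp r1E r2E.
have p10 := lt_trans q0 qp1; have p20 := lt_trans q0 qp2.
have qr1 := harmonic_gap_gt q0 p10 qp1 r1E.
have qr2 := harmonic_gap_gt q0 p20 qp2 r2E.
have r10 : (0 < r1)%R by exact: lt_trans qr1.
have r20 : (0 < r2)%R by exact: lt_trans qr2.
split=> [/bilinear_hardyP[K K0 hK]|
    [_ /(hardyD2P r20)[K K0 hK] /(hardyD3P r10)[L L0 hL]]].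
  split; [apply/hardyD1P|apply/(hardyD2P r20)|apply/(hardyD3P r10)].
  - exists K => //.
    exact: (bilinear_bound_D1 mrho q1 p11 p21 nup nw1 nw2 fin1 fin2 K0 hK).
  - exact: (bilinear_bound_D2 mrho sphere0 q1 p11 p21 nup nw1 nw2 fin1 fin2
      pos1 pos2 K0 hK qp2 r2E).
  - exact: (bilinear_bound_D2 mrho sphere0 q1 p21 p11 nup nw2 nw1 fin2 fin1
      pos2 pos1 K0 (bilinear_bound_sym hK) qp1 r1E).
apply/bilinear_hardyP.
have p1r2 : (p1 <= r2)%R by rewrite -lef_pV2 ?posrE// r2E; lra.
have p2r1 : (p2 <= r1)%R by rewrite -lef_pV2 ?posrE// r1E; lra.
have [c c0 hc] := term_bound_lt_le mrho sphere0 q1 p21 nup nw1 nw2 fin1 fin2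
  qp1 r1E p2r1 L0 hL.
have [c' c'0 hc'] := term_bound_lt_le mrho sphere0 q1 p11 nup nw2 nw1 fin2 fin1
  qp2 r2E p1r2 K0 hK.
exact: (bilinear_bound_suff mrho sphere0 q1 p11 p21 nup nw1 nw2 fin1 fin2
  c0 c'0 hc hc').
Qed.

Lemma hardy_case_iv r1 r2 k : (q < p1)%R -> (q < p2)%R -> (1 < q)%R ->
  (p1^-1 + p2^-1 < q^-1)%R ->
  (r1^-1 = q^-1 - p1^-1)%R -> (r2^-1 = q^-1 - p2^-1)%R ->
  (k^-1 = q^-1 - p1^-1 - p2^-1)%R ->
  bilinear_hardy mu a q p1 p2 u v1 v2 <->
  [/\ hardyD4 mu a p1 p2 k u v1 v2 < +oo,
      hardyD5 mu a q p1 p2 r2 k u v1 v2 < +oo &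
      hardyD6 mu a q p1 p2 r1 k u v1 v2 < +oo].
Proof.
move=> qp1 qp2 q1 qpp r1E r2E kE.
have p10 := lt_trans q0 qp1; have p20 := lt_trans q0 qp2.
have qr1 := harmonic_gap_gt q0 p10 qp1 r1E.
have qr2 := harmonic_gap_gt q0 p20 qp2 r2E.
have r10 : (0 < r1)%R by exact: lt_trans qr1.
have r20 : (0 < r2)%R by exact: lt_trans qr2.
have k0 : (0 < k)%R by rewrite -invr_gt0 kE; lra.
have r1p2 : (r1 < p2)%R by rewrite -ltf_pV2 ?posrE// r1E; lra.
have r2p1 : (r2 < p1)%R by rewrite -ltf_pV2 ?posrE// r2E; lra.
have k1E : (k^-1 = r1^-1 - p2^-1)%R by rewrite kE r1E.
have k2E : (k^-1 = r2^-1 - p1^-1)%R by rewrite kE r2E; ring.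
split=> [/bilinear_hardyP[K K0 hK]|[_ /(hardyD5P _ k0) h5 /(hardyD6P _ k0) h6]].
  split; [apply/(hardyD4P k0)|apply/(hardyD5P _ k0)|apply/(hardyD6P _ k0)].
  - exact: (bilinear_bound_D4 mrho sphere0 q1 p11 p21 nup nw1 nw2 fin1 fin2
      pos1 pos2 K0 hK qp1 r1E r1p2 k1E).
  - exact: (bilinear_bound_D6 mrho sphere0 q1 p21 p11 nup nw2 nw1 fin2 fin1
      pos2 pos1 K0 (bilinear_bound_sym hK) qp2 r2E r2p1 k2E).
  - exact: (bilinear_bound_D6 mrho sphere0 q1 p11 p21 nup nw1 nw2 fin1 fin2
      pos1 pos2 K0 hK qp1 r1E r1p2 k1E).
apply/bilinear_hardyP.
have [c c0 hc] := term_bound_lt_lt mrho sphere0 q1 nup nw1 nw2 fin1 fin2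
  qp1 r1E r1p2 k1E h6.
have [c' c'0 hc'] := term_bound_lt_lt mrho sphere0 q1 nup nw2 nw1 fin2 fin1
  qp2 r2E r2p1 k2E h5.
exact: (bilinear_bound_suff mrho sphere0 q1 p11 p21 nup nw1 nw2 fin1 fin2
  c0 c'0 hc hc').
Qed.

End weights.
End transfer.

Local Close Scope ereal_scope.

(** * The characterization *)

Theorem theorem4p2 (d : measure_display) (R : realType)
  (X : borelMetricType d R) (mu : {measure set X -> \bar R}) (a : X)
  (polar : polar_decomposition mu a)
  (q p1 p2 : R) (q_gt0 : 0 < q) (p1_gt1 : 1 < p1) (p2_gt1 : 1 < p2)
  (u v1 v2 : X -> R)
  (mu_u : measurable_fun setT u) (mv1 : measurable_fun setT v1)
  (mv2 : measurable_fun setT v2)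
  (u_gt0 : {ae mu, forall x, 0 < u x})
  (v1_gt0 : {ae mu, forall x, 0 < v1 x})
  (v2_gt0 : {ae mu, forall x, 0 < v2 x})
  (u_loc : metric_locally_integrable mu [set~ a] u)
  (v1_loc : metric_locally_integrable mu setT (dual_weight p1 v1))
  (v2_loc : metric_locally_integrable mu setT (dual_weight p2 v2)) :
  [/\ 1 < Num.max p1 p2 <= q ->
      (bilinear_hardy mu a q p1 p2 u v1 v2 <->
        (hardyD1 mu a q p1 p2 u v1 v2 < +oo)%E),
      forall r2 : R, p1 <= q -> q < p2 -> 1 < q ->
      r2^-1 = q^-1 - p2^-1 ->
      (bilinear_hardy mu a q p1 p2 u v1 v2 <->
        (hardyD1 mu a q p1 p2 u v1 v2 < +oo)%E /\
        (hardyD2 mu a q p1 p2 r2 u v1 v2 < +oo)%E),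
      forall r1 r2 : R, q < p1 -> q < p2 -> 1 < q ->
      q^-1 <= p1^-1 + p2^-1 ->
      r1^-1 = q^-1 - p1^-1 -> r2^-1 = q^-1 - p2^-1 ->
      (bilinear_hardy mu a q p1 p2 u v1 v2 <->
        [/\ (hardyD1 mu a q p1 p2 u v1 v2 < +oo)%E,
            (hardyD2 mu a q p1 p2 r2 u v1 v2 < +oo)%E &
            (hardyD3 mu a q p1 p2 r1 u v1 v2 < +oo)%E]) &
      forall r1 r2 k : R, q < p1 -> q < p2 -> 1 < q ->
      p1^-1 + p2^-1 < q^-1 ->
      r1^-1 = q^-1 - p1^-1 -> r2^-1 = q^-1 - p2^-1 ->
      k^-1 = q^-1 - p1^-1 - p2^-1 ->
      (bilinear_hardy mu a q p1 p2 u v1 v2 <->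
        [/\ (hardyD4 mu a p1 p2 k u v1 v2 < +oo)%E,
            (hardyD5 mu a q p1 p2 r2 k u v1 v2 < +oo)%E &
            (hardyD6 mu a q p1 p2 r1 k u v1 v2 < +oo)%E])].
Proof.
have mu_fin : sigma_finite setT mu.
  exact: (weight_sigma_finite (measurable_dual_weight p1 mv1)
    (dual_weight_ge0 p1 v1) (dual_weight_gt0_ae p1 v1_gt0)
    (fun t => dual_weight_ball_fin a t v1_loc)).
have sphere0 r := polar_sphere_null r mu_fin polar.
have bf1 t := dual_weight_ball_fin a t v1_loc.
have bf2 t := dual_weight_ball_fin a t v2_loc.
have [nu nuE] := sigma_finite_measure_ex mu_fin.
move: sphere0 bf1 bf2 u_gt0 v1_gt0 v2_gt0.
rewrite nuE => sphere0 bf1 bf2 u_gt0' v1_gt0' v2_gt0'; split.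
- rewrite ge_max => /andP[_ /andP[p1q p2q]].
  exact: hardy_case_i.
- move=> r2 p1q qp2 q1 r2E.
  exact: hardy_case_ii.
- move=> r1 r2 qp1 qp2 q1 qpp r1E r2E.
  exact: hardy_case_iii.
move=> r1 r2 k qp1 qp2 q1 qpp r1E r2E kE.
exact: hardy_case_iv.
Qed.
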